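(* Let $X$ be a diffusion as in the context, with scale function $S$ and with Lévy measure $\nu$ of the inverse local time at $0$ satisfying the subexponentiality assumption (A). Let $H_0:=\inf\{t: X_t=0\}$. Then for any $x>0$, $$\lim_{t\to+\infty}\frac{\mathbf{P}_x(H_0>t)}{S(x)\,\nu((t,+\infty))}=1 .$$
   Context: Setting. $X$ is a linear regular recurrent diffusion taking values in $\mathbb{R}_+=[0,\infty)$, with $0$ an instantaneously reflecting boundary and $+\infty$ a natural boundary. $\mathbf{P}_x$ and $\mathbf{E}_x$ are the probability measure and expectation when $X$ starts from $x\ge 0$. $X$ is defined on the canonical space of continuous functions $\omega:\mathbb{R}_+\to\mathbb{R}_+$. $m$ is the speed measure and $S$ the scale function of $X$ (generator $\frac{d}{dm}\frac{d}{dS}$); $S$ is normalized by $S(0)=0$, $S(+\infty)=+\infty$ by recurrence, and $m$ has no atoms. $p(t;x,y)$ is the jointly continuous symmetric transition density of $X$ with respect to $m$, i.e. $\mathbf{P}_x(X_t\in A)=\int_A p(t;x,y)\,m(dy)$, and $R_\lambda(x,y)=\int_0^\infty e^{-\lambda t}p(t;x,y)\,dt$ for $\lambda>0$. Local time. $L_t$ is the local time of $X$ at $0$, normalized by $L_t=\lim_{\delta\downarrow0}\frac{1}{m((0,\delta))}\int_0^t \mathbf{1}_{[0,\delta)}(X_s)\,ds$. Its right-continuous inverse $\tau_\ell:=\inf\{s:L_s>\ell\}$, $\ell\ge0$, is a subordinator under $\mathbf{P}_0$ (without drift), and its Lévy measure $\nu$ is given by $$\mathbf{E}_0(e^{-\lambda\tau_\ell})=\exp(-\ell/R_\lambda(0,0))=\exp\Big(-\ell\int_0^\infty(1-e^{-\lambda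 v})\,\nu(dv)\Big).$$ Assumption (A). The probability distribution function $x\mapsto \nu((1,x])/\nu((1,+\infty))$, $x>1$ (equal to $0$ for $x\le1$), is subexponential. Here a distribution function $F$ on $(0,\infty)$ with $F(0+)=0$, $F(x)<1$ for all $x>0$, $\lim_{x\to\infty}F(x)=1$ is subexponential if $\lim_{x\to\infty}\overline{F*F}(x)/\overline F(x)=2$, with $\overline F=1-F$ and $*$ convolution. *)

(* Defs.v *)
From HB Require Import structures.
From mathcomp Require Import all_boot all_order all_algebra.
From mathcomp Require Import all_classical all_reals all_analysis.
From mathcomp Require Import measurable_realfun.
Set Implicit Arguments.
Unset Strict Implicit.
Unset Printing Implicit Defensive.
Import Order.TTheory GRing.Theory Num.Theory.
Import numFieldNormedType.Exports.
Local Open Scope classical_set_scope.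
Local Open Scope ring_scope.

(** The canonical space C(R_+, R_+). The time and state half-lines are viewed
    inside [R]: a path is extended to negative times by its value at 0, so that
    each element of C(R_+, R_+) is represented exactly once. *)
Record path (R : realType) := Path {
  path_fun :> R -> R ;
  path_continuous : continuous path_fun ;
  path_ge0 : forall t, 0 <= path_fun t ;
  path_neg : forall t, t <= 0 -> path_fun t = path_fun 0 }.

Section canonical_space.
Context (R : realType).

HB.instance Definition _ := gen_eqMixin (path R).
HB.instance Definition _ := gen_choiceMixin (path R).

Definition null_path : path R :=
  @Path R (cst 0) (@cst_continuous R R 0) (fun=> lexx 0) (fun _ _ => erefl).

HB.instance Definition _ := isPointed.Build (path R) null_path.

Lemma shift_continuous (u : R) (w : path R) :
  continuous (fun t : R => w (u + Num.max 0 t)).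
Proof.
move=> t; apply: (@continuous_comp _ _ _ (fun t : R => u + Num.max 0 t) w);
  last exact: path_continuous.
apply: cvgD; first exact: cvg_cst.
by apply: (@continuous_max R R (cst 0) id); [exact: cvg_cst | exact: cvg_id].
Qed.

Lemma shift_neg (u : R) (w : path R) (t : R) : t <= 0 ->
  w (u + Num.max 0 t) = w (u + Num.max 0 0).
Proof. by move=> t0; rewrite maxxx max_l. Qed.

(** [shift u] is theta_u for 0 <= u. *)
Definition shift (u : R) (w : path R) : path R :=
  @Path R _ (@shift_continuous u w) (fun t => path_ge0 w _) (@shift_neg u w).

Definition cylinders (I : set R) : set (set (path R)) :=
  [set B | exists (t : R) (A : set R),
    [/\ I t, measurable A & B = [set w : path R | A (w t)]]].

Definition path_space := g_sigma_algebraType (cylinders [set t | 0 <= t]).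

Definition X (t : R) (w : path_space) : R := path_fun w t.

Definition past (t : R) : set (set path_space) :=
  <<s cylinders [set s | 0 <= s <= t] >>.

(** Markov times of the right-continuous filtration, and its sigma-field
    at such a time (Ito--McKean convention, with strict inequalities). *)
Definition markov_time (T : path_space -> \bar R) :=
  (forall w, (0 <= T w)%E) /\
  (forall t, 0 <= t -> past t [set w | (T w < t%:E)%E]).

Definition past_at (T : path_space -> \bar R) (A : set path_space) :=
  measurable A /\
  (forall t, 0 <= t -> past t (A `&` [set w | (T w < t%:E)%E])).

Definition hit (y : R) (w : path_space) : \bar R :=
  ereal_inf [set t%:E | t in [set t | 0 <= t /\ X t w = y]].

End canonical_space.

Section diffusion.
Context (R : realType).
Implicit Types (m : {measure set R -> \bar R}) (S : cumulative R R).
Implicit Types (P : R -> probability (path_space R) R).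

(** [P x] is only meaningful for [0 <= x]. *)
Record strong_markov P : Prop := {
  sm_kernel : forall B : set (path_space R), measurable B ->
    measurable_fun (`[0, +oo[ : set R) (P ^~ B) ;
  sm_start : forall x, 0 <= x -> P x [set w | X 0 w = x] = 1%E ;
  sm_markov : forall x, 0 <= x ->
    forall T : path_space R -> \bar R, markov_time T ->
    forall A B : set (path_space R), past_at T A -> measurable B ->
    let A' := A `&` [set w | (T w < +oo)%E] in
    P x (A' `&` [set w | B (shift (fine (T w)) w)]) =
    (\int[P x]_(w in A') P (X (fine (T w)) w) B)%E }.

Definition regular P := forall x y, 0 <= x -> 0 <= y ->
  (0 < P x [set w | hit y w < +oo])%E.

Definition recurrent P := forall x y, 0 <= x -> 0 <= y ->
  P x [set w | (hit y w < +oo)%E] = 1%E.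

(** The scale function is set to 0 on the negative half-line, which makes
    [lebesgue_stieltjes_measure S] the measure dS on the state space. *)
Record scale_function S P : Prop := {
  scale_neg : forall x, x < 0 -> S x = 0 ;
  scale_0 : S 0 = 0 ;
  scale_lt : forall x y, 0 <= x -> x < y -> S x < S y ;
  scale_continuous : continuous S ;
  scale_pinfty : S x @[x --> +oo] --> +oo ;
  scale_hit : forall a x b, 0 <= a -> a <= x -> x <= b -> a < b ->
    P x [set w | (hit a w < hit b w)%E] = ((S b - S x) / (S b - S a))%:E }.

(** The absence of atoms includes m({0}) = 0 (instantaneous reflection), and
    finiteness of m near 0 makes 0 a regular boundary point. *)
Record speed_measure m : Prop := {
  speed_neg : m `]-oo, 0[%classic = 0%E ;
  speed_fin : forall b, (m `[0%R, b]%classic < +oo)%E ;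
  speed_gt0 : forall a b, 0 <= a -> a < b -> (0 < m `]a, b[%classic)%E ;
  speed_atom : forall x, m [set x] = 0%E }.

(** Feller's classification: +oo is natural when it is neither an exit
    (first integral finite) nor an entrance (second integral finite). *)
Definition natural_pinfty m S := forall z : R, 0 < z ->
  (\int[lebesgue_stieltjes_measure S]_(x in `]z, +oo[)
     m `]z, x[%classic = +oo)%E /\
  (\int[lebesgue_stieltjes_measure S]_(x in `]z, +oo[)
     m `]x, +oo[%classic = +oo)%E.

Definition bounded_continuous (f : R -> R) :=
  {within `[0, +oo[, continuous f} /\
  exists M, forall x, 0 <= x -> `|f x| <= M.

(** [generator P f g]: f is in the domain of the generator of X on C_b(R_+),
    with image g. As the semigroup need not be strongly continuous on
    C_b(R_+), convergence is pointwise with bounded difference quotients. *)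
Definition generator P (f g : R -> R) :=
  let quotient t x := ((\int[P x]_w f (X t w)) - f x) / t in
  [/\ bounded_continuous f, bounded_continuous g,
      exists M, forall t x, 0 < t -> 0 <= x -> `|quotient t x| <= M &
      forall x, 0 <= x -> quotient t x @[t --> 0^'+] --> g x].

Definition d_dS S (f Df : R -> R) :=
  let quotient x y := (f y - f x) / (S y - S x) in
  (forall x, 0 < x -> quotient x y @[y --> x^'] --> Df x) /\
  quotient 0 y @[y --> 0^'+] --> Df 0.

Definition d_dm m (D g : R -> R) := forall x y, 0 <= x -> x <= y ->
  D y - D x = \int[m]_(z in `]x, y]) g z.

(** The operator d/dm d/dS with the reflecting condition df/dS(0) = 0. *)
Definition d_dm_d_dS m S (f g : R -> R) :=
  [/\ bounded_continuous f, bounded_continuous g &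
      exists Df, [/\ d_dS S f Df, d_dm m Df g & Df 0 = 0]].

Record reflected_diffusion m S P : Prop := {
  diff_markov : strong_markov P ;
  diff_regular : regular P ;
  diff_recurrent : recurrent P ;
  diff_scale : scale_function S P ;
  diff_speed : speed_measure m ;
  diff_natural : natural_pinfty m S ;
  diff_generator : forall f g, generator P f g <-> d_dm_d_dS m S f g }.

Record transition_density m P (p : R -> R -> R -> R) : Prop := {
  density_continuous :
    {within [set z : R * R * R | [/\ 0 < z.1.1, 0 <= z.1.2 & 0 <= z.2]],
      continuous (fun z : R * R * R => p z.1.1 z.1.2 z.2)} ;
  density_sym : forall t x y, 0 < t -> 0 <= x -> 0 <= y ->
    p t x y = p t y x ;
  density_prob : forall t x, 0 < t -> 0 <= x ->
    forall A : set R, measurable A -> A `<=` `[0, +oo[ ->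
    P x [set w | A (X t w)] = (\int[m]_(y in A) (p t x y)%:E)%E }.

Definition green (p : R -> R -> R -> R) (lambda x y : R) : \bar R :=
  (\int[lebesgue_measure]_(t in `]0%R, +oo[)
     (expR (- (lambda * t)) * p t x y)%:E)%E.

Definition local_time m P (L : R -> path_space R -> R) :=
  forall x, 0 <= x -> {ae P x, forall w, forall t, 0 <= t ->
    (\int[lebesgue_measure]_(s in `[0, t]) \1_(`[0, delta[) (X s w))
      / fine (m `]0, delta[%classic) @[delta --> 0^'+] --> L t w}.

Definition inverse_local_time (L : R -> path_space R -> R) (l : R)
    (w : path_space R) : \bar R :=
  ereal_inf [set s%:E | s in [set s | 0 <= s /\ l < L s w]].

(** [fine] is harmless: R_lambda(0, 0) is finite and positive. The value
    +oo of the inverse local time contributes 0 to the expectations. *)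
Record levy_measure P (p : R -> R -> R -> R) (L : R -> path_space R -> R)
    (nu : {measure set R -> \bar R}) : Prop := {
  levy_support : nu `]-oo, 0]%classic = 0%E ;
  levy_green : forall l lambda : R, 0 <= l -> 0 < lambda ->
    (\int[P 0%R]_w expeR (- (lambda%:E * inverse_local_time L l w)) =
     (expR (- (l / fine (green p lambda 0 0))))%:E)%E ;
  levy_exponent : forall l lambda : R, 0 <= l -> 0 < lambda ->
    (\int[P 0%R]_w expeR (- (lambda%:E * inverse_local_time L l w)) =
     expeR (- (l%:E * \int[nu]_(v in `]0%R, +oo[)
                        (1 - expR (- (lambda * v)))%:E)))%E }.

(** [mu] is the law with distribution function [F], i.e. the measure dF, and
    the integral below is (F * F)(x). *)
Definition subexponential (F : R -> R) :=
  exists mu : probability R R,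
  [/\ forall x, mu `]-oo, x]%classic = (F x)%:E,
      (forall x, x <= 0 -> F x = 0) /\ F x @[x --> 0^'+] --> (0 : R),
      forall x, 0 < x -> F x < 1,
      F x @[x --> +oo] --> (1 : R) &
      (1 - \int[mu]_y F (x - y)) / (1 - F x) @[x --> +oo] --> (2 : R)].

(** For x <= 1 the interval ]1, x] is empty and the value is 0. *)
Definition normalized_levy (nu : {measure set R -> \bar R}) (x : R) : R :=
  fine (nu `]1, x]%classic) / fine (nu `]1, +oo[%classic).

End diffusion.

(* Main.v *)
(* Write nubar(t) = nu(]t, oo[) and a_t(y) = P_y(t < H_0). The strong Markov
   property at the hitting times of points shows that a_t(y) / S(y) is
   nonincreasing in y. Resolvents of approximate Dirac masses at 0, computed
   from the equation (l - d/dm d/dS) u = f, give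
     (1 - E_y e^(- l H_0)) / S(y) --> 1 / R_l(0, 0) = int (1 - e^(- l v)) nu(dv)
   as y --> 0+. Taking differences, E_y g(H_0) / S(y) --> int g dnu for
   g(v) = (1 - e^(- n v))^k, and these functions approximate the indicators of
   half-lines, so that for 0 < a < b
     a_b(y) <= S(y) nubar(a)   and   liminf_(y --> 0+) a_a(y) / S(y) >= nubar(b).
   Hence a_t(x) <= S(x) nubar(t - 1). Conversely, a path from y close to 0 that
   survives for a long time either visits x before 0, or stays below x during a
   time r + 2 and is then dominated by a path from x, which leads to
     nubar(t + r + 3) <= a_t(x) / S(x) + nubar(1/4) a_r(x) a_t(x),
   where a_r(x) --> 0 as r --> oo. Subexponential laws are long-tailed, that is
   nubar(t - s) / nubar(t) --> 1, so both bounds give the same limit. *)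
From Pilot Require Import Defs.
From HB Require Import structures.
From mathcomp Require Import all_boot all_order all_algebra.
From mathcomp Require Import all_classical all_reals all_analysis.
From mathcomp Require Import measurable_realfun lra ring.
Import Order.TTheory GRing.Theory Num.Theory.
Import numFieldNormedType.Exports.
Local Open Scope classical_set_scope.
Local Open Scope ring_scope.

Set Implicit Arguments.
Unset Strict Implicit.
Unset Printing Implicit Defensive.

(** * Hitting times on the path space *)

(** The hypotheses describe the reflected process only, so E_y e^(- l H_0) is reached through it.
    The resolvent u of a bump near 0 solves a second-order equation whose flux du/dS drops from 0 to
    about -1 across the bump, while the strong Markov property makes u proportional to y |-> E_y
    e^(- l H_0) beyond the bump. Together they squeeze u(0) around S(y) / (1 - E_y e^(- l H_0)). The
    delicate point is to identify the limit of u(0) with R_l(0, 0): nothing bounds p(t; 0, 0) a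
    priori as t --> 0. Fatou's lemma gives one inequality; the other needs uniform integrability in
    time, obtained from the upper bounds on potentials at other rates. As nu may have infinite mass
    near 0, errors in the approximation of indicators are measured against 1 - e^(- v), which nu
    integrates. Indicators are approximated only up to a gap a < b; these gaps and the waiting time
    r + 3 are time shifts that do not depend on t, and long-tailedness absorbs them. *)

Section paths.
Context (R : realType).
Implicit Types (s t y : R) (w : path_space R) (A : set R).

Lemma measurable_X t : measurable_fun [set: path_space R] (X t).
Proof.
move=> _ A mA; rewrite setTI; apply: sub_sigma_algebra.
have [t0|t0] := leP 0 t; first by exists t, A.
exists 0, A; split=> //=; apply/seteqP; split => w /=;
  by rewrite /X /preimage /= (path_neg w (ltW t0)).
Qed.

Lemma X_cvg w (u : R^nat) t : u n @[n --> \oo] --> t -> X (u n) w @[n --> \oo] --> X t w.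
Proof. by move=> ut; apply: (cvg_comp _ _ ut); exact: path_continuous. Qed.

(** Rounding the time down to a multiple of 1 / (n + 1) leaves countably many time slabs, on each of
    which a single coordinate matters, so preimages are countable unions of rectangles. Continuity
    of paths passes to the limit. *)
Lemma measurable_X_pair :
  measurable_fun setT (fun z : R * path_space R => X z.1 z.2).
Proof.
pose grid n (t : R) : R := (Num.floor (t * n.+1%:R))%:~R / n.+1%:R.
apply: (@measurable_fun_cvg _ _ _ _ (fun n z => X (grid n z.1) z.2)) => //.
- move=> n _ A mA; rewrite setTI.
  rewrite [X in measurable X](_ : _ = \bigcup_(k : int)
    (((fun t : R => Num.floor (t * n.+1%:R)) @^-1` [set k]) `*`
      ((X (k%:~R / n.+1%:R)) @^-1` A))); last first.
    apply/seteqP; split=> [[t w] /= Aw|[t w] [k _ [/= <-]]] //.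
    by exists (Num.floor (t * n.+1%:R)).
  apply: countable_bigcupT_measurable => [|k]; first exact: countableP.
  apply: measurableX; last first.
    by rewrite -[X in measurable X]setTI; exact: measurable_X.
  rewrite [X in measurable X](_ : _ =
    [set t : R | k%:~R / n.+1%:R <= t < (k + 1)%:~R / n.+1%:R]); last first.
    apply/seteqP; split=> t /=.
      by move=> /eqP; rewrite floor_eq ler_pdivrMr ?ltr0n// ltr_pdivlMr ?ltr0n.
    move=> h; apply/eqP; rewrite floor_eq; move: h.
    by rewrite ler_pdivrMr ?ltr0n// ltr_pdivlMr ?ltr0n.
  rewrite (_ : mkset _ = `[k%:~R / n.+1%:R, (k + 1)%:~R / n.+1%:R[%classic).
    exact: measurable_itv.
  by apply/seteqP; split=> t /=; rewrite in_itv.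
- move=> [t w] _ /=; apply: X_cvg.
  apply/cvgrPdist_le => e e0; near=> n.
  have n0 : (0 : R) < n.+1%:R by rewrite ltr0n.
  have /andP[h1 h2] := floor_itv (t * n.+1%:R).
  have h3 : grid n t <= t by rewrite /grid ler_pdivrMr.
  rewrite ger0_norm ?subr_ge0//.
  have h4 : t < grid n t + n.+1%:R^-1.
    rewrite /grid -[X in _ + X]mul1r -mulrDl ltr_pdivlMr//.
    by rewrite intrD in h2.
  rewrite lerBlDl (le_trans (ltW h4))// lerD2l ltW//.
  by near: n; exact: (near_infty_natSinv_lt (PosNum e0)).
Unshelve. all: by end_near. Qed.

Lemma hit_le y w t : 0 <= t -> X t w = y -> (hit y w <= t%:E)%E.
Proof. by move=> t0 Xt; apply: ereal_inf_lbound; exists t. Qed.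

Lemma hit_ge0 y w : (0 <= hit y w)%E.
Proof. by apply: le_ereal_inf_tmp => _ [t [t0 _] <-]; rewrite lee_fin. Qed.

Lemma hit_ltP y w t :
  (hit y w < t%:E)%E <-> exists s, [/\ 0 <= s, s < t & X s w = y].
Proof.
split=> [/ereal_inf_lt[_ [s [s0 Xs] <-]]|[s [s0 st Xs]]].
  by rewrite lte_fin => st; exists s.
by apply: le_lt_trans (hit_le s0 Xs) _; rewrite lte_fin.
Qed.

(** The set of visit times of a continuous path is closed, so the infimum is attained. *)
Lemma hit_finP y w : (hit y w < +oo)%E ->
  [/\ 0 <= fine (hit y w), X (fine (hit y w)) w = y &
      hit y w = (fine (hit y w))%:E].
Proof.
move=> hfin; have hE : hit y w = (fine (hit y w))%:E.
  by rewrite fineK// ge0_fin_numE// hit_ge0.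
split=> //; first by rewrite fine_ge0// hit_ge0.
have /choice[s sP] : forall n, exists s, [/\ fine (hit y w) <= s,
    s < fine (hit y w) + n.+1%:R^-1 & X s w = y].
  move=> n; have /hit_ltP[s [s0 sn Xs]] :
      (hit y w < (fine (hit y w) + n.+1%:R^-1)%:E)%E.
    by rewrite [ltLHS]hE lte_fin ltrDl invr_gt0 ltr0n.
  exists s; split=> //; rewrite -lee_fin -hE; exact: hit_le.
have : X (s n) w @[n --> \oo] --> X (fine (hit y w)) w.
  apply: X_cvg; apply/cvgrPdist_le => e e0; near=> n.
  have [h1 h2 _] := sP n.
  rewrite distrC ger0_norm ?subr_ge0// lerBlDl (le_trans (ltW h2))// lerD2l ltW//.
  by near: n; exact: (near_infty_natSinv_lt (PosNum e0)).
have -> : (fun n => X (s n) w) = cst y by apply/funext => n; have [] := sP n.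
by move=> /cvg_lim <-//; rewrite lim_cst.
Unshelve. all: by end_near. Qed.

Lemma X_continuous w : continuous (fun t => X t w).
Proof. exact: path_continuous. Qed.

Lemma hit_crossing y w t : 0 <= t -> X 0 w <= y <= X t w \/ X t w <= y <= X 0 w ->
  (hit y w <= t%:E)%E.
Proof.
move=> t0 cross.
have [||c ct Xc] := @IVT R (fun t => X t w) 0 t y t0.
- by apply: continuous_subspaceT; exact: X_continuous.
- by rewrite ge_min le_max; case: cross => /andP[-> ->]; rewrite ?orbT.
- move: ct; rewrite in_itv/= => /andP[c0 ct].
  by apply: le_trans (hit_le c0 Xc) _; rewrite lee_fin.
Qed.

Lemma X_shift u s w : 0 <= s -> X s (Defs.shift u w) = X (u + s) w.
Proof. by move=> s0; rewrite /X /= max_r. Qed.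

Lemma hit_shift u y w : 0 <= u -> (u%:E <= hit y w)%E ->
  hit y w = (u%:E + hit y (Defs.shift u w))%E.
Proof.
move=> u0 uh; apply/eqP; rewrite eq_le; apply/andP; split.
  rewrite addeC -leeBlDr//; apply: le_ereal_inf_tmp => _ [s [s0 Xs] <-].
  rewrite leeBlDr// -EFinD; apply: hit_le; first by rewrite addr_ge0.
  by rewrite addrC -X_shift.
apply: le_ereal_inf_tmp => _ [t [t0 Xt] <-].
have ut : u <= t by rewrite -lee_fin; apply: le_trans uh _; exact: hit_le.
rewrite -leeBrDl// -EFinB; apply: hit_le; first by rewrite subr_ge0.
by rewrite X_shift ?subr_ge0// addrC subrK.
Qed.

Lemma past_measurable t (A' : set (path_space R)) : past t A' -> measurable (A' : set (path_space R)).
Proof.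
apply: sub_sigma_algebra2 => B [s [A [/= /andP[s0 _] mA ->]]].
by exists s, A.
Qed.

Lemma past_le s t (A' : set (path_space R)) : s <= t -> past s A' -> past t A'.
Proof.
move=> st; apply: sub_sigma_algebra2 => B [r [A [/= /andP[r0 rs] mA ->]]].
by exists r, A; split=> //=; rewrite r0 (le_trans rs).
Qed.

(** A visit to [y] strictly before [t] lies in some [[0, T n]] with [T n < t]. There it means that
    the distance to [y] falls below every 1 / (k + 1) at times [q * T n] with [q] rational: on a
    compact interval the distance attains its minimum, which must then be 0. *)
Lemma past_hit t y : past t [set w | (hit y w < t%:E)%E].
Proof.
have [t0|t0] := leP t 0.
  rewrite (_ : mkset _ = set0); first exact: (@measurable0 _ (g_sigma_algebraType _)).
  rewrite -subset0 => w /= /hit_ltP[s [s0 st _]].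
  by have := lt_le_trans st t0; rewrite ltNge s0.
pose T n : R := t * (1 - n.+2%:R^-1).
have TP n : 0 < T n < t.
  have : n.+2%:R^-1 < 1 :> R by rewrite invf_lt1 ?ltr1n ?ltr0n.
  have : 0 < n.+2%:R^-1 :> R by rewrite invr_gt0 ltr0n.
  rewrite /T; move: (n.+2%:R^-1) => z z0 z1.
  by rewrite mulr_gt0 ?subr_gt0//= gtr_pMr// ltrBlDr ltrDl.
have E : [set w : path_space R | (hit y w < t%:E)%E] =
    \bigcup_n \bigcap_k \bigcup_(q : rat) [set w : path_space R |
      (0 <= (ratr q : R) <= 1) /\ `|X (ratr q * T n) w - y| < k.+1%:R^-1];
  last first.
  rewrite E.
  apply: (@bigcupT_measurable _ (g_sigma_algebraType _)) => n.
  apply: bigcapT_measurable => k.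
  apply: bigcupT_measurable_rat => q.
  have [/andP[q0 q1]|q01] := boolP (0 <= (ratr q : R) <= 1); last first.
    rewrite (_ : [set w | _ /\ _] = set0); first exact: measurable0.
    by rewrite -subset0 => w [].
  apply: sub_sigma_algebra; exists (ratr q * T n), (ball y k.+1%:R^-1); split.
  - have /andP[T0 Tt] := TP n.
    rewrite /= mulr_ge0// ?(ltW T0)//= (le_trans _ (ltW Tt))//.
    by rewrite ler_piMl// ltW.
  - exact: measurable_ball.
  - apply/seteqP; split=> w /=; rewrite /ball/= distrC; first by case.
    by [].
apply/seteqP; split=> [w /hit_ltP[s [s0 st Xs]]|w [n _ h]].
  have [n sn] : exists n, s <= T n.
    have ts : 0 < (t - s) / t by rewrite divr_gt0// subr_gt0.
    have [n _ /(_ n (leqnn n)) nP] := near_infty_natSinv_lt (PosNum ts).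
    exists n; rewrite /T mulrBr mulr1 lerBrDr -lerBrDl.
    rewrite -ler_pdivlMl// mulrC (le_trans _ (ltW nP))//.
    by rewrite lef_pV2 ?posrE ?ltr0n// ler_nat.
  have /andP[T0 Tt] := TP n.
  exists n => // k _.
  pose r := s / T n.
  have r01 : 0 <= r <= 1 by rewrite /r divr_ge0// ?(ltW T0)//= ler_pdivrMr// mul1r.
  have : (fun r' => X (r' * T n) w) r' @[r' --> r] --> X (r * T n) w.
    apply: (@continuous_comp _ _ _ (fun r' : R => r' * T n) (fun t => X t w)).
      exact: mulrr_continuous.
    exact: X_continuous.
  have k0 : 0 < k.+1%:R^-1 :> R by rewrite invr_gt0 ltr0n.
  move=> /cvgrPdist_lt /(_ _ k0)[d /= d0 dP].
  have [|q] := @rat_in_itvoo R (Num.max 0 (r - d)) (Num.min 1 (r + d)).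
    rewrite lt_min !gt_max; lra.
  rewrite in_itv/= gt_max lt_min => /andP[/andP[q0 q1] /andP[q2 q3]].
  exists q => //; split; first lra.
  rewrite distrC -Xs -[s in X s](divfK (lt0r_neq0 T0)) -/r.
  apply: dP => /=; rewrite ltr_norml; apply/andP; split; lra.
have /andP[T0 Tt] := TP n.
have [||c c01 cmin] := @EVT_min R (fun r => `|X (r * T n) w - y|) 0 1.
- exact: ler01.
- apply: continuous_subspaceT => r.
  apply: cvg_norm.
  apply: cvgB; last exact: cvg_cst.
  apply: (@continuous_comp _ _ _ (fun r' : R => r' * T n) (fun t => X t w)).
    exact: mulrr_continuous.
  exact: X_continuous.
apply/hit_ltP; exists (c * T n).
move: (c01); rewrite in_itv/= => /andP[c0 c1]; split.
- by rewrite mulr_ge0// ltW.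
- by rewrite (le_lt_trans _ Tt)// ler_piMl// ltW.
- apply/eqP; rewrite -subr_eq0 -normr_le0 leNgt; apply/negP => c_gt0.
  have [k _ /(_ k (leqnn k)) kP] := near_infty_natSinv_lt (PosNum c_gt0).
  have [q _ [q01 hq]] := h k I.
  have := cmin (ratr q); rewrite in_itv/= => /(_ q01).
  by rewrite leNgt => /negP; apply; exact: lt_trans hq kP.
Qed.

Lemma markov_time_hit y : markov_time (hit y : path_space R -> \bar R).
Proof. by split=> [w|t t0]; [exact: hit_ge0|exact: past_hit]. Qed.

Lemma markov_time_cst u : 0 <= u -> markov_time (fun _ : path_space R => u%:E).
Proof.
move=> u0; split=> [w|t t0]; first by rewrite lee_fin.
have [ut|tu] := ltP u t.
  rewrite (_ : mkset _ = setT); first exact: (@measurableT _ (g_sigma_algebraType _)).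
  by apply/seteqP; split=> w //=; rewrite lte_fin ut.
rewrite (_ : mkset _ = set0); first exact: (@measurable0 _ (g_sigma_algebraType _)).
by rewrite -subset0 => w /=; rewrite lte_fin ltNge tu.
Qed.

Lemma measurable_hit y :
  measurable_fun [set: path_space R] (hit y : path_space R -> \bar R).
Proof.
move=> mD; apply: (measurability _ (ErealGenInftyO.measurableE R)) => //.
move=> _ [_ [t ->] <-]; rewrite setTI.
apply: (@past_measurable t).
rewrite (_ : _ @^-1` _ = [set w | (hit y w < t%:E)%E]); first exact: past_hit.
by apply/seteqP; split=> w /=; rewrite in_itv.
Qed.

Lemma measurable_fine_hit y :
  measurable_fun [set: path_space R] (fun w => fine (hit y w)).
Proof. by apply: measurableT_comp (measurable_hit y); exact: fine_measurable. Qed.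

(** On [hit y w < t] the condition [fine (hit y w) < s] amounts to [hit y w < Num.min s t], an event
    of the past of that earlier time. *)
Lemma past_at_hit y (A : set R) : measurable A ->
  past_at (hit y : path_space R -> \bar R) [set w | A (fine (hit y w))].
Proof.
move=> mA; split.
  by rewrite -[X in measurable X]setTI; exact: measurable_fine_hit.
move=> t t0.
pose T := g_sigma_algebraType (@cylinders R [set s | 0 <= s <= t]).
pose D : set T := [set w | (hit y w < t%:E)%E].
have mf : measurable_fun D (fun w : T => fine (hit y w)).
  move=> mD; apply: (measurability _ (RGenInftyO.measurableE R)) => //.
  move=> _ [_ [s ->] <-].
  have [s0|s0] := leP s 0.
    rewrite (_ : _ `&` _ = set0); first exact: measurable0.
    rewrite -subset0 => w [_] /=; rewrite in_itv/= => /lt_le_trans /(_ s0).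
    by rewrite ltNge fine_ge0// hit_ge0.
  rewrite (_ : _ `&` _ = [set w : T | (hit y w < (Num.min s t)%:E)%E]).
    apply: (past_le _ (@past_hit (Num.min s t) y)).
    by rewrite ge_min lexx orbT.
  apply/seteqP; split=> w /=; rewrite in_itv/=.
    move=> [ht hs]; have [_ _ hE] := hit_finP (lt_trans ht (ltry t)).
    by rewrite hE lte_fin lt_min hs/= -lte_fin -hE.
  move=> h; have [_ _ hE] := hit_finP (lt_trans h (ltry _)).
  move: h; rewrite hE /D /= hE !lte_fin/= lt_min => /andP[-> ->].
  by split.
rewrite setIC; apply: mf => //; exact: past_hit.
Qed.

(** Needed to restart at a random time. A coordinate of the shifted path is
    [X (T w + Num.max 0 t) w], which is measurable because [X] is jointly measurable in time and
    path. *)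
Lemma measurable_shift (T : path_space R -> R) : measurable_fun setT T ->
  measurable_fun setT (fun w => Defs.shift (T w) w : path_space R).
Proof.
move=> mT.
apply: (@measurability _ _ (path_space R) (path_space R) setT _ (cylinders [set t : R | 0 <= t]) erefl) => // _ [_ [t [A [t0 mA ->]]] <-].
rewrite setTI (_ : _ @^-1` _ =
  (fun w => X (T w + Num.max 0 t) w) @^-1` A); last by [].
rewrite -[X in measurable X]setTI.
have : measurable_fun setT (fun w => X (T w + Num.max 0 t) w); last exact.
apply: (measurableT_comp measurable_X_pair (g := fun w => (T w + Num.max 0 t, w))).
by apply: measurable_fun_pair => //; exact: measurable_funD.
Qed.

End paths.

(** * Comparisons on events of probability one *)

Section probability_one.
Context d (T : measurableType d) (R : realType) (mu : probability T R).
Local Open Scope ereal_scope.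

Lemma prob1_setC (E : set T) : measurable E -> mu E = 1 -> mu (~` E) = 0.
Proof. by move=> mE E1; rewrite probability_setC// E1 subee. Qed.

Lemma prob1_le (E A B : set T) : measurable E -> measurable A -> measurable B ->
  mu E = 1 -> (forall w, E w -> A w -> B w) -> mu A <= mu B.
Proof.
move=> mE mA mB E1 AB.
rewrite -[leRHS]adde0 -(prob1_setC mE E1).
apply: (le_trans _ (measureU2 mu mB (measurableC mE))).
rewrite le_measure ?inE//; first exact/measurableU/measurableC.
by move=> w Aw; have [/AB|] := pselect (E w); [left; auto|right].
Qed.

Lemma prob1_eq (E A B : set T) : measurable E -> measurable A -> measurable B ->
  mu E = 1 -> (forall w, E w -> (A w <-> B w)) -> mu A = mu B.
Proof.
by move=> mE mA mB E1 AB; apply/eqP; rewrite eq_le;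
  rewrite (prob1_le mE mA mB)// ?(prob1_le mE mB mA)// => w /AB[].
Qed.

Lemma prob1_ae (E : set T) : measurable E -> mu E = 1 ->
  {ae mu, forall w, E w}.
Proof.
move=> mE E1; exists (~` E); split; first exact: measurableC.
  exact: prob1_setC.
by move=> w.
Qed.

Lemma prob1_eq_integral (E : set T) (f g : T -> \bar R) :
  measurable E -> mu E = 1 ->
  measurable_fun setT f -> measurable_fun setT g ->
  (forall w, 0 <= f w) -> (forall w, 0 <= g w) ->
  (forall w, E w -> f w = g w) -> \int[mu]_w f w = \int[mu]_w g w.
Proof.
move=> mE E1 mf mg f0 g0 fg; apply: ge0_ae_eq_integral => //.
by apply: filterS (prob1_ae mE E1) => w Ew _; exact: fg.
Qed.

End probability_one.

(** * Strong Markov property at hitting times *)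

Section markov.
Context (R : realType) (P : R -> probability (path_space R) R).
Hypothesis smP : strong_markov P.
Hypothesis recP : recurrent P.
Local Open Scope ereal_scope.
Implicit Types (x y z : R).

Lemma measurable_start x : measurable [set w : path_space R | X 0 w = x].
Proof.
rewrite (_ : [set w | _] = setT `&` X 0 @^-1` [set x]); last by rewrite setTI.
exact: measurable_X.
Qed.

Lemma measurable_hit_lt y (t : \bar R) :
  measurable [set w : path_space R | hit y w < t].
Proof.
rewrite -[X in measurable X]setTI.
by apply: emeasurable_fun_infty_o => //; exact: measurable_hit.
Qed.

Lemma measurable_hit_gt y (t : \bar R) :
  measurable [set w : path_space R | t < hit y w].
Proof.
rewrite -[X in measurable X]setTI.
by apply: emeasurable_fun_o_infty => //; exact: measurable_hit.
Qed.

Lemma measurable_hit_lt_hit y z :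
  measurable [set w : path_space R | hit y w < hit z w].
Proof.
rewrite -[X in measurable X]setTI.
by apply: emeasurable_fun_lt => //; exact: measurable_hit.
Qed.

Lemma measurable_shift_preimage (T : path_space R -> R) (B : set (path_space R)) :
  measurable_fun setT T -> measurable B ->
  measurable [set w | B (Defs.shift (T w) w)].
Proof.
move=> mT mB; rewrite -[X in measurable X]setTI.
exact: measurable_shift.
Qed.

(** The path sits at [z] at time [hit z], so the integrand in [sm_markov] is the constant [P z B];
    recurrence removes the restriction to finite hitting times. Thus the past up to [hit z] and the
    path after it are independent. *)
Lemma hit_markov x z (A B : set (path_space R)) : (0 <= x)%R -> (0 <= z)%R ->
  past_at (hit z : path_space R -> \bar R) A -> measurable B ->
  P x (A `&` [set w | B (Defs.shift (fine (hit z w)) w)]) = P x A * P z B.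
Proof.
move=> x0 z0 pA mB; have mA := pA.1.
have mS : measurable [set w | B (Defs.shift (fine (hit z w)) w)].
  by apply: measurable_shift_preimage => //; exact: measurable_fine_hit.
have mfin := measurable_hit_lt z +oo.
have hfin := recP x0 z0.
have -> : P x A = P x (A `&` [set w | hit z w < +oo]).
  by apply: (prob1_eq mfin) => //; [exact: measurableI|move=> w hw; split=> [|[]]].
rewrite (prob1_eq mfin _ _ hfin
    (B := A `&` [set w | hit z w < +oo] `&`
          [set w | B (Defs.shift (fine (hit z w)) w)])); last 3 first.
- exact: measurableI.
- by apply: measurableI => //; exact: measurableI.
- by move=> w hw; split=> [[]|[[]]].
rewrite (sm_markov smP x0 (markov_time_hit z) pA mB).
rewrite (eq_integral (cst (P z B))).
  by rewrite integral_cst; [rewrite muleC|exact: measurableI].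
by move=> w; rewrite inE => -[_ /= /hit_finP[_ -> _]].
Qed.

(** By [hit_markov] the joint law of the hitting time and of the shifted path is a product on
    rectangles; uniqueness of product measures extends this to all measurable sets, and Tonelli's
    theorem factors the integral. *)
Lemma hit_markov_integral x z (g : R -> \bar R) (G : path_space R -> \bar R) :
  (0 <= x)%R -> (0 <= z)%R ->
  measurable_fun setT g -> measurable_fun setT G ->
  (forall t, 0 <= g t) -> (forall w, 0 <= G w) ->
  \int[P x]_w (g (fine (hit z w)) * G (Defs.shift (fine (hit z w)) w)) =
  (\int[P x]_w g (fine (hit z w))) * \int[P z]_w G w.
Proof.
move=> x0 z0 mg mG g0 G0.
have mh := @measurable_fine_hit R z.
have ms := measurable_shift mh.
pose H : {mfun path_space R >-> R} :=
  HB.pack (fun w : path_space R => fine (hit z w)) (isMeasurableFun.Build _ _ _ _ _ mh).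
have mY := measurable_fun_pair mh ms.
pose Y : {mfun path_space R >-> (R * path_space R)%type} :=
  HB.pack (fun w : path_space R => (fine (hit z w), Defs.shift (fine (hit z w)) w : path_space R))
    (isMeasurableFun.Build _ _ _ _ _ mY).
have prodE : forall A : set (R * path_space R), measurable A ->
    (distribution (P x) H \x P z) A = distribution (P x) Y A.
  apply: product_measure_unique => A B mA mB.
  transitivity (P x ([set w | A (fine (hit z w))] `&`
      [set w | B (Defs.shift (fine (hit z w)) w)])); first by [].
  by rewrite hit_markov//; exact: past_at_hit.
pose F (a : R * path_space R) := g a.1 * G a.2.
have mF : measurable_fun setT F.
  by apply: emeasurable_funM; exact: measurableT_comp.
have F0 a : 0 <= F a by rewrite mule_ge0.
transitivity (\int[distribution (P x) Y]_a F a).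
  by rewrite ge0_integral_distribution.
rewrite -(eq_measure_integral _ (fun A mA _ => prodE A mA)).
rewrite fubini_tonelli1//= /fubini_F /F/=.
rewrite -[X in _ = X * _](ge0_integral_distribution H mg g0).
rewrite -ge0_integralZr//; last exact: integral_ge0.
by apply: eq_integral => a _; rewrite ge0_integralZl.
Qed.

Lemma past_at_cst (s : R) (A : set (path_space R)) : past s A ->
  past_at (fun=> s%:E : \bar R) A.
Proof.
move=> pA; split=> [|t t0]; first exact: past_measurable pA.
have [st|ts] := ltP s t.
  rewrite (_ : [set w | _] = setT) ?setIT; first exact: past_le (ltW st) pA.
  by apply/seteqP; split=> w //=; rewrite lte_fin.
rewrite (_ : [set w | _] = set0) ?setI0; first exact: (@measurable0 _ (g_sigma_algebraType _)).
by rewrite -subset0 => w /=; rewrite lte_fin ltNge ts.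
Qed.

Lemma measurable_P_X (s : R) (B : set (path_space R)) : measurable B ->
  measurable_fun setT (fun w : path_space R => P (X s w) B).
Proof.
move=> mB _ Y mY.
have mk := sm_kernel smP mB (measurable_itv _) mY.
rewrite (_ : _ `&` _ = setT `&` (X s @^-1` (`[0%R, +oo[ `&` (P ^~ B) @^-1` Y))).
  exact: measurable_X.
apply/seteqP; split=> w [_ /=]; last by case.
by move=> h; split=> //; split=> //=; rewrite in_itv/= andbT; exact: path_ge0.
Qed.

(** The bound is asked only of paths with [X 0 w = x], which is enough almost surely; knowing the
    starting point helps to locate [X s w]. *)
Lemma markov_le x (s : R) (A B : set (path_space R)) (b : \bar R) :
  (0 <= x)%R -> (0 <= s)%R -> past s A -> measurable B -> 0 <= b ->
  (forall w, X 0 w = x -> A w -> P (X s w) B <= b) ->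
  P x (A `&` [set w | B (Defs.shift s w)]) <= P x A * b.
Proof.
move=> x0 s0 pA mB b0 Ab; have mA := past_measurable pA.
have := sm_markov smP x0 (markov_time_cst s0) (past_at_cst pA) mB.
have -> : A `&` [set w : path_space R | s%:E < +oo] = A.
  by rewrite (_ : [set w | _] = setT) ?setIT//; apply/seteqP; split=> w //= _; rewrite ltry.
move=> /= ->; rewrite -[leRHS]muleC -integral_cst//.
apply: ae_ge0_le_integral => //.
  exact: measurable_funS (measurable_P_X s mB).
have := prob1_ae (measurable_start x) (sm_start smP x0).
by apply: filterS => w /= Xw Aw; exact: Ab.
Qed.

End markov.

(** * Transition density and strong Feller property *)

Section mixture.
Context d1 d2 (Y : measurableType d1) (Z : measurableType d2) (R : realType).
Variables (mu : {measure set Z -> \bar R}) (m : {measure set Y -> \bar R}).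
Variable nu : Y -> {measure set Z -> \bar R}.
Hypothesis mnu : forall B, measurable B -> measurable_fun setT (nu ^~ B).
Hypothesis muE : forall B, measurable B -> (mu B = \int[m]_y nu y B)%E.
Local Open Scope ereal_scope.

Import HBNNSimple.

Let integral_mixture_nnsfun (f : {nnsfun Z >-> R}) :
  \int[mu]_z (f z)%:E = \int[m]_y \int[nu y]_z (f z)%:E.
Proof.
have fE (r : R) : range f r -> r = `|r|%R.
  by move=> [z _ <-]; rewrite ger0_norm.
have sE (k : {measure set Z -> \bar R}) :
    \int[k]_z (f z)%:E = \sum_(r \in range f) `|r|%:E * k (f @^-1` [set r]).
  rewrite integralT_nnsfun sintegralE; apply: eq_fsbigr => r.
  by rewrite inE => /fE {1}->.
rewrite sE; under [RHS]eq_integral do rewrite sE.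
rewrite ge0_integral_fsum//.
- apply: eq_fsbigr => r _; rewrite ge0_integralZl//; first by rewrite muE.
  exact: mnu.
- by move=> r; apply: measurable_funeM; exact: mnu.
Qed.

(** From sets to simple functions to monotone limits. With the laws [P (X s w)] it yields the Markov
    property for integrals; with Dirac masses weighted by [p t x y] it yields integrals against the
    transition density. *)
Lemma integral_mixture (f : Z -> \bar R) :
  measurable_fun setT f -> (forall z, 0 <= f z) ->
  \int[mu]_z f z = \int[m]_y \int[nu y]_z f z.
Proof.
move=> mf f0; pose g := nnsfun_approx measurableT mf.
have gf (k : {measure set Z -> \bar R}) :
    \int[k]_z f z = lim (\int[k]_z (g n z)%:E @[n --> \oo]).
  rewrite -monotone_convergence//.
  - apply: eq_integral => z _; apply/esym/cvg_lim => //.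
    exact: cvg_nnsfun_approx.
  - by move=> n; exact/measurable_EFinP.
  - by move=> n z _; rewrite lee_fin.
  - by move=> z _ a b ab; rewrite lee_fin; exact/lefP/nd_nnsfun_approx.
rewrite gf; under [RHS]eq_integral do rewrite gf.
rewrite monotone_convergence//.
- have -> : (fun n => \int[mu]_z (g n z)%:E) =
      (fun n => \int[m]_y \int[nu y]_z (g n z)%:E).
    by apply/funext => n; exact: integral_mixture_nnsfun.
  by [].
- move=> n; apply: measurable_fun_integral_kernel => //.
  + by move=> z; rewrite lee_fin.
  + exact/measurable_EFinP.
- by move=> n y _; apply: integral_ge0 => z _; rewrite lee_fin.
- move=> y _ a b ab; apply: ge0_le_integral => //.
  + by move=> z _; rewrite lee_fin.
  + exact/measurable_EFinP.
  + exact/measurable_EFinP.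
  + by move=> z _; rewrite lee_fin; exact/lefP/nd_nnsfun_approx.
Qed.

End mixture.

Section markov_integral.
Context (R : realType) (P : R -> probability (path_space R) R).
Hypothesis smP : strong_markov P.
Local Open Scope ereal_scope.

Lemma markov_integral (x s : R) (G : path_space R -> \bar R) :
  (0 <= x)%R -> (0 <= s)%R -> measurable_fun setT G -> (forall w, 0 <= G w) ->
  \int[P x]_w G (Defs.shift s w) = \int[P x]_w \int[P (X s w)]_w' G w'.
Proof.
move=> x0 s0 mG G0.
have ms : measurable_fun setT (fun w : path_space R => Defs.shift s w : path_space R).
  exact: (measurable_shift (T := fun=> s)).
pose Y : {mfun path_space R >-> path_space R} :=
  HB.pack (fun w : path_space R => Defs.shift s w : path_space R)
    (isMeasurableFun.Build _ _ _ _ _ ms).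
rewrite -(ge0_integral_distribution Y mG G0).
apply: (integral_mixture (m := P x) (nu := fun w => P (X s w))) => //.
  by move=> B mB; exact: measurable_P_X.
move=> B mB.
have := sm_markov smP x0 (markov_time_cst s0) (past_at_cst (A := setT) _) mB.
rewrite /= setTI (_ : [set w | s%:E < +oo] = setT); last first.
  by apply/seteqP; split=> w //= _; rewrite ltry.
rewrite setTI; apply.
exact: (@measurableT _ (g_sigma_algebraType _)).
Qed.

End markov_integral.

Lemma cvg_pair_to {T : Type} {F : set_system T} {FF : Filter F}
    (U V : topologicalType) (f : T -> U) (g : T -> V) (a : U) (b : V) :
  f x @[x --> F] --> a -> g x @[x --> F] --> b -> (f x, g x) @[x --> F] --> (a, b).
Proof. exact: cvg_pair. Qed.

Section density.
Context (R : realType) (m : {measure set R -> \bar R}).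
Context (P : R -> probability (path_space R) R) (p : R -> R -> R -> R).
Hypothesis smm : speed_measure m.
Hypothesis hp : transition_density m P p.
Local Open Scope ereal_scope.

(** Composition with [Num.max 0] extends the density continuously to negative arguments, so that
    continuity within the half-lines becomes ordinary continuity. *)
Lemma density_continuous_max (z : R * R * R) : (0 < z.1.1)%R ->
  {for z, continuous (fun z : R * R * R =>
    p z.1.1 (Num.max 0%R z.1.2) (Num.max 0%R z.2))}.
Proof.
move=> t0; pose g (z : R * R * R) := (z.1.1, Num.max 0%R z.1.2, Num.max 0%R z.2).
have c11 : (fun z : R * R * R => z.1.1) z' @[z' --> z] --> z.1.1.
  exact: (cvg_comp _ _ (@cvg_fst _ _ (nbhs z.1) (nbhs z.2) _)
                       (@cvg_fst _ _ (nbhs z.1.1) (nbhs z.1.2) _)).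
have c12 : (fun z : R * R * R => z.1.2) z' @[z' --> z] --> z.1.2.
  exact: (cvg_comp _ _ (@cvg_fst _ _ (nbhs z.1) (nbhs z.2) _)
                       (@cvg_snd _ _ (nbhs z.1.1) (nbhs z.1.2) _)).
have c2 : (fun z : R * R * R => z.2) z' @[z' --> z] --> z.2.
  exact: (@cvg_snd _ _ (nbhs z.1) (nbhs z.2) _).
have cmax (h : R * R * R -> R) a : h z' @[z' --> z] --> a ->
    Num.max 0%R (h z') @[z' --> z] --> Num.max 0%R a.
  move=> ha; apply: (cvg_comp h (Num.max 0%R) ha).
  by apply: (@continuous_max R R (cst 0%R) id); [exact: cvg_cst|exact: cvg_id].
have gc : g z' @[z' --> z] --> g z.
  by apply: cvg_pair_to; [apply: cvg_pair_to|]; auto.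
have gD z' : (0 < z'.1.1)%R -> [/\ (0 < (g z').1.1)%R, (0 <= (g z').1.2)%R & (0 <= (g z').2)%R].
  by move=> h; split; rewrite //= le_max lexx.
have /subspace_continuousP /(_ (g z) (gD z t0)) pc := density_continuous hp.
have gw : g z' @[z' --> z] --> within
   [set z : R * R * R | [/\ (0 < z.1.1)%R, (0 <= z.1.2)%R & (0 <= z.2)%R]] (nbhs (g z)).
  move=> A /gc gA; have /cvgr_gt /(_ 0%R t0) h0 := c11.
  by apply: filterS2 h0 gA => z' hz' + ; apply; exact: gD.
exact: (cvg_comp _ _ gw pc).
Qed.

Lemma density_cvg (t x y : R) (u v : R^nat) : (0 < t)%R -> (0 <= x)%R -> (0 <= y)%R ->
  (forall n, 0 <= u n)%R -> (forall n, 0 <= v n)%R ->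
  u n @[n --> \oo] --> x -> v n @[n --> \oo] --> y ->
  p t (u n) (v n) @[n --> \oo] --> p t x y.
Proof.
move=> t0 x0 y0 u0 v0 ux vy.
have pc : p z.1.1 (Num.max 0%R z.1.2) (Num.max 0%R z.2) @[z --> (t, x, y)] --> p t x y.
  rewrite -[in X in _ --> X](max_r x0) -[in X in _ --> X](max_r y0).
  exact: (@density_continuous_max (t, x, y) t0).
have uv : (t, u n, v n) @[n --> \oo] --> (t, x, y).
  by apply: cvg_pair_to => //; apply: cvg_pair_to => //; exact: cvg_cst.
have := cvg_comp _ _ uv pc; apply: cvg_trans; apply: near_eq_cvg.
by apply: nearW => n /=; rewrite !max_r.
Qed.

Lemma density_max_continuous (t x : R) : (0 < t)%R -> (0 <= x)%R ->
  continuous (fun z : R => p t x (Num.max 0%R z)).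
Proof.
move=> t0 x0 y.
have pc : p z.1.1 (Num.max 0%R z.1.2) (Num.max 0%R z.2) @[z --> (t, x, y)] -->
    p t x (Num.max 0%R y).
  rewrite -[in X in _ --> X](max_r x0).
  exact: (@density_continuous_max (t, x, y) t0).
have uv : (t, x, y') @[y' --> y] --> (t, x, y).
  by apply: cvg_pair_to => //; apply: cvg_pair_to => //; exact: cvg_cst.
have := cvg_comp _ _ uv pc; apply: cvg_trans; apply: near_eq_cvg.
by apply: nearW => n /=; rewrite (max_r x0).
Qed.

Lemma measurable_density (t x : R) : (0 < t)%R -> (0 <= x)%R ->
  measurable_fun setT (fun z : R => p t x (Num.max 0%R z)).
Proof.
move=> t0 x0; apply: continuous_measurable_fun; exact: density_max_continuous.
Qed.

(** If [p t x y] were negative, continuity would keep [p t x] below [p t x y / 2] on some []y, y +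
    d[], an interval of positive speed measure, and [X t] would fall there with negative
    probability. *)
Lemma density_ge0 (t x y : R) : (0 < t)%R -> (0 <= x)%R -> (0 <= y)%R -> (0 <= p t x y)%R.
Proof.
move=> t0 x0 y0; rewrite leNgt; apply/negP => p0.
have pm0 : (p t x (Num.max 0%R y) < p t x y / 2)%R by rewrite max_r//; lra.
have := @density_max_continuous t x t0 x0 y.
move=> /cvgr_lt /(_ _ pm0) [d /= d0 dP].
pose J : set R := `]y, (y + d)%R[%classic.
have mJ : measurable J by exact: measurable_itv.
have JP z : J z -> [/\ (y < z)%R, (0 <= z)%R & (p t x z < p t x y / 2)%R].
  rewrite /J/= in_itv/= => /andP[yz zd]; have z0 : (0 <= z)%R by lra.
  split=> //; have := dP z; rewrite /= max_r//; apply.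
  by rewrite ltr_norml; apply/andP; split; lra.
have J0 : J `<=` `[0%R, +oo[ by move=> z /JP[_ z0 _]; rewrite /= in_itv/= z0.
have mJ0 : 0 < m J by apply: (speed_gt0 smm) => //; rewrite ltrDl.
have : 0 <= P x [set w | J (X t w)] by [].
rewrite (density_prob hp t0 x0 mJ J0) leNgt => /negP; apply.
have pE : {in J, forall z, (p t x z)%:E = - (- p t x (Num.max 0%R z))%:E}.
  by move=> z; rewrite inE => /JP[_ z0 _]; rewrite -EFinN opprK max_r.
rewrite (eq_integral _ _ pE) integral_ge0N; last first.
  by move=> z /JP[_ z0 pz]; rewrite lee_fin max_r//; lra.
rewrite oppe_lt0; apply: (@lt_le_trans _ _ (\int[m]_(y' in J) (- (p t x y / 2))%:E)).
  by rewrite integral_cst// mule_gt0// lte_fin; lra.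
apply: ge0_le_integral => //.
- by move=> z _; rewrite lee_fin; lra.
- apply/measurable_EFinP; apply: measurableT_comp => //.
  by apply: measurable_funS (measurable_density t0 x0).
- by move=> z /JP[_ z0 pz]; rewrite lee_fin max_r//; lra.
Qed.

Lemma speed_half_line (f : R -> \bar R) : measurable_fun setT f ->
  (forall y, 0 <= f y) -> \int[m]_(y in `[0%R, +oo[) f y = \int[m]_y f y.
Proof.
move=> mf f0.
rewrite (ge0_negligible_integral _ _ mf _ (speed_neg smm))//.
congr (integral _ _ _); apply/seteqP; split=> y /=; rewrite !in_itv/= andbT.
  by move=> y0; split=> //; rewrite ltNge y0.
by move=> [_ /negP]; rewrite -leNgt.
Qed.

Lemma integral_density (t x : R) (f : R -> \bar R) : (0 < t)%R -> (0 <= x)%R ->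
  measurable_fun setT f -> (forall y, 0 <= f y) ->
  \int[P x]_w f (X t w) = \int[m]_(y in `[0%R, +oo[) (f y * (p t x y)%:E).
Proof.
move=> t0 x0 mf f0.
have mX := @measurable_X R t.
pose Y : {mfun path_space R >-> R} :=
  HB.pack (X t : path_space R -> R) (isMeasurableFun.Build _ _ _ _ _ mX).
rewrite -(ge0_integral_distribution Y mf f0).
have q0 (y : R) : (0 <= p t x (Num.max 0%R y))%R by rewrite density_ge0// le_max lexx.
have mq : measurable_fun setT (fun y : R => (p t x (Num.max 0%R y))%:E).
  by apply/measurable_EFinP; exact: measurable_density.
(* The law of [X t] is the mixture over [m] of the Dirac masses at [y] with weights [p t x y]; the
   maximum keeps the weight nonnegative on all of R. *)
pose nu (y : R) : {measure set R -> \bar R} := mscale (NngNum (q0 y)) (dirac y).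
have nuE y B : nu y B = (p t x (Num.max 0%R y))%:E * (\1_B y)%:E by [].
have mnu B : measurable B -> measurable_fun setT (nu ^~ B).
  by move=> mB; apply: emeasurable_funM => //; exact/measurable_EFinP/measurable_indic.
rewrite (integral_mixture (m := m) (nu := nu))//; last first.
  move=> B mB.
  transitivity (P x [set w | (B `&` `[0%R, +oo[) (X t w)]).
    congr (P x _); apply/seteqP; split=> w /=; last by case.
    by move=> h; split=> //; rewrite in_itv/= andbT; exact: path_ge0.
  have mBI : measurable (B `&` `[0%R, +oo[ : set R) by exact: measurableI.
  rewrite (density_prob hp t0 x0 mBI); last by move=> ? [].
  rewrite setIC integral_mkcondr -speed_half_line//; last exact: mnu.
  apply: eq_integral => y; rewrite inE/= in_itv/= andbT => y0.
  rewrite nuE patchE indicE max_r//.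
  by case: (y \in B); rewrite ?mule1 ?mule0.
have muf : measurable_fun setT (fun y : R => (f y * (p t x (Num.max 0%R y))%:E)).
  exact: emeasurable_funM.
transitivity (\int[m]_y (f y * (p t x (Num.max 0%R y))%:E)).
  apply: eq_integral => y _.
  rewrite ge0_integral_mscale//= integral_dirac// diracT mul1e muleC//.
rewrite -speed_half_line//; last by move=> y; rewrite mule_ge0// lee_fin.
by apply: eq_integral => y; rewrite inE/= in_itv/= andbT => y0; rewrite max_r.
Qed.

End density.

Section fatou_near.
Context d (T : measurableType d) (R : realType) (mu : {measure set T -> \bar R}).
Local Open Scope ereal_scope.

Lemma near_lt_limn_einf (u : (\bar R)^nat) (c : \bar R) :
  c < limn_einf u -> \forall n \near \oo, c < u n.
Proof.
have -> : limn_einf u = ereal_sup (range (einfs u)).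
  by rewrite limn_einf_lim; apply/cvg_lim => //; exact: cvg_einfs_sup.
move=> /ereal_sup_gt[_ [n _ <-] cn]; exists n => // k /= nk.
by apply: (lt_le_trans cn); apply: ereal_inf_lbound; exists k.
Qed.

(** Fatou's lemma in the form of lower semicontinuity: a strict lower bound of the limit integral
    holds eventually, without any dominating function. *)
Lemma fatou_near (D : set T) (f : (T -> \bar R)^nat) (g : T -> \bar R) (c : \bar R) :
  measurable D -> (forall n, measurable_fun D (f n)) ->
  (forall n x, D x -> 0 <= f n x) ->
  (forall x, D x -> f n x @[n --> \oo] --> g x) ->
  c < \int[mu]_(x in D) g x ->
  \forall n \near \oo, c < \int[mu]_(x in D) f n x.
Proof.
move=> mD mf f0 fg cg; apply: near_lt_limn_einf.
apply: lt_le_trans (fatou mu mD mf f0); rewrite (lt_le_trans cg)//.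
rewrite (eq_integral (fun x => limn_einf (f ^~ x)))// => x; rewrite inE => Dx.
by have [-> _] := cvg_limn_einf_sup (fg _ Dx).
Qed.

End fatou_near.

Section bounded_expectation.
Context d (T : measurableType d) (R : realType) (mu : probability T R).
Local Open Scope ereal_scope.

Lemma prob_integral_bound (f : T -> R) (K : R) : measurable_fun setT f ->
  (forall w, 0 <= f w <= K)%R -> 0 <= \int[mu]_w (f w)%:E <= K%:E.
Proof.
move=> mf fK; apply/andP; split.
  by apply: integral_ge0 => w _; rewrite lee_fin; have /andP[] := fK w.
apply: (@le_trans _ _ (\int[mu]_w K%:E)).
  apply: ge0_le_integral => //.
  - by move=> w _; rewrite lee_fin; have /andP[] := fK w.
  - exact/measurable_EFinP.
  - by move=> w _; rewrite lee_fin; have /andP[] := fK w.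
by rewrite integral_cst//= probability_setT mule1.
Qed.

Lemma prob_integral_fin (f : T -> R) (K : R) : measurable_fun setT f ->
  (forall w, 0 <= f w <= K)%R -> \int[mu]_w (f w)%:E \is a fin_num.
Proof.
move=> mf fK; have /andP[h0 hK] := prob_integral_bound mf fK.
by rewrite ge0_fin_numE// (le_lt_trans hK)// ltry.
Qed.

Lemma prob_integral_complement (f : T -> R) (K : R) : measurable_fun setT f ->
  (forall w, 0 <= f w <= K)%R ->
  \int[mu]_w (K - f w)%:E = K%:E - \int[mu]_w (f w)%:E.
Proof.
move=> mf fK; have Ifin := prob_integral_fin mf fK.
rewrite -[LHS]addr0 -(subee Ifin) addeA -ge0_integralD//; first last.
- exact/measurable_EFinP.
- by move=> w _; rewrite lee_fin; have /andP[] := fK w.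
- by apply/measurable_EFinP; exact: measurable_funB.
- by move=> w _; rewrite lee_fin subr_ge0; have /andP[] := fK w.
congr (_ - _); under eq_integral do rewrite -EFinD subrK.
by rewrite integral_cst//= probability_setT mule1.
Qed.

End bounded_expectation.

Section feller.
Context (R : realType) (m : {measure set R -> \bar R}).
Context (P : R -> probability (path_space R) R) (p : R -> R -> R -> R).
Hypothesis smm : speed_measure m.
Hypothesis hp : transition_density m P p.
Local Open Scope ereal_scope.

(** For fixed [z] the density [p t y z] is continuous in [y], so by Fatou's lemma the mean of
    [f (X t)] is lower semicontinuous in the starting point. *)
Lemma strong_feller_near (t x : R) (u : R^nat) (f : R -> R) (c : \bar R) :
  (0 < t)%R -> (0 <= x)%R ->
  (forall n, 0 <= u n)%R -> u n @[n --> \oo] --> x ->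
  measurable_fun setT f -> (forall y, 0 <= f y)%R ->
  c < \int[P x]_w (f (X t w))%:E ->
  \forall n \near \oo, c < \int[P (u n)]_w (f (X t w))%:E.
Proof.
move=> t0 x0 u0 ux mf f0.
have mEf : measurable_fun setT (EFin \o f) by exact/measurable_EFinP.
have dE y : (0 <= y)%R -> \int[P y]_w (f (X t w))%:E =
    \int[m]_(z in `[0%R, +oo[) ((f z)%:E * (p t y (Num.max 0%R z))%:E).
  move=> y0; rewrite (integral_density smm hp (f := EFin \o f))//.
  by apply: eq_integral => z; rewrite inE/= in_itv/= andbT => z0; rewrite max_r.
rewrite dE//; under eq_near do rewrite dE//.
apply: fatou_near => //.
- move=> n; apply: emeasurable_funM; first exact: measurable_funS mEf.
  apply/measurable_EFinP; apply: measurable_funS (measurable_density hp t0 (u0 n)) => //.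
- move=> n z /=; rewrite in_itv/= andbT => z0; rewrite mule_ge0 ?lee_fin//.
  by apply: (density_ge0 smm hp) => //; rewrite le_max lexx.
- move=> z /=; rewrite in_itv/= andbT => z0.
  have z00 : (0 <= Num.max 0%R z)%R by rewrite le_max lexx.
  have := density_cvg hp t0 x0 z00 u0 (fun=> z00) ux (cvg_cst _).
  move=> pc; under eq_cvg do rewrite -EFinM.
  apply: cvg_EFin; first exact: nearW.
  by apply: (@cvgM _ _ _ _ (cst (f z))); [exact: cvg_cst|exact: pc].
Qed.

(* As in Scheffé's lemma, Fatou is applied to both [f] and [K - f]. *)
Lemma strong_feller (t x : R) (u : R^nat) (f : R -> R) (K : R) :
  (0 < t)%R -> (0 <= x)%R ->
  (forall n, 0 <= u n)%R -> u n @[n --> \oo] --> x ->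
  measurable_fun setT f -> (forall y, 0 <= f y <= K)%R ->
  \int[P (u n)]_w (f (X t w))%:E @[n --> \oo] --> \int[P x]_w (f (X t w))%:E.
Proof.
move=> t0 x0 u0 ux mf fK.
have mfX : measurable_fun setT (fun w : path_space R => f (X t w)).
  by apply: measurableT_comp => //; exact: measurable_X.
have fKX (w : path_space R) : (0 <= f (X t w) <= K)%R by [].
have aE y : \int[P y]_w (f (X t w))%:E = (fine (\int[P y]_w (f (X t w))%:E))%:E.
  by rewrite fineK//; exact: (@prob_integral_fin _ _ _ (P y) _ K mfX fKX).
rewrite aE; under eq_cvg do rewrite aE.
apply: cvg_EFin; first exact: nearW.
set a := fun y => fine (\int[P y]_w (f (X t w))%:E).
apply/cvgrPdist_lt => e e0.
have h1 : \forall n \near \oo, (a x - e < a (u n))%R.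
  have := @strong_feller_near t x u f (a x - e)%:E t0 x0 u0 ux mf.
  rewrite aE -/(a x) lte_fin ltrBlDr ltrDl => /(_ _ e0) h.
  apply: filterS (h _) => [n|y]; last by have /andP[] := fK y.
  by rewrite aE lte_fin.
have h2 : \forall n \near \oo, (K - a x - e < K - a (u n))%R.
  have cE y : \int[P y]_w (K - f (X t w))%:E = (K - a y)%:E.
    by rewrite prob_integral_complement// aE EFinB.
  have := @strong_feller_near t x u (fun y => (K - f y)%R) (K - a x - e)%:E t0 x0 u0 ux.
  rewrite cE lte_fin [in X in _ -> _ -> X -> _]ltrBlDr ltrDl => /(_ _ _ e0) h.
  apply: filterS (h _ _) => [n|//|y]; last by rewrite subr_ge0; have /andP[] := fK y.
    by rewrite cE lte_fin.
  exact: measurable_funB.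
near=> n.
have a1 : (a x - e < a (u n))%R by near: n.
have a2 : (K - a x - e < K - a (u n))%R by near: n.
by change (`|a x - a (u n)| < e)%R; rewrite ltr_norml; apply/andP; split; lra.
Unshelve. all: by end_near. Qed.

End feller.

(** * Resolvents *)

Section lebesgue_half_line.
Context (R : realType).
Local Open Scope ereal_scope.
Local Notation leb := (@lebesgue_measure R).

Lemma lebesgue_measureD (h : R) (A : set R) : measurable A ->
  pushforward leb ((fun t => t + h)%R : _ -> measurableTypeR R) A = leb A.
Proof.
have mD : measurable_fun setT ((fun t => t + h)%R : R -> measurableTypeR R).
  exact: measurable_funD.
pose D : {mfun R >-> measurableTypeR R} := HB.pack
  ((fun t => t + h)%R : R -> measurableTypeR R) (isMeasurableFun.Build _ _ _ _ _ mD).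
move=> mA; apply/esym/(@lebesgue_measure_unique _ (pushforward leb D)) => //= _ [[a b]] _ <-.
rewrite /pushforward/= (_ : _ @^-1` _ = `](a - h)%R, (b - h)%R]%classic).
  rewrite !lebesgue_measure_itv/= !lte_fin ltrD2r.
  by case: ifP => // _; rewrite -!EFinB opprB addrA subrK.
by apply/seteqP; split=> t /=; rewrite !in_itv/= ltrBlDr lerBrDr.
Qed.

Lemma ge0_integral_translate (h : R) (g : R -> \bar R) :
  measurable_fun setT g -> (forall t, 0 <= g t) ->
  \int[leb]_(t in `[h, +oo[) g t = \int[leb]_(t in `[0%R, +oo[) g (h + t)%R.
Proof.
move=> mg g0.
have mD : measurable_fun setT
    ((fun t => t + h)%R : measurableTypeR R -> measurableTypeR R).
  exact: measurable_funD.
rewrite (_ : `[0%R, +oo[%classic =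
    ((fun t => t + h)%R : R -> measurableTypeR R) @^-1` `[h, +oo[); last first.
  by apply/seteqP; split=> t /=; rewrite !in_itv/= !andbT lerDr.
have g0' : {in `[h, +oo[%classic, forall t, 0 <= g t} by [].
have E := @ge0_integral_pushforward _ _ (measurableTypeR R) (measurableTypeR R) R _
  mD leb _ g (measurable_itv `[h, +oo[) (measurable_funS measurableT (@subsetT _ _) mg) g0'.
transitivity (\int[pushforward leb ((fun t => t + h)%R : R -> measurableTypeR R)]_(t in `[h, +oo[) g t).
  by apply: eq_measure_integral => //= A mA _; exact/esym/lebesgue_measureD.
by rewrite E; apply: eq_integral => t _ /=; rewrite addrC.
Qed.

Lemma integral_expR (l : R) : (0 < l)%R ->
  \int[leb]_(t in `[0%R, +oo[) (expR (- (l * t)))%:E = l^-1%:E.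
Proof.
move=> l0; have := integral_exponential_pdf l0.
rewrite -[X in X = _]mule1 => E.
have -> : \int[leb]_(t in `[0%R, +oo[) (expR (- (l * t)))%:E =
    l^-1%:E * \int[leb]_x (exponential_pdf l x)%:E.
  rewrite -ge0_integralZl//= ?lee_fin ?invr_ge0 ?ltW//.
  - rewrite integral_mkcond; apply: eq_integral => t _.
    rewrite /exponential_pdf !patchE; case: ifP => _; last by rewrite mule0.
    by rewrite -EFinM mulrA mulVf ?gt_eqF// mul1r mulNr.
  - by apply/measurable_EFinP; exact: measurable_exponential_pdf.
  - by move=> x _; rewrite lee_fin exponential_pdf_ge0// ltW.
by rewrite -[X in _ * X]mule1 E mule1.
Qed.

End lebesgue_half_line.

Section discounted.
Context (R : realType) (l : R) (f : R -> R) (K : R).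
Hypothesis l0 : 0 < l.
Hypothesis mf : measurable_fun setT f.
Hypothesis fK : forall y, 0 <= f y <= K.
Local Open Scope ereal_scope.
Local Notation leb := (@lebesgue_measure R).
Implicit Types (w : path_space R).

(** Kept path by path, before any expectation is taken, so that it can be cut at a random time such
    as a hitting time. *)
Definition discounted w : \bar R :=
  \int[leb]_(t in `[0%R, +oo[) (expR (- (l * t)) * f (X t w))%:E.

Let K0 : (0 <= K)%R. Proof. by have /andP[/le_trans] := fK 0; apply. Qed.

Let mexp : measurable_fun setT (fun t : R => expR (- (l * t))).
Proof.
by apply: measurableT_comp => //; apply: measurableT_comp => //; exact: measurable_funM.
Qed.

Let mfX : measurable_fun setT (fun z : R * path_space R => f (X z.1 z.2)).
Proof. exact: measurableT_comp mf (@measurable_X_pair R). Qed.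

Let mG : measurable_fun setT
  (fun z : R * path_space R => (expR (- (l * z.1)) * f (X z.1 z.2))%:E).
Proof.
apply/measurable_EFinP; apply: measurable_funM => //.
exact: (measurableT_comp mexp).
Qed.

Let G0 (z : R * path_space R) : 0 <= (expR (- (l * z.1)) * f (X z.1 z.2))%:E.
Proof. by rewrite lee_fin mulr_ge0 ?expR_ge0//; have /andP[] := fK (X z.1 z.2). Qed.

Let mG1 w : measurable_fun setT (fun t : R => (expR (- (l * t)) * f (X t w))%:E).
Proof. exact: (measurableT_comp mG (measurable_fun_pair (@measurable_id _ _ setT) (measurable_cst w))). Qed.

Lemma discounted_ge0 w : 0 <= discounted w.
Proof. by apply: integral_ge0 => t _; exact: (G0 (t, w)). Qed.

Lemma discounted_le w : discounted w <= (K / l)%:E.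
Proof.
apply: (@le_trans _ _ (\int[leb]_(t in `[0%R, +oo[) (K%:E * (expR (- (l * t)))%:E))).
  apply: ge0_le_integral => //.
  - by move=> t _; exact: (G0 (t, w)).
  - exact: measurable_funS (mG1 w).
  - by apply: measurable_funeM; apply/measurable_EFinP; exact: measurable_funS mexp.
  - move=> t _; rewrite -EFinM lee_fin mulrC ler_wpM2r ?expR_ge0//.
    by have /andP[] := fK (X t w).
rewrite ge0_integralZl//.
- by rewrite integral_expR.
- by apply/measurable_EFinP; exact: measurable_funS mexp.
Qed.

Let restrictE (D : set R) t (g : R -> \bar R) : (g \_ D) t = g t * (\1_D t)%:E.
Proof. by rewrite patchE indicE; case: (t \in D); rewrite ?mule1 ?mule0. Qed.

Lemma integral_discounted_swap (mu : probability (path_space R) R) (D : set R) :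
  measurable D ->
  \int[mu]_w \int[leb]_(t in D) (expR (- (l * t)) * f (X t w))%:E =
  \int[leb]_(t in D) ((expR (- (l * t)))%:E * \int[mu]_w (f (X t w))%:E).
Proof.
move=> mD.
pose F (z : path_space R * R) :=
  (expR (- (l * z.2)) * f (X z.2 z.1))%:E * (\1_D z.2)%:E.
have mF : measurable_fun setT F.
  apply: emeasurable_funM.
    exact: (measurableT_comp mG (measurable_fun_pair measurable_snd measurable_fst)).
  apply/measurable_EFinP; apply: measurableT_comp => //.
have F0 z : 0 <= F z.
  by rewrite mule_ge0//; exact: (G0 (z.2, z.1)).
have := @fubini_tonelli _ _ _ _ _ mu leb F mF F0.
rewrite /F/= => E; transitivity (\int[mu]_w \int[leb]_t F (w, t)).
  apply: eq_integral => w _; rewrite integral_mkcond.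
  by apply: eq_integral => t _; rewrite restrictE.
rewrite E [RHS]integral_mkcond; apply: eq_integral => t _.
rewrite restrictE ge0_integralZr//=.
- congr (_ * _); under eq_integral do rewrite EFinM.
  rewrite ge0_integralZl//= ?lee_fin ?expR_ge0//.
    by apply/measurable_EFinP; apply: measurableT_comp => //; exact: measurable_X.
  by move=> w _; rewrite lee_fin; have /andP[] := fK (X t w).
- exact: (measurableT_comp mG (measurable_fun_pair (measurable_cst t) (@measurable_id _ _ setT))).
- by move=> w _; exact: (G0 (t, w)).
Qed.

Lemma measurable_discounted_on (D : set R) : measurable D ->
  measurable_fun setT
    (fun w => \int[leb]_(t in D) (expR (- (l * t)) * f (X t w))%:E).
Proof.
move=> mD; pose F (z : path_space R * R) :=
  (expR (- (l * z.2)) * f (X z.2 z.1))%:E * (\1_D z.2)%:E.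
have mF : measurable_fun setT F.
  apply: emeasurable_funM.
    exact: (measurableT_comp mG (measurable_fun_pair measurable_snd measurable_fst)).
  apply/measurable_EFinP; apply: measurableT_comp => //.
have F0 z : 0 <= F z.
  by rewrite mule_ge0//; exact: (G0 (z.2, z.1)).
have := @measurable_fun_fubini_tonelli_F _ _ _ _ _ leb F mF F0.
congr (measurable_fun _ _); apply/funext => w.
rewrite integral_mkcond.
by apply: eq_integral => t _; rewrite restrictE.
Qed.

Lemma measurable_discounted : measurable_fun setT discounted.
Proof. exact: measurable_discounted_on. Qed.

Lemma discounted_split (h : R) w : (0 <= h)%R ->
  discounted w = \int[leb]_(t in `[0%R, h[) (expR (- (l * t)) * f (X t w))%:E +
    (expR (- (l * h)))%:E * discounted (Defs.shift h w).
Proof.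
move=> h0; rewrite /discounted.
have E : `[0%R, +oo[%classic = `[0%R, h[%classic `|` `[h, +oo[%classic.
  apply/seteqP; split=> t /=; rewrite !in_itv/= !andbT; first by move=> ->; case: ltP; auto.
  by move=> [/andP[]//|]; exact: le_trans.
rewrite [in LHS]E ge0_integral_setU//.
- congr (_ + _); rewrite ge0_integral_translate//; last by move=> t; exact: (G0 (t, w)).
  rewrite -ge0_integralZl//.
  + apply: eq_integral => t; rewrite inE => ht.
    have t0 : (0 <= t)%R by move: ht; rewrite /= in_itv/= andbT.
    by rewrite -EFinM X_shift// mulrDr opprD expRD mulrA.
  + exact: measurable_funS (mG1 _).
  + by move=> t _; exact: (G0 (t, _)).
- exact: measurable_funS (mG1 w).
- by move=> t _; exact: (G0 (t, w)).
- rewrite disj_set2E; apply/eqP; rewrite -subset0 => t [/=].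
  by rewrite !in_itv/= => /andP[_ th]; rewrite andbT leNgt th.
Qed.

End discounted.

Section ge0_dominated_convergence.
Context d (T : measurableType d) (R : realType) (mu : {measure set T -> \bar R}).
Local Open Scope ereal_scope.

Lemma ge0_dominated_cvg (D : set T) (f : (T -> \bar R)^nat) (g h : T -> \bar R) :
  measurable D -> (forall n, measurable_fun D (f n)) -> measurable_fun D h ->
  (forall n x, D x -> 0 <= f n x <= h x) ->
  (forall x, D x -> f n x @[n --> \oo] --> g x) ->
  \int[mu]_(x in D) h x < +oo ->
  \int[mu]_(x in D) f n x @[n --> \oo] --> \int[mu]_(x in D) g x.
Proof.
move=> mD mf mh fh fg hoo.
have h0 x : D x -> 0 <= h x.
  by move=> /(fh 0%N)/andP[]; exact: le_trans.
have [] // := @dominated_convergence _ _ _ mu D mD f g h mf.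
- exact: emeasurable_fun_cvg mf fg.
- exact: aeW.
- apply/integrableP; split=> //; apply: le_lt_trans hoo; apply: ge0_le_integral => //.
  + exact: measurableT_comp.
  + by move=> x /h0 hx; rewrite gee0_abs.
- by apply: aeW => x n /(fh n)/andP[f0 ?]; rewrite gee0_abs.
Qed.

End ge0_dominated_convergence.

Section resolvent.
Context (R : realType) (m : {measure set R -> \bar R}) (S : cumulative R R).
Context (P : R -> probability (path_space R) R) (p : R -> R -> R -> R).
Hypothesis hX : reflected_diffusion m S P.
Hypothesis hp : transition_density m P p.
Context (l : R) (f : R -> R) (K : R).
Hypothesis l0 : 0 < l.
Hypothesis cf : continuous f.
Hypothesis fK : forall y, 0 <= f y <= K.
Local Notation leb := (@lebesgue_measure R).

Definition resolvent x : R := fine (\int[P x]_w discounted l f w)%E.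

Let mf : measurable_fun setT f. Proof. exact: continuous_measurable_fun. Qed.

Let K0 : (0 <= K)%R. Proof. by have /andP[/le_trans] := fK 0; apply. Qed.

Let mfX t : measurable_fun setT (fun w : path_space R => f (X t w)).
Proof. by apply: measurableT_comp => //; exact: measurable_X. Qed.

Let mean (x t : R) := fine (\int[P x]_w (f (X t w))%:E)%E.

Let meanE x t : (\int[P x]_w (f (X t w))%:E = (mean x t)%:E)%E.
Proof. by rewrite fineK//; exact: (@prob_integral_fin _ _ _ (P x) _ K (mfX t)). Qed.

Let mean_bound x t : 0 <= mean x t <= K.
Proof.
rewrite -2!lee_fin -meanE.
by apply: prob_integral_bound => //; exact: mfX.
Qed.

Let mdisc : measurable_fun setT (discounted l f).
Proof. exact: (measurable_discounted l mf fK). Qed.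

Lemma resolventE x : (\int[P x]_w discounted l f w = (resolvent x)%:E)%E.
Proof.
rewrite /resolvent fineK// ge0_fin_numE; last first.
  by apply: integral_ge0 => w _; exact: (discounted_ge0 l fK).
apply: (@le_lt_trans _ _ (\int[P x]_w (K / l)%:E)%E).
  apply: ge0_le_integral => //.
  - by move=> w _; exact: (discounted_ge0 l fK).
  - by move=> w _; exact: (discounted_le l0 mf fK).
by rewrite integral_cst//= probability_setT mule1 ltry.
Qed.

Lemma resolvent_ge0 x : 0 <= resolvent x.
Proof. by rewrite fine_ge0//; apply: integral_ge0 => w _; exact: (discounted_ge0 l fK). Qed.

Lemma resolvent_le x : resolvent x <= K / l.
Proof.
rewrite -lee_fin -resolventE.
apply: (@le_trans _ _ (\int[P x]_w (K / l)%:E)%E).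
  apply: ge0_le_integral => //.
  - by move=> w _; exact: (discounted_ge0 l fK).
  - by move=> w _; exact: (discounted_le l0 mf fK).
by rewrite integral_cst//= probability_setT mule1.
Qed.

Lemma resolvent_laplace x :
  ((resolvent x)%:E = \int[leb]_(t in `[0%R, +oo[) ((expR (- (l * t)) * mean x t)%:E))%E.
Proof.
rewrite -resolventE (integral_discounted_swap l mf fK)//.
by apply: eq_integral => t _; rewrite meanE.
Qed.

Let mexp (r : R) : measurable_fun setT (fun t : R => expR (- (r * t))).
Proof.
by apply: measurableT_comp => //; apply: measurableT_comp => //; exact: measurable_funM.
Qed.

Lemma measurable_mean x : measurable_fun setT (mean x).
Proof.
suff : measurable_fun setT (fun t => \int[P x]_w (f (X t w))%:E)%E.
  by move=> h; apply: measurableT_comp h; exact: fine_measurable.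
have mF : measurable_fun setT (fun z : R * path_space R => (f (X z.1 z.2))%:E).
  by apply/measurable_EFinP; exact: measurableT_comp mf (@measurable_X_pair R).
apply: (@measurable_fun_fubini_tonelli_F _ _ _ _ _ (P x) _ mF).
by move=> z; rewrite lee_fin; have /andP[] := fK (X z.1 z.2).
Qed.

Lemma resolvent_cvg (x : R) (u : R^nat) : 0 <= x -> (forall n, 0 <= u n) ->
  u n @[n --> \oo] --> x -> resolvent (u n) @[n --> \oo] --> resolvent x.
Proof.
move=> x0 u0 ux.
suff : (resolvent (u n))%:E @[n --> \oo] --> (resolvent x)%:E.
  by move/fine_cvg.
(* Time 0, a null set, is removed because the strong Feller property requires [0 < t]. The
   domination is by [K * expR (- (l * t))]. *)
have E y : ((resolvent y)%:E =
    \int[leb]_(t in `]0%R, +oo[) ((expR (- (l * t)) * mean y t)%:E))%E.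
  rewrite resolvent_laplace integral_itv_obnd_cbnd//.
  apply/measurable_EFinP; apply: measurable_funS (measurable_funM (mexp l) (measurable_mean y)) => //.
rewrite E; under eq_cvg do rewrite E.
apply: (@ge0_dominated_cvg _ _ _ leb `]0%R, +oo[%classic
  (fun n t => (expR (- (l * t)) * mean (u n) t)%:E)
  (fun t => (expR (- (l * t)) * mean x t)%:E)
  (fun t => (K * expR (- (l * t)))%:E)) => //.
- move=> n; apply/measurable_EFinP.
  exact: measurable_funS (measurable_funM (mexp l) (measurable_mean (u n))).
- apply/measurable_EFinP; apply: measurable_funM => //.
  exact: measurable_funS (mexp l).
- move=> n t _; have /andP[h0 hK] := mean_bound (u n) t.
  by rewrite !lee_fin mulr_ge0 ?expR_ge0//= mulrC ler_wpM2r ?expR_ge0.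
- move=> t /=; rewrite in_itv/= andbT => t0.
  apply: cvg_EFin; first exact: nearW.
  apply: (@cvgM _ _ _ _ (cst (expR (- (l * t))))); first exact: cvg_cst.
  have := strong_feller (diff_speed hX) hp t0 x0 u0 ux mf fK.
  rewrite meanE; under eq_cvg do rewrite meanE.
  by move/fine_cvg.
- rewrite integral_itv_obnd_cbnd; last first.
    by apply/measurable_EFinP; apply: measurable_funM => //; exact: measurable_funS (mexp l).
  under eq_integral do rewrite EFinM.
  rewrite ge0_integralZl//.
  + by rewrite integral_expR// -EFinM ltry.
  + by apply/measurable_EFinP; exact: measurable_funS (mexp l).
Qed.

Lemma resolvent_max_continuous : continuous (fun x : R => resolvent (Num.max 0 x)).
Proof.
move=> x; apply/continuous_withinNx; apply/cvgr_dnbhsP => u [_ ux].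
apply: resolvent_cvg => [|n|]; rewrite ?le_max ?lexx//.
apply: (cvg_comp u (Num.max 0) ux).
by apply: (@continuous_max R R (cst 0) id); [exact: cvg_cst|exact: cvg_id].
Qed.

(** The coefficient [a] covers both members of the pair in the generator: [a = 0] gives the
    resolvent up to the factor [l], and [a = 1] gives its image. *)
Lemma bounded_continuous_resolvent (a : R) :
  bounded_continuous (fun x => l * resolvent x - a * f x) .
Proof.
split.
  apply/subspace_continuousP => y; rewrite /= in_itv/= andbT => y0.
  have yc : l * resolvent (Num.max 0 z) - a * f z @[z --> y] --> l * resolvent y - a * f y.
    rewrite -[in X in _ --> X](max_r y0).
    apply: cvgB; apply: cvgM; try exact: cvg_cst; last by rewrite max_r//; exact: cf.
    exact: resolvent_max_continuous.
  have yw := @cvg_within_filter _ _ _ (nbhs y) _ _ `[0, +oo[%classic yc.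
  have E : {near within `[0, +oo[%classic (nbhs y),
      (fun z => l * resolvent (Num.max 0 z) - a * f z) =1
      (fun z => l * resolvent z - a * f z)}.
    near=> z; have : z \in `[0, +oo[%R by near: z; exact: near_withinT.
    by rewrite in_itv/= andbT => z0; rewrite max_r.
  move=> A yA; suff : within `[0, +oo[%classic (nbhs y)
      (fun z => A (l * resolvent z - a * f z)) by [].
  by apply: (filterS2 _ _ E (yw _ A yA)) => z /= ->.
exists (K + `|a| * K) => x x0.
rewrite (le_trans (ler_normB _ _))// lerD//.
  have lu : 0 <= l * resolvent x by rewrite mulr_ge0 ?resolvent_ge0// ltW.
  by rewrite ger0_norm// mulrC -ler_pdivlMr// resolvent_le.
by rewrite normrM ler_wpM2l// ger0_norm; have /andP[] := fK x.
Unshelve. all: by end_near. Qed.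

Definition initial_mean (h x : R) : R :=
  fine (\int[leb]_(t in `[0%R, h[) ((expR (- (l * t)) * mean x t)%:E))%E.

Let initial_meanE h x : 0 <= h ->
  (\int[leb]_(t in `[0%R, h[) ((expR (- (l * t)) * mean x t)%:E) =
    (initial_mean h x)%:E)%E /\ 0 <= initial_mean h x <= K * h.
Proof.
move=> h0; have mI : measurable_fun `[0%R, h[ (fun t => expR (- (l * t)) * mean x t).
  exact: measurable_funS (measurable_funM (mexp l) (measurable_mean x)).
have I0 : (0 <= \int[leb]_(t in `[0%R, h[) ((expR (- (l * t)) * mean x t)%:E))%E.
  apply: integral_ge0 => t _; rewrite lee_fin mulr_ge0 ?expR_ge0//.
  by have /andP[] := mean_bound x t.
have IK : (\int[leb]_(t in `[0%R, h[) ((expR (- (l * t)) * mean x t)%:E) <= (K * h)%:E)%E.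
  apply: (@le_trans _ _ (\int[leb]_(t in `[0%R, h[) K%:E)%E).
    apply: ge0_le_integral => //.
    - move=> t _; rewrite lee_fin mulr_ge0 ?expR_ge0//.
      by have /andP[] := mean_bound x t.
    - exact/measurable_EFinP.
    - move=> t; rewrite /= in_itv/= => /andP[t0 _].
      have /andP[m0 mK] := mean_bound x t.
      rewrite lee_fin -[K]mul1r ler_pM ?expR_ge0//.
      by rewrite -expR0 ler_expR oppr_le0 mulr_ge0// ltW.
  rewrite integral_cst//= lebesgue_measure_itv/= lte_fin.
  by move: h0; rewrite le_eqVlt => /orP[/eqP<-|->]; rewrite ?ltxx ?mule0 ?mulr0// oppr0 adde0.
have E : (\int[leb]_(t in `[0%R, h[) ((expR (- (l * t)) * mean x t)%:E) =
    (initial_mean h x)%:E)%E.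
  by rewrite fineK// ge0_fin_numE// (le_lt_trans IK)// ltry.
by split=> //; rewrite -2!lee_fin -E I0 IK.
Qed.

Let measurable_discounted_shift h :
  measurable_fun setT (fun w : path_space R => discounted l f (Defs.shift h w)).
Proof. by apply: measurableT_comp mdisc _; exact: (measurable_shift (T := fun=> h)). Qed.

Lemma mean_resolventE h x : 0 <= h -> 0 <= x ->
  ((\int[P x]_w resolvent (X h w))%:E = \int[P x]_w discounted l f (Defs.shift h w))%E.
Proof.
move=> h0 x0; have E : (\int[P x]_w (resolvent (X h w))%:E =
    \int[P x]_w discounted l f (Defs.shift h w))%E.
  rewrite (markov_integral (diff_markov hX))//; last by move=> w; exact: (discounted_ge0 l fK).
  by apply: eq_integral => w _; rewrite resolventE.
rewrite /Rintegral E fineK// ge0_fin_numE; last first.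
  by apply: integral_ge0 => w _; exact: (discounted_ge0 l fK).
apply: (@le_lt_trans _ _ (\int[P x]_w (K / l)%:E)%E).
  apply: ge0_le_integral => //.
  - by move=> w _; exact: (discounted_ge0 l fK).
  - by move=> w _; exact: (discounted_le l0 mf fK).
by rewrite integral_cst//= probability_setT mule1 ltry.
Qed.

Lemma mean_resolvent_bound h x : 0 <= h -> 0 <= x ->
  0 <= \int[P x]_w resolvent (X h w) <= K / l.
Proof.
move=> h0 x0; rewrite -2!lee_fin mean_resolventE//; apply/andP; split.
  by apply: integral_ge0 => w _; exact: (discounted_ge0 l fK).
apply: (@le_trans _ _ (\int[P x]_w (K / l)%:E)%E).
  apply: ge0_le_integral => //.
  - by move=> w _; exact: (discounted_ge0 l fK).
  - by move=> w _; exact: (discounted_le l0 mf fK).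
by rewrite integral_cst//= probability_setT mule1.
Qed.

(** The Markov property at time [h], applied to the part of the potential accumulated after [h]. It
    puts the increment of the semigroup on the resolvent in closed form, from which the generator
    can be read off. *)
Lemma resolvent_split h x : 0 <= h -> 0 <= x ->
  \int[P x]_w resolvent (X h w) = expR (l * h) * (resolvent x - initial_mean h x).
Proof.
move=> h0 x0; have mh := measurable_discounted_shift h.
have [IE _] := initial_meanE x h0.
have : (resolvent x)%:E = ((initial_mean h x)%:E +
    (expR (- (l * h)))%:E * (\int[P x]_w resolvent (X h w))%:E)%E.
  rewrite -resolventE mean_resolventE//.
  under eq_integral do rewrite (discounted_split l mf fK _ h0).
  rewrite ge0_integralD//; first last.
  - by apply: measurable_funeM.
  - by move=> w _; rewrite mule_ge0 ?lee_fin ?expR_ge0// (discounted_ge0 l fK).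
  - exact: measurable_discounted_on.
  - move=> w _; apply: integral_ge0 => t _; rewrite lee_fin mulr_ge0 ?expR_ge0//.
    by have /andP[] := fK (X t w).
  rewrite (integral_discounted_swap l mf fK)//.
  congr (_ + _)%E.
    by rewrite -IE; apply: eq_integral => t _; rewrite meanE.
  by rewrite ge0_integralZl// => w _; exact: (discounted_ge0 l fK).
rewrite -EFinM -EFinD => -[->].
by rewrite addrAC subrr add0r mulrA -expRD subrr expR0 mul1r.
Qed.

Let mean_cvg0 x : 0 <= x -> mean x t @[t --> 0^'+] --> f x.
Proof.
move=> x0; apply/cvg_at_rightP => u [u0 ucvg].
suff : (mean x (u n))%:E @[n --> \oo] --> (f x)%:E by move/fine_cvg.
have -> : (f x)%:E = (\int[P x]_w (f (X 0 w))%:E)%E.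
  rewrite (prob1_eq_integral (measurable_start x) (sm_start (diff_markov hX) x0)
    (g := cst (f x)%:E)).
  - by rewrite integral_cst//= probability_setT mule1.
  - by apply/measurable_EFinP.
  - exact: measurable_cst.
  - by move=> w; rewrite lee_fin; have /andP[] := fK (X 0 w).
  - by move=> w; rewrite lee_fin; have /andP[] := fK x.
  - by move=> w /= ->.
under eq_cvg do rewrite -meanE.
apply: (@ge0_dominated_cvg _ _ _ (P x) setT (fun n w => (f (X (u n) w))%:E)
   (fun w => (f (X 0 w))%:E) (cst K%:E)) => //.
- by move=> n; exact/measurable_EFinP.
- by move=> n w _; rewrite !lee_fin.
- move=> w _; apply: cvg_EFin; first exact: nearW.
  have h : f (X (u n) w) @[n --> \oo] --> f (X 0 w).
    by apply: (cvg_comp (fun n => X (u n) w) f); [exact: X_cvg ucvg|exact: cf].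
  exact: h.
- by rewrite integral_cst//= probability_setT mule1 ltry.
Qed.

Let initial_mean_cvg x : 0 <= x ->
  initial_mean h x / h @[h --> 0^'+] --> f x.
Proof.
move=> x0.
have disc : expR (- (l * t)) * mean x t @[t --> 0^'+] --> f x.
  rewrite -[f x]mul1r; apply: cvgM; last exact: mean_cvg0.
  apply: cvg_at_right_filter; rewrite -expR0 -[X in expR X](_ : - (l * 0) = 0); last first.
    by rewrite mulr0 oppr0.
  apply: (@continuous_comp _ _ _ (fun t => - (l * t)) expR); last exact: continuous_expR.
  by apply: cvgN; apply: cvgM; [exact: cvg_cst|exact: cvg_id].
apply/cvgrPdist_le => e e0.
have /cvgrPdist_le /(_ _ e0)[d /= d0 dP] := disc.
near=> h.
have h0 : 0 < h by near: h; exact: nbhs_right_gt.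
have hd : h < d by near: h; exact: nbhs_right_lt.
have [IE _] := initial_meanE x (ltW h0).
have mI : measurable_fun `]0%R, h[ (fun t => expR (- (l * t)) * mean x t).
  exact: measurable_funS (measurable_funM (mexp l) (measurable_mean x)).
have Ie t : t \in `]0, h[ -> `|f x - expR (- (l * t)) * mean x t| <= e.
  rewrite in_itv/= => /andP[t0 th]; apply: dP => //=.
  by rewrite sub0r normrN gtr0_norm// (lt_trans th).
have I0 t : 0 <= expR (- (l * t)) * mean x t.
  by rewrite mulr_ge0 ?expR_ge0//; have /andP[] := mean_bound x t.
have ID (c : R) : (\int[leb]_(t in `]0%R, h[) c%:E = (c * h)%:E)%E.
  by rewrite integral_cst//= lebesgue_measure_itv/= lte_fin h0 oppr0 adde0.
move: IE; rewrite -integral_itv_obnd_cbnd => [IE|]; last first.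
  exact/measurable_EFinP.
rewrite ler_norml; apply/andP; split.
- rewrite lerBrDl -lerBrDr ler_pdivrMr// -lee_fin -IE opprK -ID.
  apply: ge0_le_integral => //.
  + by move=> t _; rewrite lee_fin.
  + exact/measurable_EFinP.
  + by move=> t /Ie; rewrite lee_fin ler_norml => /andP[? ?]; lra.
- have [fe|fe] := leP (f x) e.
    have A0 : 0 <= initial_mean h x / h.
      by have [_ /andP[A1 _]] := initial_meanE x (ltW h0); rewrite divr_ge0// ltW.
    by lra.
  rewrite lerBlDr -lerBlDl ler_pdivlMr// -lee_fin -IE -ID.
  apply: ge0_le_integral => //.
  + by move=> t _; rewrite lee_fin; lra.
  + exact/measurable_EFinP.
  + by move=> t /Ie; rewrite lee_fin ler_norml => /andP[? ?]; lra.
Unshelve. all: by end_near. Qed.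

Let expm1_bound (z : R) : 0 <= z -> z <= expR z - 1 <= z * expR z.
Proof.
move=> z0; rewrite lerBrDr addrC expR_ge1Dx/=.
have := expR_ge1Dx (- z); rewrite expRN => h.
have e0 := expR_gt0 z.
have : (1 - z) * expR z <= (expR z)^-1 * expR z by rewrite ler_wpM2r// ltW.
by rewrite mulVf ?lt0r_neq0// mulrBl mul1r; lra.
Qed.

Let quotientE h x : 0 < h -> 0 <= x ->
  ((\int[P x]_w resolvent (X h w)) - resolvent x) / h =
  resolvent x * ((expR (l * h) - 1) / h) - expR (l * h) * (initial_mean h x / h).
Proof.
move=> h0 x0; rewrite (resolvent_split (ltW h0) x0).
by rewrite !mulrA -mulrBl; congr (_ / _); ring.
Qed.

Lemma resolvent_generator : generator P resolvent (fun x => l * resolvent x - f x).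
Proof.
split.
- have [] := bounded_continuous_resolvent 0 => c [M Mb].
  have E x : resolvent x = l^-1 * (l * resolvent x - 0 * f x).
    by rewrite mul0r subr0 mulrA mulVf ?mul1r// gt_eqF.
  split; last first.
    exists (K / l) => x _; rewrite ger0_norm ?resolvent_ge0//; exact: resolvent_le.
  rewrite (funext E) => x; apply: cvgM; first exact: cvg_cst.
  exact: c.
- rewrite (_ : (fun x => _) = (fun x => l * resolvent x - 1 * f x)).
    exact: bounded_continuous_resolvent.
  by apply/funext => x; rewrite mul1r.
(* For [h <= 1] each of the two terms of [quotientE] is at most [K * expR l]; for [h > 1] a
   difference of two numbers in [[0, K / l]] is divided by more than 1. *)
- exists (K * expR l + K * expR l + (K / l) ) => h x h0 x0.
  have u0 := resolvent_ge0 x; have uK := resolvent_le x.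
  have [_ /andP[A0 AK]] := initial_meanE x (ltW h0).
  have Kl : 0 <= K / l by rewrite divr_ge0// ltW.
  have [h1|h1] := leP h 1.
    rewrite quotientE//.
    have el : expR (l * h) <= expR l by rewrite ler_expR ger_pMr.
    have [/andP[e1 e2]] := expm1_bound (mulr_ge0 (ltW l0) (ltW h0)).
    have e0 := expR_ge0 (l * h).
    have q0 : 0 <= (expR (l * h) - 1) / h <= l * expR l.
      have q1 : 0 <= expR (l * h) - 1 by rewrite (le_trans _ e1)// mulr_ge0// ltW.
      rewrite divr_ge0 ?(ltW h0)//=.
      rewrite ler_pdivrMr// (le_trans e2)// mulrAC.
      by rewrite ler_wpM2r ?(ltW h0)// ler_wpM2l// ltW.
    have A1 : 0 <= initial_mean h x / h <= K.
      by rewrite divr_ge0 ?(ltW h0)//= ler_pdivrMr.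
    have t1 : 0 <= resolvent x * ((expR (l * h) - 1) / h) <= K * expR l.
      have /andP[q1 q2] := q0; rewrite mulr_ge0//=.
      apply: (@le_trans _ _ ((K / l) * (l * expR l))); first by rewrite ler_pM.
      by rewrite mulrA divfK ?gt_eqF.
    have t2 : 0 <= expR (l * h) * (initial_mean h x / h) <= K * expR l.
      have /andP[q1 q2] := A1; rewrite mulr_ge0//= mulrC ler_pM//.
    rewrite ler_norml; move: t1 t2 => /andP[? ?] /andP[? ?].
    by apply/andP; split; lra.
  have /andP[p0 pK] := mean_resolvent_bound (ltW h0) x0.
  rewrite normrM normfV (gtr0_norm h0) ler_pdivrMr//.
  have n1 : `|(\int[P x]_w resolvent (X h w)) - resolvent x| <= K / l.
    by rewrite ler_norml; apply/andP; split; lra.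
  have Ke : 0 <= K * expR l by rewrite mulr_ge0// expR_ge0.
  apply: (le_trans n1); rewrite -[leLHS]mulr1; apply: ler_pM => //; last exact: ltW.
  by rewrite lerDr addr_ge0.
- move=> x x0.
  have el : expR (l * h) @[h --> 0^'+] --> (1 : R).
    apply: cvg_at_right_filter; rewrite -expR0 -[X in expR X](mulr0 l).
    apply: (@continuous_comp _ _ _ (fun t => l * t) expR); last exact: continuous_expR.
    by apply: cvgM; [exact: cvg_cst|exact: cvg_id].
  have ql : (expR (l * h) - 1) / h @[h --> 0^'+] --> l.
    apply: (@squeeze_cvgr _ _ _ _ (cst l) (fun h => l * expR (l * h))).
    + near=> h; have h0 : 0 < h by near: h; exact: nbhs_right_gt.
      have [/andP[e1 e2]] := expm1_bound (mulr_ge0 (ltW l0) (ltW h0)).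
      by rewrite ler_pdivlMr// e1 ler_pdivrMr// mulrAC.
    + exact: cvg_cst.
    + by rewrite -[X in _ --> X]mulr1; apply: cvgM => //; exact: cvg_cst.
  have main : resolvent x * ((expR (l * h) - 1) / h) - expR (l * h) * (initial_mean h x / h)
      @[h --> 0^'+] --> resolvent x * l - 1 * f x.
    apply: cvgB; apply: cvgM => //; [exact: cvg_cst|exact: initial_mean_cvg].
  rewrite [l * _]mulrC -[X in _ - X](mul1r (f x)).
  apply: cvg_trans main; apply: near_eq_cvg; near=> h.
  by rewrite quotientE//; near: h; exact: nbhs_right_gt.
Unshelve. all: by end_near. Qed.

(** The identification of the generator turns the probabilistic potential into a solution of (l -
    d/dm d/dS) u = f with du/dS(0) = 0. The estimates near 0 start from this equation. *)
Lemma resolvent_ode :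
  d_dm_d_dS m S resolvent (fun x => l * resolvent x - f x).
Proof. exact/(diff_generator hX)/resolvent_generator. Qed.

End resolvent.

(** * Mean value theorem relative to the scale function *)

Section scale_mvt.
Context (R : realType) (S : cumulative R R).
Hypothesis S_lt : forall x y : R, 0 <= x -> x < y -> S x < S y.
Hypothesis S_cont : continuous S.
Context (f Df : R -> R).
Hypothesis cf : {within `[0, +oo[, continuous f}.
Hypothesis fDf : d_dS S f Df.

Let extremum (g : R -> R) (a b : R) : a < b -> {within `[a, b], continuous g} ->
  g a = g b -> exists2 c, c \in `]a, b[%R &
    (forall t, t \in `[a, b]%R -> g t <= g c) \/ (forall t, t \in `[a, b]%R -> g c <= g t).
Proof.
move=> ab cg gab.
have [c1 c1ab c1P] := EVT_max (ltW ab) cg.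
have [c2 c2ab c2P] := EVT_min (ltW ab) cg.
have inP c : c \in `[a, b]%R -> (c \in `]a, b[%R) \/ g c = g a.
  rewrite !in_itv/= => /andP[]; rewrite le_eqVlt => /predU1P[<-|ac]; first by right.
  by rewrite le_eqVlt => /predU1P[->|cb]; [right|left; rewrite ac].
have [h1|g1] := inP c1 c1ab; first by exists c1 => //; left.
have [h2|g2] := inP c2 c2ab; first by exists c2 => //; right.
exists ((a + b) / 2); first by rewrite in_itv/= midf_lt//= midf_lt.
left => t tab; rewrite (le_trans (c1P t tab))// g1 -g2; apply: c2P.
by rewrite in_itv/= !midf_le// ltW.
Qed.

(** Lagrange's argument with [S] in place of the identity, as [S] need not be differentiable:
    [f - k S] takes equal values at [a] and [b], hence has an interior extremum [c]. There the left
    and right quotients bound [Df c] by [k] from opposite sides. *)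
Lemma scale_mvt (a b : R) : 0 <= a -> a < b ->
  exists2 c, a < c < b & f b - f a = Df c * (S b - S a).
Proof.
move=> a0 ab; have Sab : 0 < S b - S a by rewrite subr_gt0 S_lt.
pose k := (f b - f a) / (S b - S a).
have kE : k * (S b - S a) = f b - f a by rewrite divfK// gt_eqF.
pose g x := f x - k * S x.
have cg : {within `[a, b], continuous g}.
  have sub : `[a, b] `<=` `[0, +oo[ by move=> t /=; rewrite !in_itv/= andbT => /andP[/(le_trans a0)].
  move=> x; apply: cvgB; first exact: (continuous_subspaceW sub cf).
  apply: cvgM; first exact: cvg_cst.
  exact: (continuous_subspaceT S_cont).
have gab : g a = g b by rewrite /g; have := kE; rewrite mulrBr; lra.
have [c cab ext] := extremum ab cg gab.
move: cab; rewrite in_itv/= => /andP[ac cb].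
have c0 : 0 < c := le_lt_trans a0 ac.
have lim := fDf.1 c c0.
have limR : (f y - f c) / (S y - S c) @[y --> c^'+] --> Df c.
  exact: cvg_dnbhs_at_right lim.
have limL : (f y - f c) / (S y - S c) @[y --> c^'-] --> Df c.
  exact: cvg_dnbhs_at_left lim.
exists c; first by rewrite ac.
rewrite -kE; congr (_ * _).
have gE y : g y - g c = (f y - f c) - k * (S y - S c) by rewrite /g; ring.
apply/eqP; rewrite eq_sym eq_le.
case: ext => ext; apply/andP; split.
- apply: (cvgr_to_le limR); near=> y.
  have cy : c < y by near: y; exact: nbhs_right_gt.
  have yb : y < b by near: y; exact: nbhs_right_lt.
  have Scy : 0 < S y - S c by rewrite subr_gt0 S_lt// ltW.
  rewrite ler_pdivrMr// -subr_le0 -gE subr_le0; apply: ext.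
  by rewrite in_itv/= (ltW yb) (ltW (lt_trans ac cy)).
- apply: (cvgr_to_ge limL); near=> y.
  have cy : y < c by near: y; exact: nbhs_left_lt.
  have ay : a < y by near: y; exact: nbhs_left_gt.
  have Scy : S y - S c < 0 by rewrite subr_lt0 S_lt// ltW// (le_lt_trans a0).
  rewrite ler_ndivlMr// -subr_le0 -gE subr_le0; apply: ext.
  by rewrite in_itv/= (ltW ay) (ltW (lt_trans cy cb)).
- apply: (cvgr_to_le limL); near=> y.
  have cy : y < c by near: y; exact: nbhs_left_lt.
  have ay : a < y by near: y; exact: nbhs_left_gt.
  have Scy : S y - S c < 0 by rewrite subr_lt0 S_lt// ltW// (le_lt_trans a0).
  rewrite ler_ndivrMr// -subr_ge0 -gE subr_ge0; apply: ext.
  by rewrite in_itv/= (ltW ay) (ltW (lt_trans cy cb)).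
- apply: (cvgr_to_ge limR); near=> y.
  have cy : c < y by near: y; exact: nbhs_right_gt.
  have yb : y < b by near: y; exact: nbhs_right_lt.
  have Scy : 0 < S y - S c by rewrite subr_gt0 S_lt// ltW.
  rewrite ler_pdivlMr// -subr_ge0 -gE subr_ge0; apply: ext.
  by rewrite in_itv/= (ltW yb) (ltW (lt_trans ac cy)).
Unshelve. all: by end_near. Qed.

End scale_mvt.

(** * Laplace transform and tail of the hitting time of 0 *)

Section hitting.
Context (R : realType) (m : {measure set R -> \bar R}) (S : cumulative R R).
Context (P : R -> probability (path_space R) R).
Hypothesis hX : reflected_diffusion m S P.
Let smP := diff_markov hX.
Let recP := diff_recurrent hX.
Let scP := diff_scale hX.
Local Open Scope ereal_scope.
Implicit Types (x y z s t l : R).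

Lemma scale_gt0 x : (0 < x)%R -> (0 < S x)%R.
Proof. by move=> x0; rewrite -(scale_0 scP) (scale_lt scP). Qed.

(** On this event of full probability the pathwise facts hold without exception, so integrands can
    be compared path by path. *)
Definition started_finite y z : set (path_space R) :=
  [set w | X 0 w = y] `&` [set w | hit z w < +oo] `&` [set w | hit 0%R w < +oo].

Lemma measurable_started_finite y z : measurable (started_finite y z).
Proof.
apply: measurableI; last exact: measurable_hit_lt.
by apply: measurableI; [exact: measurable_start|exact: measurable_hit_lt].
Qed.

Lemma prob_setI1 (mu : probability (path_space R) R) (A B : set (path_space R)) :
  measurable A -> measurable B -> mu A = 1 -> mu B = 1 -> mu (A `&` B) = 1.
Proof.
move=> mA mB A1 B1; rewrite -B1; apply: (prob1_eq mA _ mB A1) => [|w Aw].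
  exact: measurableI.
by split=> [[]|].
Qed.

Lemma prob_started_finite y z : (0 <= y)%R -> (0 <= z)%R ->
  P y (started_finite y z) = 1.
Proof.
move=> y0 z0; apply: prob_setI1.
- apply: measurableI; [exact: measurable_start|exact: measurable_hit_lt].
- exact: measurable_hit_lt.
- apply: prob_setI1.
  + exact: measurable_start.
  + exact: measurable_hit_lt.
  + exact: (sm_start smP y0).

  + exact: recP.
- exact: recP.
Qed.

Lemma hit_shift_fin u (w : path_space R) : (0 <= u)%R -> u%:E <= hit 0%R w -> hit 0%R w < +oo ->
  fine (hit 0%R w) = (u + fine (hit 0%R (Defs.shift u w)))%R.
Proof.
move=> u0 uh; rewrite (hit_shift u0 uh).
by case: (hit 0%R (Defs.shift u w)) (hit_ge0 0%R (Defs.shift u w)) => //=.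
Qed.

(** By continuity a path from [y] can neither reach 0 without meeting [z] nor go below [z] before
    meeting it. *)
Lemma started_finite_hit y z (w : path_space R) : (0 <= z)%R -> (z <= y)%R -> started_finite y z w ->
  [/\ (0 <= fine (hit z w))%R, hit z w = (fine (hit z w))%:E,
      (fine (hit z w))%:E <= hit 0%R w &
      forall t, (0 <= t)%R -> (t < fine (hit z w))%R -> (z <= X t w)%R].
Proof.
move=> z0 zy [[/= Xy /hit_finP[hz Xz hzE]] /hit_finP[h0 X0 h0E]]; split=> //.
  by rewrite -hzE h0E; apply: hit_crossing => //; right; rewrite X0 Xy z0 zy.
move=> t t0 th; rewrite leNgt; apply/negP => Xtz.
have := hit_crossing (y := z) (w := w) t0.
rewrite Xy zy (ltW Xtz) => /(_ (or_intror isT)).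
by rewrite hzE lee_fin leNgt th.
Qed.

(** E_y e^(- l H_z), with the starting point as last argument. An infinite hitting time is read as 0
    by the inner [fine]; recurrence makes this a null event. *)
Definition hit_laplace l z y : R :=
  fine (\int[P y]_w (expR (- (l * fine (hit z w))))%:E).

Lemma measurable_expR_hit l z :
  measurable_fun setT (fun w : path_space R => expR (- (l * fine (hit z w)))).
Proof.
apply: measurableT_comp => //; apply: measurableT_comp => //.
by apply: measurable_funM => //; exact: measurable_fine_hit.
Qed.

Lemma expR_hit_bound l z (w : path_space R) : (0 <= l)%R ->
  (0 <= expR (- (l * fine (hit z w))) <= 1)%R.
Proof.
move=> l0; rewrite expR_ge0/= -expR0 ler_expR oppr_le0 mulr_ge0//.
by rewrite fine_ge0// hit_ge0.
Qed.

Lemma hit_laplaceE l z y : (0 <= l)%R ->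
  \int[P y]_w (expR (- (l * fine (hit z w))))%:E = (hit_laplace l z y)%:E.
Proof.
move=> l0; rewrite fineK//.
apply: (@prob_integral_fin _ _ _ (P y) _ 1%R (measurable_expR_hit l z)) => w.
exact: expR_hit_bound.
Qed.

Lemma hit_laplace_bound l z y : (0 <= l)%R -> (0 <= hit_laplace l z y <= 1)%R.
Proof.
move=> l0; rewrite -2!lee_fin -hit_laplaceE//.
apply: (@prob_integral_bound _ _ _ (P y) _ 1%R (measurable_expR_hit l z)) => w.
exact: expR_hit_bound.
Qed.

(** From [y], H_0 is H_z plus an independent copy of H_0 started at [z], so the Laplace transforms
    multiply. *)
Lemma hit_laplaceM l z y : (0 <= l)%R -> (0 <= z)%R -> (z <= y)%R ->
  hit_laplace l 0%R y = (hit_laplace l z y * hit_laplace l 0%R z)%R.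
Proof.
move=> l0 z0 zy; have y0 := le_trans z0 zy.
apply: EFin_inj; rewrite -(hit_laplaceE 0%R y l0).
transitivity ((hit_laplace l z y)%:E * (hit_laplace l 0%R z)%:E); last by [].
rewrite -[X in _ = X * _](hit_laplaceE z y l0) -[X in _ = _ * X](hit_laplaceE 0%R z l0).
pose g t := (expR (- (l * t)))%:E : \bar R.
have mg : measurable_fun setT g.
  by apply/measurable_EFinP; apply: measurableT_comp => //; apply: measurableT_comp => //; exact: measurable_funM.
have mG : measurable_fun setT
    (fun w : path_space R => (expR (- (l * fine (hit 0%R w))))%:E).
  by apply/measurable_EFinP; exact: measurable_expR_hit.
rewrite -(hit_markov_integral smP recP y0 z0 mg mG)//; last by move=> t; rewrite lee_fin expR_ge0.
have mh := @measurable_fine_hit R z.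
apply: (prob1_eq_integral (measurable_started_finite y z) (prob_started_finite y0 z0)) => //.
- apply: emeasurable_funM; first exact: measurableT_comp mg mh.
  exact: measurableT_comp mG (measurable_shift mh).
- by move=> w; rewrite mule_ge0 ?lee_fin ?expR_ge0.
- move=> w sw; have [hz hzE hz0 _] := started_finite_hit z0 zy sw.
  rewrite /g -EFinM -expRD (hit_shift_fin hz hz0); last by have [[_ _]] := sw.
  by rewrite mulrDr opprD.
Qed.

(** Until it reaches [z] the path stays where [f] vanishes, so the potential starts to accumulate
    only at H_z, with the discount e^(- l H_z). *)
Lemma resolvent_hit (l : R) (f : R -> R) (K z y : R) : (0 < l)%R ->
  continuous f -> (forall y, 0 <= f y <= K)%R ->
  (forall y, z <= y -> f y = 0)%R -> (0 <= z)%R -> (z <= y)%R ->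
  resolvent P l f y = (hit_laplace l z y * resolvent P l f z)%R.
Proof.
move=> l0 cf fK fz z0 zy; have y0 := le_trans z0 zy.
have mf : measurable_fun setT f by exact: continuous_measurable_fun.
apply: EFin_inj; rewrite EFinM -!(resolventE P l0 cf fK) -hit_laplaceE ?ltW//.
have mG := measurable_discounted l mf fK.
pose g t := (expR (- (l * t)))%:E : \bar R.
have mg : measurable_fun setT g.
  by apply/measurable_EFinP; apply: measurableT_comp => //; apply: measurableT_comp => //; exact: measurable_funM.
rewrite -(hit_markov_integral smP recP y0 z0 mg mG)//; last 2 first.
- by move=> t; rewrite lee_fin expR_ge0.
- by move=> w; exact: (discounted_ge0 l fK).
have mh := @measurable_fine_hit R z.
apply: (prob1_eq_integral (measurable_started_finite y z) (prob_started_finite y0 z0)) => //.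
- apply: emeasurable_funM; first exact: measurableT_comp mg mh.
  exact: measurableT_comp mG (measurable_shift mh).
- exact: discounted_ge0 fK.
- by move=> w; rewrite mule_ge0 ?lee_fin ?expR_ge0// (discounted_ge0 l fK).
- move=> w sw; have [hz hzE hz0 Xz] := started_finite_hit z0 zy sw.
  rewrite (discounted_split l mf fK w hz) integral0_eq ?add0e// => t.
  rewrite /= in_itv/= => /andP[t0 tz].
  by rewrite fz ?mulr0//; exact: Xz.
Qed.

End hitting.

(** * Tail of the hitting time as a function of the starting point *)

Section hitting_tail.
Context (R : realType) (m : {measure set R -> \bar R}) (S : cumulative R R).
Context (P : R -> probability (path_space R) R) (p : R -> R -> R -> R).
Hypothesis hX : reflected_diffusion m S P.
Hypothesis hp : transition_density m P p.
Let smP := diff_markov hX.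
Let recP := diff_recurrent hX.
Let scP := diff_scale hX.
Local Open Scope ereal_scope.
Implicit Types (x y z s t r : R) (w : path_space R).

Definition hit_tail t y : R := fine (P y [set w | t%:E < hit 0%R w]).

Lemma hit_tailE t y : P y [set w | t%:E < hit 0%R w] = (hit_tail t y)%:E.
Proof. by rewrite fineK// fin_num_measure//; exact: measurable_hit_gt. Qed.

Lemma hit_tail_ge0 t y : (0 <= hit_tail t y)%R.
Proof. by rewrite fine_ge0. Qed.

(** The complement of [scale_hit] between 0 and [x]. Ties are excluded: both times are almost surely
    finite and a path is not at 0 and at [x] at once. *)
Lemma prob_hit_up y x : (0 < y)%R -> (y < x)%R ->
  P y [set w | hit x w < hit 0%R w] = (S y / S x)%:E.
Proof.
move=> y0 yx; have x0 := lt_trans y0 yx.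
have Sx := scale_gt0 hX x0.
have := scale_hit scP (lexx 0%R) (ltW y0) (ltW yx) x0.
rewrite (scale_0 scP) subr0 => h.
have mlt := measurable_hit_lt_hit 0%R x.
rewrite (prob1_eq (measurable_started_finite y x) _ _ (prob_started_finite hX (ltW y0) (ltW x0))
    (B := ~` [set w | hit 0%R w < hit x w])); last 3 first.
- exact: measurable_hit_lt_hit.
- exact: measurableC.
- move=> w [[_ /= /hit_finP[hx Xx xE]] /= /hit_finP[h0 X0 E0]]; split=> [hlt|].
    by apply/negP; rewrite -leNgt ltW.
  move/negP; rewrite -leNgt le_eqVlt => /predU1P[e|//].
  have xx : x = 0%R by rewrite -Xx e X0.
  by exfalso; move: x0; rewrite xx ltxx.
rewrite probability_setC// h -EFinB; congr EFin.
by rewrite mulrBl divff ?gt_eqF// opprB addrC subrK.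
Qed.

(** Before time [t] the order of the two hitting times is witnessed by a rational [q < t] with H_x <
    [q] <= H_0, and both conditions belong to the past of [q]. *)
Lemma past_at_hit_up x : past_at (hit x : path_space R -> \bar R)
  [set w | hit x w < hit 0%R w].
Proof.
split=> [|t t0]; first exact: measurable_hit_lt_hit.
pose T := g_sigma_algebraType (@cylinders R [set s | (0 <= s <= t)%R]).
have E : [set w | hit x w < hit 0%R w] `&` [set w | hit x w < t%:E] =
    \bigcup_(q : rat) [set w | (ratr q < t)%R /\
      (hit x w < (ratr q)%:E /\ ~ (hit 0%R w < (ratr q)%:E))].
  apply/seteqP; split=> [w [/= h1 h2]|w [q _ [/= qt [h1 h2]]]].
    have [hx Xx xE] := hit_finP (lt_trans h2 (ltry t)).
    have [b [xb bt b0]] : exists b, [/\ (fine (hit x w) < b)%R, (b <= t)%R & b%:E <= hit 0%R w].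
      have [h0|] := ltP (hit 0%R w) t%:E.
        have [_ _ E0] := hit_finP (lt_trans h0 (ltry t)).
        exists (fine (hit 0%R w)); rewrite -lte_fin -xE -E0 h1 lexx; split=> //.
        by rewrite -lee_fin -E0 ltW.
      by move=> th; exists t; rewrite -lte_fin -xE h2 lexx.
    have [q] := rat_in_itvoo xb; rewrite in_itv/= => /andP[xq qb].
    exists q => //; split; first exact: lt_le_trans bt.
    rewrite xE lte_fin; split=> //; apply/negP; rewrite -leNgt.
    by apply: le_trans b0; rewrite lee_fin ltW.
  split=> /=; last by apply: lt_trans h1 _; rewrite lte_fin.
  by apply: lt_le_trans h1 _; rewrite leNgt; apply/negP.
rewrite E; apply: (@bigcupT_measurable_rat _ T) => q.
have [qt|tq] := ltP (ratr q : R) t; last first.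
  rewrite (_ : [set w | _ /\ _] = set0); first exact: measurable0.
  by rewrite -subset0 => w [].
rewrite (_ : [set w | _ /\ _] =
   [set w | hit x w < (ratr q)%:E] `&` ~` [set w | hit 0%R w < (ratr q)%:E]).
  have past1 z : past t [set w | hit z w < (ratr q)%:E].
    exact: (past_le (ltW qt) (@past_hit R (ratr q) z)).
  exact: (@measurableI _ T _ _ (past1 x) (@measurableC _ T _ (past1 0%R))).
by apply/seteqP; split=> w /=; [case|move=> ?].
Qed.

Lemma prob_hit_up_shift r y x : (0 < y)%R -> (y < x)%R ->
  P y ([set w | hit x w < hit 0%R w] `&`
    [set w | r%:E < hit 0%R (Defs.shift (fine (hit x w)) w)]) =
  (S y / S x * hit_tail r x)%:E.
Proof.
move=> y0 yx; have x0 := lt_trans y0 yx.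
rewrite (hit_markov smP recP (ltW y0) (ltW x0) (past_at_hit_up x)
  (measurable_hit_gt 0%R r%:E)).
by rewrite (prob_hit_up y0 yx) hit_tailE.
Qed.

Let measurable_shift_gt r x :
  measurable [set w | r%:E < hit 0%R (Defs.shift (fine (hit x w)) w)].
Proof.
apply: (measurable_shift_preimage (T := fun w => fine (hit x w)) (B := [set w | r%:E < hit 0%R w])).
  exact: measurable_fine_hit.
exact: measurable_hit_gt.
Qed.

(** One way to survive past [t] is to visit [x] before 0, which has probability [S y / S x], and
    then to survive for a time [t] from there. This is the monotonicity of the tail divided by
    [S]. *)
Lemma hit_tail_scale t y x : (0 < y)%R -> (y < x)%R ->
  (S y / S x * hit_tail t x <= hit_tail t y)%R.
Proof.
move=> y0 yx; rewrite -lee_fin -(prob_hit_up_shift t y0 yx) -hit_tailE.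
rewrite le_measure ?inE//.
- by apply: measurableI; [exact: measurable_hit_lt_hit|exact: measurable_shift_gt].
- exact: measurable_hit_gt.
move=> w [/= hlt]; have [hx _ xE] := hit_finP (lt_le_trans hlt (leey _)).
have hx0 : (fine (hit x w))%:E <= hit 0%R w by rewrite -xE ltW.
rewrite (hit_shift hx hx0).
by move=> /lt_le_trans; apply; rewrite leeDr// lee_fin.
Qed.

Lemma hit_tail_le t z x : (0 <= z)%R -> (z <= x)%R -> (hit_tail t z <= hit_tail t x)%R.
Proof.
move=> z0 zx; have x0 := le_trans z0 zx.
have pT : past_at (hit z : path_space R -> \bar R) setT.
  by split=> // s s0; rewrite setTI; exact: past_hit.
rewrite -lee_fin -!hit_tailE.
have := hit_markov smP recP x0 z0 pT (measurable_hit_gt 0%R t%:E).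
rewrite setTI probability_setT mul1e => <-.
apply: (prob1_le (measurable_started_finite x z) _ _ (prob_started_finite hX x0 z0)).
- exact: measurable_shift_gt.
- exact: measurable_hit_gt.
move=> w sw /=; have [hz hzE hz0 _] := started_finite_hit z0 zx sw.
by rewrite (hit_shift hz hz0) => /lt_le_trans; apply; rewrite leeDr// lee_fin.
Qed.

(** Phrased by negated strict inequalities because the events [hit y w < s] are those that [past s]
    contains. *)
Let before x s := [set w | ~ (hit 0%R w < s%:E) /\ ~ (hit x w < s%:E)].

Let past_before x s : past s (before x s).
Proof.
pose T := g_sigma_algebraType (@cylinders R [set s' | (0 <= s' <= s)%R]).
exact: (@measurableI _ T _ _ (@measurableC _ T _ (@past_hit R s 0%R))
  (@measurableC _ T _ (@past_hit R s x))).
Qed.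

Let prob_before_shift y x s r : (0 < y)%R -> (y < x)%R -> (0 <= s)%R ->
  P y (before x s `&` [set w | r%:E < hit 0%R (Defs.shift s w)]) <=
  P y (before x s) * (hit_tail r x)%:E.
Proof.
move=> y0 yx s0; have x0 := lt_trans y0 yx.
apply: (@markov_le R P smP y s (before x s) [set w | r%:E < hit 0%R w]
  (hit_tail r x)%:E (ltW y0) s0 (@past_before x s) (measurable_hit_gt 0%R r%:E)).
  by rewrite lee_fin hit_tail_ge0.
move=> w Xy [_ hx]; rewrite hit_tailE lee_fin; apply: hit_tail_le.
  exact: path_ge0.
(* A position above [x] at time [s] would force a visit to [x] by time [s], hence exactly at [s],
   where the position would be [x] itself. *)
rewrite leNgt; apply/negP => xX.
have hxs : hit x w <= s%:E.
  by apply: hit_crossing => //; left; rewrite Xy !ltW.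
have [_ Xx xE] := hit_finP (le_lt_trans hxs (ltry s)).
apply: hx; rewrite lt_neqAle hxs andbT; apply/eqP => e.
have Xs : X s w = x by rewrite -[RHS]Xx e.
by move: xX; rewrite Xs ltxx.
Qed.

(* Restart at [x] if [x] is visited before 0; otherwise the path lies in [`]0, x[]
   at time [s] and its tail is at most the one from [x]. *)
Lemma hit_tail_before y x t s : (0 < y)%R -> (y < x)%R -> (0 <= t)%R -> (0 <= s)%R ->
  ((hit_tail (s + t) y)%:E <=
    (S y / S x * hit_tail t x)%:E + P y (before x s) * (hit_tail t x)%:E).
Proof.
move=> y0 yx t0 s0; have x0 := lt_trans y0 yx.
have mb := past_measurable (@past_before x s).
have ms : measurable [set w : path_space R | t%:E < hit 0%R (Defs.shift s w)].
  exact: (measurable_shift_preimage (T := fun=> s) (B := [set w | t%:E < hit 0%R w]) _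
    (measurable_hit_gt _ _)).
rewrite -hit_tailE -(prob_hit_up_shift t y0 yx).
apply: (@le_trans _ _ (P y ([set w | hit x w < hit 0%R w] `&`
    [set w | t%:E < hit 0%R (Defs.shift (fine (hit x w)) w)]) +
    P y (before x s `&` [set w | t%:E < hit 0%R (Defs.shift s w)]))); last first.
  by rewrite leeD2l// prob_before_shift.
have mA : measurable ([set w | hit x w < hit 0%R w] `&`
    [set w | t%:E < hit 0%R (Defs.shift (fine (hit x w)) w)]).
  by apply: measurableI; [exact: measurable_hit_lt_hit|exact: measurable_shift_gt].
have mB := measurableI _ _ mb ms.
apply: (le_trans _ (measureU2 (P y) mA mB)).
rewrite le_measure ?inE//; [exact: measurable_hit_gt|exact: measurableU|].
move=> w /= st.
have sh : s%:E <= hit 0%R w.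
  by apply/ltW/(le_lt_trans _ st); rewrite lee_fin lerDl.
have [hxs|hxs] := ltP (hit x w) s%:E.
  have [hx _ xE] := hit_finP (lt_trans hxs (ltry s)).
  left; split; first exact: lt_le_trans sh.
  have hx0 : (fine (hit x w))%:E <= hit 0%R w by rewrite -xE ltW// (lt_le_trans hxs).
  move: st; rewrite /= (hit_shift hx hx0).
  have hs : (fine (hit x w) < s)%R by rewrite -lte_fin -xE.
  case: (hit 0%R (Defs.shift (fine (hit x w)) w)) => [h| |] //=.
    by rewrite -EFinD !lte_fin; lra.
  by move=> _; rewrite ltry.
right; split.
  by split; apply/negP; rewrite -leNgt.
move: st; rewrite /= (hit_shift s0 sh).
case: (hit 0%R (Defs.shift s w)) => [h| |] //=.
  by rewrite -EFinD !lte_fin; lra.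
by move=> _; rewrite ltry.
Qed.

(** The extra unit of time turns the weak inequality of [before] into the strict one of
    [hit_tail]. *)
Let prob_before y x s r : (0 < y)%R -> (y < x)%R -> (0 <= s)%R -> (0 <= r)%R ->
  P y (before x (s + (r + 1))) <= P y (before x s) * (hit_tail r x)%:E.
Proof.
move=> y0 yx s0 r0; apply: le_trans (prob_before_shift r y0 yx s0).
have ms : measurable [set w : path_space R | r%:E < hit 0%R (Defs.shift s w)].
  exact: (measurable_shift_preimage (T := fun=> s) (B := [set w | r%:E < hit 0%R w]) _
    (measurable_hit_gt _ _)).
rewrite le_measure ?inE//.
- exact: past_measurable (@past_before _ _).
- by apply: measurableI ms; exact: past_measurable (@past_before _ _).
move=> w [/negP + /negP]; rewrite -!leNgt => h0 hx.
have ss : s%:E <= (s + (r + 1))%:E by rewrite lee_fin; lra.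
have sh : s%:E <= hit 0%R w by apply: le_trans h0.
split; first by split; apply/negP; rewrite -leNgt//; exact: le_trans hx.
move: h0; rewrite /= (hit_shift s0 sh).
case: (hit 0%R (Defs.shift s w)) => [h| |] //=.
  by rewrite -EFinD lee_fin lte_fin; lra.
by move=> _; rewrite ltry.
Qed.

(** Both terms on the right are at most of order [S y] as [y] decreases to 0, so the inequality
    survives division by [S y]. The factor [hit_tail 2^-1 y] is extracted from the first unit of
    time spent between 0 and [x], and [hit_tail r x] from the next [r + 1]. *)
Lemma hit_tail_recursion y x t r : (0 < y)%R -> (y < x)%R -> (0 <= t)%R -> (0 <= r)%R ->
  (hit_tail (r + 2 + t) y <=
    S y / S x * hit_tail t x + hit_tail 2^-1 y * hit_tail r x * hit_tail t x)%R.
Proof.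
move=> y0 yx t0 r0; rewrite -lee_fin.
have r2 : (0 <= r + 2)%R by lra.
apply: (le_trans (hit_tail_before y0 yx t0 r2)).
rewrite EFinD leeD2l// [in leRHS]EFinM lee_pmul ?lee_fin ?hit_tail_ge0//.
rewrite (_ : r + 2 = 1 + (r + 1))%R; last by ring.
apply: (le_trans (prob_before y0 yx ler01 r0)).
rewrite EFinM lee_pmul ?lee_fin ?hit_tail_ge0// -hit_tailE le_measure ?inE//.
- exact: past_measurable (@past_before _ _).
- exact: measurable_hit_gt.
(* [before] only gives 1 <= H_0; comparison with 1/2 restores a strict inequality. *)
move=> w [/negP + _]; rewrite -leNgt; apply: lt_le_trans.
by rewrite lte_fin invf_lt1// ltr1n.
Qed.

(** A surviving path has visited a small level [x] before 0, which has probability [S (u n) / S x],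
    or is at most [x] at time [t]. By the strong Feller property the probability of the latter tends
    to its value from 0, which is small with [x] because [m] has no atom at 0. *)
Lemma hit_tail_cvg_start t (u : R^nat) : (0 < t)%R -> (forall n, 0 < u n)%R ->
  u n @[n --> \oo] --> 0%R -> hit_tail t (u n) @[n --> \oo] --> 0%R.
Proof.
move=> t0 u0 ucvg; apply/cvgrPdist_le => e e0.
pose F (k : nat) : set (path_space R) := [set w | (X t w <= k.+1%:R^-1)%R].
have mF k : measurable (F k).
  rewrite (_ : F k = setT `&` X t @^-1` [set` `]-oo, k.+1%:R^-1]%R]).
    exact: measurable_X.
  by rewrite setTI; apply/seteqP; split=> w /=; rewrite in_itv.
have F0 : \bigcap_k F k = [set w | [set 0%R] (X t w)].
  apply/seteqP; split=> w /= h; last by move=> k _; rewrite /F/= h invr_ge0.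
  apply/eqP; rewrite eq_le; apply/andP; split; last exact: path_ge0.
  rewrite leNgt; apply/negP => Xt.
  have [k _ /(_ k (leqnn k)) kP] := near_infty_natSinv_lt (PosNum Xt).
  by have := h k I; rewrite /F/= leNgt kP.
have PF : P 0%R (\bigcap_k F k) = 0.
  rewrite F0 (density_prob hp t0 (lexx 0%R) (measurable_set1 0%R)).
    apply: null_set_integral => //; last exact: speed_atom (diff_speed hX) 0%R.
    apply/measurable_EFinP; apply: (@eq_measurable_fun _ _ _ _ _
        (fun z : R => p t 0%R (Num.max 0%R z))).
      by move=> z; rewrite inE => ->; rewrite maxxx.
    exact: measurable_funS (measurable_density hp t0 (lexx 0%R)).
  by move=> _ ->; rewrite /= in_itv/= lexx.
have : P 0%R (F k) @[k --> \oo] --> 0.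
  rewrite -PF; apply: nonincreasing_cvg_mu => //.
  - by rewrite (le_lt_trans (probability_le1 _ (mF 0%N)))// ltry.
  - exact: bigcapT_measurable.
  - move=> i j ij; apply/subsetPset => w /= h; apply: (le_trans h).
    by rewrite lef_pV2 ?posrE ?ltr0n// ler_nat.
have e2 : (0 < e / 2)%R by rewrite divr_gt0.
move=> /fine_cvgP[_ /cvgrPdist_lt /(_ _ e2)[k _ /(_ k (leqnn k))]].
rewrite /= sub0r normrN ger0_norm ?fine_ge0// => Pk.
pose x : R := (k.+1%:R^-1)%R.
have x0 : (0 < x)%R by rewrite invr_gt0 ltr0n.
have Sx := scale_gt0 hX x0.
pose f : R -> R := \1_(`]-oo, x]%classic).
have fE y : \int[P y]_w (f (X t w))%:E = P y (F k).
  transitivity (\int[P y]_w (\1_(F k) w)%:E); last by rewrite integral_indic// setIT.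
  apply: eq_integral => w _.
  by rewrite /f !indicE; congr ((nat_of_bool _)%:R%:E); apply/idP/idP; rewrite !inE/= in_itv.
have h1 : \forall n \near \oo, (fine (P (u n) (F k)) < e / 2)%R.
  have fb (y : R) : (0 <= f y <= 1)%R.
    by rewrite /f indicE; case: (_ \in _); rewrite !lexx ler01.
  have : P (u n) (F k) @[n --> \oo] --> (fine (P 0%R (F k)))%:E.
    rewrite fineK ?fin_num_measure// -fE; under eq_cvg do rewrite -fE.
    apply: (strong_feller (diff_speed hX) hp t0 (lexx 0%R) (fun n => ltW (u0 n)) ucvg _ fb).
    exact: measurable_indic.
  by move=> /fine_cvgP[_ /cvgr_lt]; apply.
have h2 : \forall n \near \oo, (S (u n) < S x * (e / 2))%R.
  have : S (u n) @[n --> \oo] --> S 0%R.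
    by apply: (cvg_comp u S ucvg); exact: (Defs.scale_continuous scP).
  by rewrite (scale_0 scP) => /cvgr_lt; apply; rewrite mulr_gt0.
have h3 : \forall n \near \oo, (u n < x)%R by move/cvgr_lt : ucvg; apply.
near=> n.
have a1 : (fine (P (u n) (F k)) < e / 2)%R by near: n.
have a2 : (S (u n) / S x < e / 2)%R by rewrite ltr_pdivrMr// mulrC; near: n.
have a3 : (u n < x)%R by near: n.
rewrite sub0r normrN ger0_norm ?hit_tail_ge0//.
suff : (hit_tail t (u n))%:E <= (S (u n) / S x)%:E + P (u n) (F k).
  by rewrite -(fineK (fin_num_measure (P (u n)) _ (mF k))) -EFinD lee_fin; lra.
have mlt := measurable_hit_lt_hit x 0%R.
rewrite -(prob_hit_up (u0 n) a3) -hit_tailE.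
apply: le_trans (measureU2 (P (u n)) mlt (mF k)).
apply: (prob1_le (measurable_start (u n)) _ _ (sm_start smP (ltW (u0 n)))).
- exact: measurable_hit_gt.
- exact: measurableU.
- move=> w /= Xw tw; have [xX|] := ltP x (X t w); last by right.
  left => /=; apply: le_lt_trans tw; apply: hit_crossing => //; first exact: ltW.
  by left; rewrite Xw !ltW.
Unshelve. all: by end_near. Qed.

Lemma hit_tail_eventually x (e : R) : (0 <= x)%R -> (0 < e)%R ->
  exists2 r, (0 <= r)%R & (hit_tail r x <= e)%R.
Proof.
move=> x0 e0; pose F (n : nat) : set (path_space R) := [set w | n%:R%:E < hit 0%R w].
have mF n : measurable (F n) by exact: measurable_hit_gt.
have FE : \bigcap_n F n = ~` [set w | hit 0%R w < +oo].
  apply/seteqP; split=> w /= h.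
    move=> /hit_finP[h0 _ hE]; have := h (Num.truncn (fine (hit 0%R w))).+1 I.
    rewrite /F/= hE lte_fin ltNge => /negP; apply.
    exact/ltW/truncnS_gt.
  by move=> n _; rewrite /F/=; case: (hit 0%R w) h (hit_ge0 0%R w) => //= r; rewrite ltry.
have : P x (F n) @[n --> \oo] --> 0.
  rewrite -(prob1_setC (measurable_hit_lt 0%R +oo) (recP x0 (lexx 0%R))) -FE.
  apply: nonincreasing_cvg_mu => //.
  - by rewrite (le_lt_trans (probability_le1 _ (mF 0%N)))// ltry.
  - exact: bigcapT_measurable.
  - move=> i j ij; apply/subsetPset => w; rewrite /F/=; apply: le_lt_trans.
    by rewrite lee_fin ler_nat.
move=> /fine_cvgP[_ /cvgrPdist_le /(_ _ e0)[n _ /(_ n (leqnn n))]].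
rewrite /= sub0r normrN ger0_norm ?fine_ge0// => Pn.
by exists n%:R.
Qed.

End hitting_tail.

Section laplace_bounds.
Context (R : realType) (m : {measure set R -> \bar R}) (S : cumulative R R).
Context (P : R -> probability (path_space R) R) (p : R -> R -> R -> R).
Hypothesis hX : reflected_diffusion m S P.
Hypothesis hp : transition_density m P p.
Implicit Types (l t y s : R).

Lemma hit_tail_indic t y :
  ((hit_tail P t y)%:E = \int[P y]_w (\1_[set w | (t%:E < hit 0 w)%E] w)%:E)%E.
Proof. by rewrite -hit_tailE integral_indic ?setIT//; exact: measurable_hit_gt. Qed.

(** Integrates e^(- l t) <= e^(- l H_0) + 1_(H_0 > t). *)
Lemma hit_laplace_ge l t y : 0 <= l -> 0 <= t -> 0 <= y ->
  expR (- (l * t)) - hit_tail P t y <= hit_laplace P l 0 y.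
Proof.
move=> l0 t0 y0; rewrite lerBlDr -lee_fin EFinD -(hit_laplaceE _ _ _ l0) hit_tail_indic.
have mt := measurable_hit_gt 0 t%:E.
rewrite -ge0_integralD//; last 2 first.
- by apply/measurable_EFinP; exact: measurable_expR_hit.
- by apply/measurable_EFinP; exact: measurable_indic.
rewrite -[leLHS](_ : \int[P y]_w (expR (- (l * t)))%:E = _)%E; last first.
  by rewrite integral_cst//= probability_setT mule1.
apply: ge0_le_integral => //.
- apply: emeasurable_funD.
    by apply/measurable_EFinP; exact: measurable_expR_hit.
  by apply/measurable_EFinP; exact: measurable_indic.
- move=> w _; rewrite -EFinD lee_fin indicE.
  have [tw|wt] := ltP t%:E (hit 0 w).
    rewrite mem_set//= (le_trans (y := 1)) ?lerDr ?expR_ge0//.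
    by rewrite -expR0 ler_expR oppr_le0 mulr_ge0.
  rewrite ler_wpDr// ler_expR lerN2 ler_wpM2l//.
  by rewrite -lee_fin fineK// ge0_fin_numE ?hit_ge0// (le_lt_trans wt)// ltry.
Qed.

(** Integrates e^(- l H_0) + (1 - e^(- l s)) 1_(H_0 > s) <= 1, valid wherever H_0 is finite. A lower
    bound on the tail thus keeps the transform away from 1. *)
Lemma hit_laplace_le l s y : 0 <= l -> 0 <= s -> 0 <= y ->
  hit_laplace P l 0 y <= 1 - (1 - expR (- (l * s))) * hit_tail P s y.
Proof.
move=> l0 s0 y0; rewrite lerBrDr -lee_fin EFinD EFinM -(hit_laplaceE _ _ _ l0) hit_tail_indic.
have mt := measurable_hit_gt 0 s%:E.
have e1 : 0 <= 1 - expR (- (l * s)).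
  by rewrite subr_ge0 -expR0 ler_expR oppr_le0 mulr_ge0.
rewrite -ge0_integralZl//; last by apply/measurable_EFinP; exact: measurable_indic.
rewrite -ge0_integralD//; last 3 first.
- by apply/measurable_EFinP; exact: measurable_expR_hit.
- by move=> w _; rewrite mule_ge0 ?lee_fin.
- by apply: measurable_funeM; apply/measurable_EFinP; exact: measurable_indic.
rewrite -[leRHS](_ : \int[P y]_w 1%:E = _)%E; last first.
  by rewrite integral_cst//= probability_setT mule1.
apply: ae_ge0_le_integral => //.
- by move=> w _; rewrite adde_ge0 ?mule_ge0 ?lee_fin ?expR_ge0.
- apply: emeasurable_funD.
    by apply/measurable_EFinP; exact: measurable_expR_hit.
  by apply: measurable_funeM; apply/measurable_EFinP; exact: measurable_indic.
have := prob1_ae (measurable_hit_lt 0 +oo%E) (diff_recurrent hX y0 (lexx 0)).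
apply: filterS => w /= /hit_finP[h0 _ hE] _.
rewrite -EFinM -EFinD lee_fin indicE.
have [sw|ws] := ltP s%:E (hit 0 w).
  rewrite mem_set//= mulr1.
  suff : expR (- (l * fine (hit 0 w))) <= expR (- (l * s)) by lra.
  by rewrite ler_expR lerN2 ler_wpM2l// ltW// -lte_fin -hE.
rewrite memNset/= ?mulr0 ?addr0; last by apply/negP; rewrite -leNgt.
by rewrite -expR0 ler_expR oppr_le0 mulr_ge0.
Qed.

(** A path from [y > 0] is not at 0 at once, so the events H_0 <= 1 / (n + 1) decrease to a null
    set. *)
Lemma hit_tail_near0 y (e : R) : 0 < y -> 0 < e ->
  exists2 s, 0 < s & 1 - e <= hit_tail P s y.
Proof.
move=> y0 e0; pose F (n : nat) : set (path_space R) :=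
  [set w | (hit 0 w <= (n.+1%:R^-1)%:E)%E].
have mF n : measurable (F n).
  rewrite (_ : F n = ~` [set w | ((n.+1%:R^-1)%:E < hit 0 w)%E]).
    by apply: measurableC; exact: measurable_hit_gt.
  by apply/seteqP; split=> w /=; rewrite /F/= leNgt => /negP.
have FE : \bigcap_n F n `<=` ~` [set w | X 0 w = y].
  move=> w h /= Xw.
  have /hit_finP[h0 X0 hE] : (hit 0 w < +oo)%E by apply: le_lt_trans (h 0%N I) _; rewrite ltry.
  have hw : fine (hit 0 w) = 0.
    apply/eqP; rewrite eq_le h0 andbT leNgt; apply/negP => hgt.
    have [k _ /(_ k (leqnn k)) kP] := near_infty_natSinv_lt (PosNum hgt).
    by have := h k I; rewrite /F/= hE lee_fin leNgt kP.
  by move: X0; rewrite hw Xw => yy; move: y0; rewrite yy ltxx.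
have PF : P y (\bigcap_n F n) = 0%E.
  apply/eqP; rewrite eq_le measure_ge0 andbT.
  have s1 := sm_start (diff_markov hX) (ltW y0).
  rewrite -(prob1_setC (measurable_start y) s1) le_measure ?inE//.
    exact: bigcapT_measurable.
  by apply: measurableC; exact: measurable_start.
have : P y (F n) @[n --> \oo] --> 0%E.
  rewrite -PF; apply: nonincreasing_cvg_mu => //.
  - by rewrite (le_lt_trans (probability_le1 _ (mF 0%N)))// ltry.
  - exact: bigcapT_measurable.
  - move=> i j ij; apply/subsetPset => w /= h; apply: (le_trans h).
    by rewrite lee_fin lef_pV2 ?posrE ?ltr0n// ler_nat.
move=> /fine_cvgP[_ /cvgrPdist_le /(_ _ e0)[n _ /(_ n (leqnn n))]].
rewrite /= sub0r normrN ger0_norm ?fine_ge0// => Pn.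
exists n.+1%:R^-1; first by rewrite invr_gt0.
rewrite lerBlDr -lerBlDl (le_trans _ Pn)//.
rewrite -lee_fin EFinB -hit_tailE fineK ?fin_num_measure//.
rewrite -probability_setC//; last exact: measurable_hit_gt.
rewrite le_measure ?inE//; first by apply: measurableC; exact: measurable_hit_gt.
by move=> w /= /negP; rewrite -leNgt.
Qed.

Lemma hit_laplace_lt1 l y : 0 < l -> 0 < y -> hit_laplace P l 0 y < 1.
Proof.
move=> l0 y0; have [s s0 hs] := hit_tail_near0 y0 (ltac:(lra) : 0 < 2^-1 :> R).
apply: le_lt_trans (hit_laplace_le (ltW l0) (ltW s0) (ltW y0)) _.
rewrite ltrBlDr ltrDl mulr_gt0//; last lra.
by rewrite subr_gt0 -expR0 ltr_expR oppr_lt0 mulr_gt0.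
Qed.

Lemma hit_laplace_large y : 0 < y ->
  exists2 l0, 0 < l0 & forall l, l0 <= l -> hit_laplace P l 0 y <= 2^-1.
Proof.
move=> y0; have [s s0 hs] := hit_tail_near0 y0 (ltac:(lra) : 0 < 4^-1 :> R).
(* At rates above [3 / s] one has e^(l s) >= 1 + l s >= 4, and (3 / 4) (3 / 4) >= 1 / 2. *)
exists (3 / s) => [|l sl]; first by rewrite divr_gt0.
have l0 : 0 < l by apply: lt_le_trans sl; rewrite divr_gt0.
apply: le_trans (hit_laplace_le (ltW l0) (ltW s0) (ltW y0)) _.
have : expR (- (l * s)) <= 4^-1.
  rewrite expRN lef_pV2 ?posrE ?expR_gt0//.
  have : 3 <= l * s by rewrite -ler_pdivrMr.
  by have := expR_ge1Dx (l * s); lra.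
have := expR_ge0 (- (l * s)).
move: (expR _) => e e0 e4.
have : (3 / 4) * (3 / 4) <= (1 - e) * hit_tail P s y by apply: ler_pM; lra.
by lra.
Qed.

Lemma hit_laplace_cvg_start l (u : R^nat) : 0 < l -> (forall n, 0 < u n) ->
  u n @[n --> \oo] --> 0 -> hit_laplace P l 0 (u n) @[n --> \oo] --> (1 : R).
Proof.
move=> l0 u0 ucvg; apply/cvgrPdist_le => e e0.
pose t := e / 2 / l.
have t0 : 0 < t by rewrite !divr_gt0.
have e2 : 0 < e / 2 by rewrite divr_gt0.
have et : 1 - e / 2 <= expR (- (l * t)).
  by have := expR_ge1Dx (- (l * t)); rewrite /t [l * _]mulrC divfK ?gt_eqF.
have /cvgrPdist_le /(_ _ e2) h := hit_tail_cvg_start hX hp t0 u0 ucvg.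
near=> n.
have tn : `|0 - hit_tail P t (u n)| <= e / 2 by near: n.
move: tn; rewrite sub0r normrN ger0_norm ?hit_tail_ge0// => tn.
have h1 := hit_laplace_ge (ltW l0) (ltW t0) (ltW (u0 n)).
have /andP[_ h2] := hit_laplace_bound P 0 (u n) (ltW l0).
by rewrite ger0_norm ?subr_ge0//; lra.
Unshelve. all: by end_near. Qed.

End laplace_bounds.

(** * The Green function at 0 *)

Section sandwich.
Context (R : realType) (m : {measure set R -> \bar R}) (S : cumulative R R).
Context (P : R -> probability (path_space R) R) (p : R -> R -> R -> R).
Hypothesis hX : reflected_diffusion m S P.
Hypothesis hp : transition_density m P p.
Context (l : R) (f : R -> R) (K eps : R).
Hypothesis l0 : 0 < l.
Hypothesis cf : continuous f.
Hypothesis fK : forall y, 0 <= f y <= K.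
Hypothesis eps0 : 0 < eps.
Hypothesis f_eps : forall y, eps <= y -> f y = 0.
Hypothesis f_mass : \int[m]_(z in `]0, eps]) f z = 1.
Implicit Types x y z : R.

Local Notation u := (resolvent P l f).
Local Notation phi := (hit_laplace P l 0).

Definition speed_mass y : R := fine (m `]0, y]%classic).

Lemma speed_mass_fin y : (m `]0%R, y]%classic < +oo)%E.
Proof.
apply: le_lt_trans (speed_fin (diff_speed hX) y); apply: le_measure; rewrite ?inE//.
by move=> z /=; rewrite !in_itv/= => /andP[/ltW -> ->].
Qed.

Lemma speed_massE y : m `]0, y]%classic = (speed_mass y)%:E.
Proof. by rewrite fineK// ge0_fin_numE//; exact: speed_mass_fin. Qed.

Lemma speed_mass_ge0 y : 0 <= speed_mass y.
Proof. by rewrite fine_ge0. Qed.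

Lemma speed_mass_le y z : y <= z -> speed_mass y <= speed_mass z.
Proof.
move=> yz; rewrite -lee_fin -!speed_massE; apply: le_measure; rewrite ?inE//.
by move=> t /=; rewrite !in_itv/= => /andP[-> /le_trans]; apply.
Qed.

Let mf : measurable_fun setT f. Proof. exact: continuous_measurable_fun. Qed.

Let integrable_bounded (g : R -> R) (M : R) y :
  measurable_fun `]0, y] g -> (forall z, z \in `]0, y]%R -> 0 <= g z <= M) ->
  m.-integrable `]0, y] (EFin \o g).
Proof.
move=> mg gM; apply/integrableP; split; first exact/measurable_EFinP.
apply: (@le_lt_trans _ _ (\int[m]_(z in `]0%R, y]) M%:E)%E).
  apply: ge0_le_integral => //.
  - by apply: measurableT_comp => //; exact/measurable_EFinP.
  - by move=> z zy; have /andP[g0 gm] := gM z zy; rewrite /= ger0_norm.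
by rewrite integral_cst//= speed_massE -EFinM ltry.
Qed.

Let mu_u y : measurable_fun `]0, y] u.
Proof.
apply: (@eq_measurable_fun _ _ _ _ _ (fun x : R => u (Num.max 0 x))).
  by move=> z; rewrite inE/= in_itv/= => /andP[z0 _]; rewrite max_r// ltW.
apply: measurable_funS (continuous_measurable_fun _) => //.
exact: (resolvent_max_continuous hX hp l0 cf fK).
Qed.

Let f_itv y : m.-integrable `]0, y] (EFin \o f).
Proof. by apply: (@integrable_bounded _ K) => //; exact: measurable_funS mf. Qed.

Let u_itv y : m.-integrable `]0, y] (EFin \o u).
Proof.
apply: (@integrable_bounded _ (K / l)) => // z _.
by rewrite (resolvent_ge0 _ _ fK) (resolvent_le _ l0 cf fK).
Qed.

Let mass_f y : 0 <= y ->
  0 <= \int[m]_(z in `]0, y]) f z <= 1 /\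
  (eps <= y -> \int[m]_(z in `]0, y]) f z = 1).
Proof.
move=> y0; have f0 z : 0 <= f z by have /andP[] := fK z.
have J0 : 0 <= \int[m]_(z in `]0, y]) f z by apply: Rintegral_ge0.
have E : eps <= y -> \int[m]_(z in `]0, y]) f z = 1.
  move=> ey; have dec : `]0, y]%classic = `]0, eps]%classic `|` `]eps, y]%classic.
    apply/seteqP; split=> z /=; rewrite !in_itv/=.
      by move=> /andP[-> ->]; have [ze|ze] := leP z eps; [left|right].
    move=> [/andP[-> /le_trans->//]|/andP[ez ->]].
    by rewrite (lt_trans eps0).
  rewrite dec Rintegral_setU//; last 2 first.
  - by rewrite -dec; exact: f_itv.
  - rewrite disj_set2E; apply/eqP; rewrite -subset0 => z [/=].
    by rewrite !in_itv/= => /andP[_ ze] /andP[]; rewrite ltNge ze.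
  rewrite f_mass (@eq_Rintegral _ _ _ m _ (cst 0)) ?Rintegral_cst//= ?mul0r ?addr0//.
  by move=> z; rewrite inE/= in_itv/= => /andP[ez _]; rewrite f_eps// ltW.
split=> //; rewrite J0/=.
have [ey|ye] := leP eps y; first by rewrite E.
rewrite -f_mass fine_le ?integrable_fin_num//; try exact: f_itv.
apply: ge0_subset_integral => //.
- by apply/measurable_EFinP; exact: measurable_funS mf.
- by move=> z _; rewrite lee_fin.
- by move=> z /=; rewrite !in_itv/= => /andP[-> /le_trans]; apply; exact: ltW.
Qed.

Let M : R := u eps + S eps.

Lemma resolvent_right y : eps <= y -> u y = hit_laplace P l eps y * u eps.
Proof. by move=> ey; apply: (resolvent_hit hX l0 cf fK) => //; exact: ltW. Qed.

(** Since [Du 0 = 0], the flux at [z] is l times the integral of [u] minus the mass of [f] up to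
    [z]. It is at least -1 everywhere, and at most -1 + l M m(]0, y]) between [eps] and [y], where M
    = [u eps + S eps] bounds [u]. The mean value theorem turns these bounds into bounds on
    increments of [u]. As [f] shrinks to a Dirac mass at 0, they squeeze [u eps] towards S(y) / (1 -
    phi(y)), up to the factor 1 - l M m(]0, y]). *)
Lemma resolvent_sandwich y : eps < y ->
  [/\ u eps * (phi eps - phi y) <= (S y - S eps) * phi eps,
      (1 - l * (u eps + S eps) * speed_mass y) * ((S y - S eps) * phi eps) <=
        u eps * (phi eps - phi y),
      u 0 <= u eps + S eps &
      u eps - l * (u eps + S eps) * speed_mass eps * S eps <= u 0].
Proof.
move=> ey.
have [[cu _] _ [Du [dS dm Du0]]] := resolvent_ode hX hp l0 cf fK.
have scP := diff_scale hX.
have mvt := scale_mvt (scale_lt scP) (Defs.scale_continuous scP) cu dS.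
have Seps : 0 < S eps by exact: (scale_gt0 hX eps0).
have u0 z : 0 <= u z by exact: (resolvent_ge0 P l fK).
have DuE z : 0 <= z -> Du z = l * (\int[m]_(x in `]0, z]) u x) - \int[m]_(x in `]0, z]) f x.
  move=> z0; have := dm 0 z (lexx 0) z0; rewrite Du0 subr0 => ->.
  rewrite RintegralB//; first by rewrite RintegralZl.
  rewrite (_ : EFin \o _ = (fun x => l%:E * (EFin \o u) x)%E)//.
  exact: integrableZl.
have Iu0 z : 0 <= \int[m]_(x in `]0, z]) u x by apply: Rintegral_ge0.
have Du_ge z : 0 <= z -> -1 <= Du z.
  move=> z0; have [/andP[_ J1] _] := mass_f z0.
  by have := mulr_ge0 (ltW l0) (Iu0 z); rewrite DuE//; lra.
(* To the right of [eps], [u] is a fraction of [u eps]; to the left, a slope of at least -1 in the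
   scale lets it exceed [u eps] by at most [S eps]. *)
have uM z : 0 <= z -> u z <= M.
  move=> z0; have [ez|ze] := leP eps z.
    rewrite resolvent_right// (le_trans (y := u eps))//; last by rewrite lerDl ltW.
    by rewrite ler_piMl//; have /andP[] := hit_laplace_bound P eps z (ltW l0).
  have [c /andP[zc ce] E] := mvt z eps z0 ze.
  have Sz : 0 <= S z.
    move: z0; rewrite le_eqVlt => /predU1P[<-|]; first by rewrite (scale_0 scP).
    by move=> /(scale_gt0 hX)/ltW.
  have Sze : 0 <= S eps - S z by rewrite subr_ge0 ltW// (scale_lt scP).
  have := Du_ge c (le_trans z0 (ltW zc)).
  move=> /(fun h => ler_wpM2r Sze h); rewrite -E /M; lra.
have Iu z : 0 <= z -> \int[m]_(x in `]0, z]) u x <= M * speed_mass z.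
  move=> z0; apply: (@le_trans _ _ (\int[m]_(x in `]0, z]) M)).
    apply: le_Rintegral => //.
      apply: (@integrable_bounded _ M) => //.
      by move=> x _; rewrite lexx /M addr_ge0// ltW.
    by move=> x /=; rewrite in_itv/= => /andP[x0 _]; apply: uM; exact: ltW.
  by rewrite Rintegral_cst.
have Sey : 0 < S y - S eps by rewrite subr_gt0 (scale_lt scP)// ltW.
have phi0 : 0 <= phi eps by have /andP[] := hit_laplace_bound P 0 eps (ltW l0).
(* At [y], [u] and [phi] are the same multiple of their values at [eps], so an increment of [phi]
   can be traded for one of [u]. *)
have uy : u eps * (phi eps - phi y) = (u eps - u y) * phi eps.
  rewrite (resolvent_right (ltW ey)) (hit_laplaceM hX (ltW l0) (ltW eps0) (ltW ey)).
  by ring.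
have [c /andP[ec cy] Ec] := mvt eps y (ltW eps0) ey.
have c0 : 0 <= c := ltW (lt_trans eps0 ec).
have [c1 /andP[c10 c1e] Ec1] := mvt 0 eps (lexx 0) eps0.
have Dc : Du c <= l * (M * speed_mass y) - 1.
  have [_ /(_ (ltW ec)) J1] := mass_f c0.
  rewrite DuE// J1 lerB// ler_wpM2l ?(ltW l0)//.
  apply: (le_trans (Iu c c0)); rewrite ler_wpM2l ?speed_mass_le ?(ltW cy)//.
  by rewrite /M addr_ge0// ltW.
have Dc1 : Du c1 <= l * (M * speed_mass eps).
  have [/andP[J0 _] _] := mass_f (ltW c10).
  rewrite DuE ?(ltW c10)// lerBlDr ler_wpDr// ler_wpM2l ?(ltW l0)//.
  apply: (le_trans (Iu c1 (ltW c10))); rewrite ler_wpM2l ?speed_mass_le ?(ltW c1e)//.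
  by rewrite /M addr_ge0// ltW.
split.
- rewrite uy ler_wpM2r//.
  have := ler_wpM2r (ltW Sey) (Du_ge c c0); rewrite -Ec; lra.
- rewrite uy mulrA ler_wpM2r// -/M.
  have := ler_wpM2r (ltW Sey) Dc; rewrite -Ec.
  by rewrite !mulrBl mul1r -!mulrA; lra.
- exact: uM.
- rewrite -/M; have := ler_wpM2r (ltW Seps) Dc1.
  by move: Ec1; rewrite (scale_0 scP) subr0 => <-; rewrite !mulrA; lra.
Qed.

End sandwich.

(** * Approximate Dirac masses at 0 and their potentials *)

Section approximate_identity.
Context (R : realType) (m : {measure set R -> \bar R}) (S : cumulative R R).
Context (P : R -> probability (path_space R) R) (p : R -> R -> R -> R).
Hypothesis hX : reflected_diffusion m S P.
Hypothesis hp : transition_density m P p.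
Implicit Types (x y z t l : R) (n : nat).

(** Constant on the negative half-line, so that continuity and bounds hold on all of R, as the
    resolvent lemmas ask. *)
Definition tent (eps z : R) : R := Num.max 0 (1 - Num.max 0 z / eps).

Definition tent_mass (eps : R) : R := \int[m]_(z in `]0, eps]) tent eps z.

Definition bump (eps z : R) : R := tent eps z / tent_mass eps.

Lemma tent_continuous eps : continuous (tent eps).
Proof.
move=> z; apply: (@continuous_max R R (cst 0) _ z); first exact: cvg_cst.
apply: cvgB; first exact: cvg_cst.
apply: cvgM; last exact: cvg_cst.
by apply: (@continuous_max R R (cst 0) id); [exact: cvg_cst|exact: cvg_id].
Qed.

Lemma tent_bound eps z : 0 < eps -> 0 <= tent eps z <= 1.
Proof.
move=> e0; rewrite le_max lexx/= ge_max ler01/= gerBl divr_ge0//.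
  by rewrite le_max lexx.
exact: ltW.
Qed.

Lemma tent_eq0 eps z : 0 < eps -> eps <= z -> tent eps z = 0.
Proof.
move=> e0 ez; apply/max_l; rewrite subr_le0 ler_pdivlMr// mul1r.
by rewrite le_max ez orbT.
Qed.

Lemma tent_massP eps : 0 < eps -> m.-integrable `]0, eps] (EFin \o tent eps) /\ 0 < tent_mass eps.
Proof.
move=> e0; have mt : measurable_fun setT (tent eps).
  by apply: continuous_measurable_fun; exact: tent_continuous.
have it : m.-integrable `]0, eps] (EFin \o tent eps).
  apply: measurable_bounded_integrable => //.
  - exact: speed_mass_fin hX eps.
  - exact: measurable_funS mt.
  - exists 1; split=> // M M1 z _ /=.
    by have /andP[t0 t1] := tent_bound z e0; rewrite ger0_norm// (le_trans t1)// ltW.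
split=> //; rewrite -lte_fin /tent_mass /Rintegral fineK; last first.
  exact: integrable_fin_num.
have h0 : 0 < eps / 2 by rewrite divr_gt0.
(* The tent is at least 1/2 on []0, eps / 2[], which has positive speed measure. *)
apply: (@lt_le_trans _ _ (\int[m]_(z in `]0%R, (eps / 2)%R[) (2^-1)%R%:E)%E).
  rewrite integral_cst//=; apply: mule_gt0; first by rewrite lte_fin invr_gt0.
  exact: (speed_gt0 (diff_speed hX) (lexx 0) h0).
apply: (@le_trans _ _ (\int[m]_(z in `]0%R, (eps / 2)%R[) (tent eps z)%:E)%E).
  apply: ge0_le_integral => //.
  - by apply/measurable_EFinP; exact: measurable_funS mt.
  - move=> z /=; rewrite in_itv/= => /andP[z0 ze].
    rewrite lee_fin le_max; apply/orP; right; rewrite (max_r (ltW z0)).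
    have : z / eps <= 2^-1 by rewrite ler_pdivrMr//; lra.
    by lra.
apply: ge0_subset_integral => //.
- by apply/measurable_EFinP; exact: measurable_funS mt.
- by move=> z _; rewrite lee_fin; have /andP[] := tent_bound z e0.
- by move=> z /=; rewrite !in_itv/= => /andP[-> ze]/=; lra.
Qed.

Lemma bump_continuous eps : continuous (bump eps).
Proof.
by move=> z; apply: cvgM; [exact: tent_continuous|exact: cvg_cst].
Qed.

Lemma bump_bound eps z : 0 < eps -> 0 <= bump eps z <= (tent_mass eps)^-1.
Proof.
move=> e0; have [_ B0] := tent_massP e0; have /andP[t0 t1] := tent_bound z e0.
by rewrite divr_ge0 ?(ltW B0)//= ler_piMl// invr_ge0 ltW.
Qed.

Lemma bump_eq0 eps z : 0 < eps -> eps <= z -> bump eps z = 0.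
Proof. by move=> e0 ez; rewrite /bump tent_eq0// mul0r. Qed.

Lemma bump_mass eps : 0 < eps -> \int[m]_(z in `]0, eps]) bump eps z = 1.
Proof.
move=> e0; have [it B0] := tent_massP e0.
by rewrite RintegralZr// divff// gt_eqF.
Qed.

Definition mesh n : R := n.+1%:R^-1.

Lemma mesh_gt0 n : 0 < mesh n. Proof. by rewrite invr_gt0. Qed.

Lemma mesh_cvg : mesh n @[n --> \oo] --> 0.
Proof.
apply/cvgrPdist_lt => e e0; near=> n.
rewrite sub0r normrN gtr0_norm ?mesh_gt0//.
by near: n; exact: (near_infty_natSinv_lt (PosNum e0)).
Unshelve. all: by end_near. Qed.

Definition potential l n x : R := resolvent P l (bump (mesh n)) x.

(** The value around which the sandwich confines the potentials for vanishing meshes. It lies above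
    R_l(0, 0) for every [y > 0] and tends to it as [y] decreases to 0. *)
Definition kappa l y : R := S y / (1 - hit_laplace P l 0 y).

Lemma scale_mesh_cvg : S (mesh n) @[n --> \oo] --> 0.
Proof.
rewrite -(scale_0 (diff_scale hX)); apply: (cvg_comp mesh S mesh_cvg).
exact: (Defs.scale_continuous (diff_scale hX)).
Qed.

Lemma kappa_cvg l y : 0 < l -> 0 < y ->
  (S y - S (mesh n)) * hit_laplace P l 0 (mesh n) /
    (hit_laplace P l 0 (mesh n) - hit_laplace P l 0 y) @[n --> \oo] --> kappa l y.
Proof.
move=> l0 y0.
have c1 := hit_laplace_cvg_start hX hp l0 mesh_gt0 mesh_cvg.
rewrite /kappa -[S y in X in _ --> X](_ : (S y - 0) * 1 = S y); last by rewrite subr0 mulr1.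
apply: cvgM.
  by apply: cvgM => //; apply: cvgB; [exact: cvg_cst|exact: scale_mesh_cvg].
apply: cvgV; first by rewrite subr_eq0 gt_eqF// (hit_laplace_lt1 hX).
by apply: cvgB => //; exact: cvg_cst.
Qed.

Let sandwich l n y : 0 < l -> mesh n < y ->
  let a := potential l n (mesh n) in
  let phi := hit_laplace P l 0 in
  [/\ a * (phi (mesh n) - phi y) <= (S y - S (mesh n)) * phi (mesh n),
      (1 - l * (a + S (mesh n)) * speed_mass m y) * ((S y - S (mesh n)) * phi (mesh n)) <=
        a * (phi (mesh n) - phi y),
      potential l n 0 <= a + S (mesh n) &
      a - l * (a + S (mesh n)) * speed_mass m (mesh n) * S (mesh n) <= potential l n 0].
Proof.
move=> l0 ny a phi; have e0 := mesh_gt0 n.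
apply: (resolvent_sandwich hX hp l0 (@bump_continuous (mesh n))
  (fun y => bump_bound y e0) e0 (fun y => @bump_eq0 (mesh n) y e0) (bump_mass e0) ny).
Qed.

Lemma potential_upper l y (e : R) : 0 < l -> 0 < y -> 0 < e ->
  \forall n \near \oo, potential l n 0 <= potential l n (mesh n) + S (mesh n) <= kappa l y + e.
Proof.
move=> l0 y0 e0; have e2 : 0 < e / 2 by rewrite divr_gt0.
have /cvgrPdist_le /(_ _ e2) h1 := kappa_cvg l0 y0.
have /cvgrPdist_le /(_ _ e2) h2 := scale_mesh_cvg.
have h3 : \forall n \near \oo, mesh n < y by have /cvgr_lt := mesh_cvg; apply.
have phi1 := hit_laplace_lt1 hX l0 y0.
have h4 : \forall n \near \oo, hit_laplace P l 0 y < hit_laplace P l 0 (mesh n).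
  by have /cvgr_gt := hit_laplace_cvg_start hX hp l0 mesh_gt0 mesh_cvg; apply.
near=> n.
have ny : mesh n < y by near: n.
have [s1 _ -> _] := sandwich l0 ny; rewrite /=.
have phin : 0 < hit_laplace P l 0 (mesh n) - hit_laplace P l 0 y.
  by rewrite subr_gt0; near: n.
rewrite -ler_pdivlMr// in s1.
have n1 : `|kappa l y - (S y - S (mesh n)) * hit_laplace P l 0 (mesh n) /
    (hit_laplace P l 0 (mesh n) - hit_laplace P l 0 y)| <= e / 2 by near: n.
have n2 : `|0 - S (mesh n)| <= e / 2 by near: n.
by move: n1 n2; rewrite !ler_norml => /andP[? ?] /andP[? ?]; lra.
Unshelve. all: by end_near. Qed.

Let cvg_affine (u v : nat -> R) (a q c : R) : u n @[n --> \oo] --> a ->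
  v n @[n --> \oo] --> 0 -> u n * q - c * v n @[n --> \oo] --> a * q.
Proof.
move=> ua v0; rewrite -[X in _ --> X]subr0 -(mulr0 c).
apply: cvgB; first by apply: cvgM => //; exact: cvg_cst.
by apply: cvgM => //; exact: cvg_cst.
Qed.

(** The second point [z] bounds [potential l n (mesh n) + S (mesh n)] by [kappa l z + 1]. With [z]
    fixed this bound does not move with [y], so the error factor tends to 1 as [y] decreases to
    0. *)
Lemma potential_lower l y z (e : R) : 0 < l -> 0 < y -> 0 < z -> 0 < e ->
  \forall n \near \oo,
    kappa l y * (1 - l * (kappa l z + 1) * speed_mass m y) - e <= potential l n 0.
Proof.
move=> l0 y0 z0 e0; have C_up := potential_upper l0 z0 (ltr01 : 0 < 1 :> R).
move: (kappa l z + 1) C_up => C C_up; set q := 1 - l * C * speed_mass m y.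
have h3 : \forall n \near \oo, mesh n < y by have /cvgr_lt := mesh_cvg; apply.
have phi1 := hit_laplace_lt1 hX l0 y0.
have h4 : \forall n \near \oo, hit_laplace P l 0 y < hit_laplace P l 0 (mesh n).
  by have /cvgr_gt := hit_laplace_cvg_start hX hp l0 mesh_gt0 mesh_cvg; apply.
have lim : (S y - S (mesh n)) * hit_laplace P l 0 (mesh n) /
    (hit_laplace P l 0 (mesh n) - hit_laplace P l 0 y) * q -
    l * C * speed_mass m 1 * S (mesh n) @[n --> \oo] --> kappa l y * q.
  exact: (@cvg_affine _ _ _ q (l * C * speed_mass m 1) (kappa_cvg l0 y0) scale_mesh_cvg).
have /cvgrPdist_le /(_ _ e0) h5 := lim.
near=> n.
have ny : mesh n < y by near: n.
have [_ s2 _ s4] := sandwich l0 ny.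
have phin : 0 < hit_laplace P l 0 (mesh n) - hit_laplace P l 0 y.
  by rewrite subr_gt0; near: n.
have n1 : `|kappa l y * q - ((S y - S (mesh n)) * hit_laplace P l 0 (mesh n) /
    (hit_laplace P l 0 (mesh n) - hit_laplace P l 0 y) * q -
    l * C * speed_mass m 1 * S (mesh n))| <= e by near: n.
have /andP[_ aC] : potential l n 0 <= potential l n (mesh n) + S (mesh n) <= C by near: n.
move: s2 s4 n1; set a := potential l n (mesh n); set sn := S (mesh n).
set X := (S y - sn) * _; set d := (_ - hit_laplace P l 0 y).
move=> s2 s4; rewrite ler_norml => /andP[_ n1].
have sn0 : 0 < sn by apply: (scale_gt0 hX); exact: mesh_gt0.
have X0 : 0 <= X.
  rewrite mulr_ge0//; last by have /andP[] := hit_laplace_bound P 0 (mesh n) (ltW l0).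
  by rewrite subr_ge0 ltW// (scale_lt (diff_scale hX))// ltW// mesh_gt0.
have qa : X / d * q <= a.
  rewrite mulrAC ler_pdivrMr//; apply: le_trans s2; rewrite mulrC ler_wpM2r//.
  rewrite lerB// ler_wpM2r ?speed_mass_ge0// ler_wpM2l// ltW//.
have la : l * (a + sn) * speed_mass m (mesh n) * sn <= l * C * speed_mass m 1 * sn.
  have C0 : 0 <= a + sn.
    rewrite addr_ge0 ?(ltW sn0)//.
    exact: (resolvent_ge0 P l (fun y => bump_bound y (mesh_gt0 n))).
  rewrite ler_wpM2r ?(ltW sn0)// ler_pM ?mulr_ge0 ?speed_mass_ge0 ?(ltW l0)//.
    by rewrite ler_wpM2l// ltW.
  by apply: (speed_mass_le hX); rewrite invf_le1 ?ler1n ?ltr0n.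
by lra.
Unshelve. all: by end_near. Qed.

End approximate_identity.

(** * Convergence of the potentials at 0 to the Green function *)

Section green_limit.
Context (R : realType) (m : {measure set R -> \bar R}) (S : cumulative R R).
Context (P : R -> probability (path_space R) R) (p : R -> R -> R -> R).
Hypothesis hX : reflected_diffusion m S P.
Hypothesis hp : transition_density m P p.
Implicit Types (y z t l : R) (n : nat).
Local Notation leb := (@lebesgue_measure R).
Local Notation bmp n := (bump m (mesh R n)).
Local Notation potential := (potential m P).
Local Notation kappa := (kappa S P).

Let smm := diff_speed hX.

Let cb n : continuous (bmp n). Proof. exact: bump_continuous. Qed.

Let bb n y : 0 <= bmp n y <= (tent_mass m (mesh R n))^-1.
Proof. by apply: (bump_bound hX); exact: mesh_gt0. Qed.

Let mb n : measurable_fun setT (EFin \o bmp n).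
Proof. by apply/measurable_EFinP; apply: continuous_measurable_fun; exact: cb. Qed.

Let integral_bump n : (\int[m]_(z in `[0%R, +oo[) (bmp n z)%:E = 1)%E.
Proof.
have b0 (z : R) : (0 <= (bmp n z)%:E)%E by rewrite lee_fin; have /andP[] := bb n z.
have m0 : m [set 0 : R] = 0%E := speed_atom smm 0.
rewrite (@ge0_negligible_integral _ _ _ m _ [set 0 : R])//; last first.
  exact: measurable_funS (mb n).
have -> : `[0%R, +oo[%classic `\` [set 0 : R] = `]0, mesh R n] `|` `]mesh R n, +oo[.
  apply/seteqP; split=> z /=; rewrite !in_itv/= ?andbT.
    move=> [z0 /eqP zn0]; have zp : 0 < z by rewrite lt_neqAle eq_sym zn0.
    by case: (leP z (mesh R n)) => h; [left; rewrite zp|right].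
  case=> [/andP[z0 _]|zn]; split; rewrite ?ltW//.
  - by apply/eqP; rewrite gt_eqF.
  - exact: lt_trans (mesh_gt0 R n) zn.
  - by apply/eqP; rewrite gt_eqF// (lt_trans (mesh_gt0 R n) zn).
rewrite ge0_integral_setU//; last 2 first.
- exact: measurable_funS (mb n).
- apply/disj_setPS => z /=; rewrite !in_itv/= andbT => -[/andP[_ a] b].
  by move: (lt_le_trans b a); rewrite ltxx.
rewrite [X in (_ + X)%E]integral0_eq ?adde0; last first.
  move=> z /=; rewrite in_itv/= andbT => zn; rewrite bump_eq0 ?mesh_gt0//; exact: ltW.
rewrite -(bump_mass hX (mesh_gt0 R n)) /Rintegral fineK//.
have [it _] := tent_massP hX (mesh_gt0 R n).
apply: integrable_fin_num => //.
rewrite (_ : (fun z => (bmp n z)%:E) =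
  (fun z => (((tent_mass m (mesh R n))^-1)%:E * (tent (mesh R n) z)%:E)%E)).
  exact: integrableZl.
by apply/funext => z; rewrite -EFinM mulrC.
Qed.

Definition bump_mean n t : R := fine (\int[P 0]_w (bmp n (X t w))%:E)%E.

Let bump_meanE n t : (\int[P 0]_w (bmp n (X t w))%:E = (bump_mean n t)%:E)%E.
Proof.
rewrite /bump_mean fineK//; apply: (prob_integral_fin (P 0) _ (fun w => bb n (X t w))).
apply: measurableT_comp; last exact: measurable_X.
by apply: continuous_measurable_fun; exact: cb.
Qed.

Lemma bump_mean_bound n t : 0 <= bump_mean n t <= (tent_mass m (mesh R n))^-1.
Proof.
rewrite -2!lee_fin -bump_meanE.
apply: (prob_integral_bound (P 0) _ (fun w => bb n (X t w))).
apply: measurableT_comp; last exact: measurable_X.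
by apply: continuous_measurable_fun; exact: cb.
Qed.

(** [bump_mean n t] is an average of [p t 0] over [[0, mesh n]], as the bump has mass 1 for [m] and
    vanishes beyond. *)
Lemma bump_mean_density n t c1 c2 : 0 < t -> 0 <= c1 ->
  (forall z, 0 <= z -> z <= mesh R n -> c1 <= p t 0 z <= c2) ->
  c1 <= bump_mean n t <= c2.
Proof.
move=> t0 c10 c12; rewrite -2!lee_fin -bump_meanE.
have b0 (z : R) : (0 <= (bmp n z)%:E)%E by rewrite lee_fin; have /andP[] := bb n z.
rewrite (integral_density smm hp t0 (lexx 0) (mb n) b0).
have c20 : 0 <= c2.
  by have /andP[a b] := c12 _ (lexx 0) (ltW (mesh_gt0 R n)); rewrite (le_trans c10 (le_trans a b)).
have E (c : R) : 0 <= c -> (\int[m]_(z in `[0%R, +oo[) ((bmp n z)%:E * c%:E) = c%:E)%E.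
  move=> c0; rewrite ge0_integralZr//; last exact: measurable_funS (mb n).
  by rewrite integral_bump mul1e.
have mp : measurable_fun (`[0, +oo[%classic : set R) (fun z : R => (p t 0 z)%:E).
  apply: (eq_measurable_fun (fun z => (p t 0 (Num.max 0 z))%:E)).
    by move=> z; rewrite inE/= in_itv/= andbT => z0; rewrite max_r.
  apply/measurable_EFinP; exact: measurable_funS (measurable_density hp t0 (lexx 0)).
rewrite -{1}(E _ c10) -(E _ c20); apply/andP; split.
- apply: ge0_le_integral => //.
  + by move=> z _; rewrite mule_ge0.
  + by apply: emeasurable_funM => //; exact: measurable_funS (mb n).
  + by apply: emeasurable_funM => //; exact: measurable_funS (mb n).
  move=> z /=; rewrite in_itv/= andbT => z0.
  have [zn|zn] := leP z (mesh R n); last by rewrite (bump_eq0 _ (mesh_gt0 R n) (ltW zn)) !mul0e.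
  by rewrite lee_wpmul2l// lee_fin; have /andP[] := c12 _ z0 zn.
- apply: ge0_le_integral => //.
  + move=> z /=; rewrite in_itv/= andbT => z0.
    by rewrite mule_ge0// lee_fin (density_ge0 smm hp).
  + by apply: emeasurable_funM => //; exact: measurable_funS (mb n).
  + by apply: emeasurable_funM => //; exact: measurable_funS (mb n).
  move=> z /=; rewrite in_itv/= andbT => z0.
  have [zn|zn] := leP z (mesh R n); last by rewrite (bump_eq0 _ (mesh_gt0 R n) (ltW zn)) !mul0e.
  by rewrite lee_wpmul2l// lee_fin; have /andP[] := c12 _ z0 zn.
Qed.

Lemma bump_mean_cvg t : 0 < t -> bump_mean n t @[n --> \oo] --> p t 0 0.
Proof.
move=> t0; apply/cvgrPdist_le => e e0.
have : p t 0 (Num.max 0 z) @[z --> (0 : R)] --> p t 0 (Num.max 0 0).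
  exact: (density_max_continuous hp t0 (lexx 0)).
rewrite maxxx => /cvgrPdist_le /(_ _ e0) /nbhs_ballP[d /= d0 hd].
have p0 : 0 <= p t 0 0 by exact: (density_ge0 smm hp).
near=> n.
have nd : mesh R n < d by near: n; have /cvgr_lt := @mesh_cvg R; apply.
suff /andP[h1 h2] : Num.max 0 (p t 0 0 - e) <= bump_mean n t <= p t 0 0 + e.
  by move: h1; rewrite ge_max ler_norml => /andP[_ h1]; apply/andP; split; lra.
apply: bump_mean_density => //; first by rewrite le_max lexx.
move=> z z0 zn; have /hd : ball 0 d z.
  by rewrite /ball/= sub0r normrN ger0_norm// (le_lt_trans zn).
rewrite (max_r z0) ler_norml => /andP[h1 h2]; apply/andP; split; last by lra.
by rewrite ge_max (density_ge0 smm hp)//=; lra.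
Unshelve. all: by end_near. Qed.

(** Continuity on a compact rectangle. The times stay away from 0, where the density may blow up. *)
Lemma density_bounded (a b : R) : 0 < a -> a <= b ->
  exists C, forall t z, a <= t -> t <= b -> 0 <= z -> z <= 1 -> p t 0 z <= C.
Proof.
move=> a0 ab; pose f (u : R * R) := p u.1 0 (Num.max 0 u.2).
have cK : compact (`[a, b] `*` `[0, 1] : set (R * R)).
  by apply: compact_setX; exact: segment_compact.
have cf : {within `[a, b] `*` `[0, 1], continuous f}.
  apply: continuous_in_subspaceT => u; rewrite inE => -[/=]; rewrite in_itv/= => /andP[au _] _.
  have h := @density_continuous_max _ _ _ _ hp ((u.1, 0), u.2) (lt_le_trans a0 au).
  rewrite /f; have -> : (fun u : R * R => p u.1 0 (Num.max 0 u.2)) =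
    (fun z : R * R * R => p z.1.1 (Num.max 0%R z.1.2) (Num.max 0%R z.2)) \o
    (fun u : R * R => ((u.1, 0), u.2)).
    by apply/funext => v /=; rewrite maxxx.
  apply: continuous_comp; last exact: h.
  apply: cvg_pair_to; last exact: cvg_snd.
  by apply: cvg_pair_to; [exact: cvg_fst|exact: cvg_cst].
have ne : (`[a, b] `*` `[0, 1] : set (R * R)) !=set0.
  by exists (a, 0); split; rewrite /= in_itv/= lexx ?ab ?ler01.
have [c _ hc] := compact_EVT_max ne cK cf.
exists (f c) => t z ta tb z0 z1; have := hc (t, z).
rewrite /f/= (max_r z0); apply; rewrite inE; split => /=; rewrite in_itv/=; exact/andP.
Qed.

Let mexp l : measurable_fun setT (fun t : R => expR (- (l * t))).
Proof.
apply: continuous_measurable_fun => t; apply: continuous_comp; last exact: continuous_expR.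
by apply: cvgN; apply: cvgM; [exact: cvg_cst|exact: cvg_id].
Qed.

Lemma measurable_bump_mean0 n : measurable_fun setT (bump_mean n).
Proof. exact: (measurable_mean P (@cb n) (bb n) 0). Qed.

Lemma measurable_bump_mean l n : measurable_fun setT (fun t : R => (expR (- (l * t)) * bump_mean n t)%:E).
Proof.
apply/measurable_EFinP; apply: measurable_funM; first exact: mexp.
exact: measurable_bump_mean0.
Qed.

Let mean0 l n t : (0 <= (expR (- (l * t)) * bump_mean n t)%:E)%E.
Proof. by rewrite lee_fin mulr_ge0 ?expR_ge0//; have /andP[] := bump_mean_bound n t. Qed.

Lemma potential_laplace l n : 0 < l -> ((potential l n 0)%:E =
  \int[leb]_(t in `]0%R, +oo[) (expR (- (l * t)) * bump_mean n t)%:E)%E.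
Proof.
move=> l0; rewrite integral_itv_obnd_cbnd; last exact: measurable_funS (measurable_bump_mean l n).
exact: (resolvent_laplace P l0 (@cb n) (bb n) 0).
Qed.

Lemma green_ge0 l : (0 <= green p l 0 0)%E.
Proof.
apply: integral_ge0 => t /=; rewrite in_itv/= andbT => t0.
by rewrite lee_fin mulr_ge0 ?expR_ge0// (density_ge0 smm hp).
Qed.

(** The potentials at 0 are Laplace transforms of [bump_mean n], which tends to [p t 0 0] at each
    [t > 0]. Fatou's lemma needs no control near time 0, and [potential_upper] bounds the
    potentials. *)
Lemma green_upper l y : 0 < l -> 0 < y -> (green p l 0 0 <= (kappa l y)%:E)%E.
Proof.
move=> l0 y0; apply/lee_addgt0Pr => e e0; rewrite leNgt; apply/negP => lt_green.
have e2 : 0 < e / 2 by rewrite divr_gt0.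
have near2 := potential_upper hX hp l0 y0 e2.
suff : \forall n \near \oo, False by move=> /filter_ex[].
near=> n.
have h1 : (((kappa l y)%:E + e%:E)%E <
  \int[leb]_(t in `]0%R, +oo[) (expR (- (l * t)) * bump_mean n t)%:E)%E.
  near: n; apply: (@fatou_near _ _ _ leb `]0%R, +oo[
    (fun n t => (expR (- (l * t)) * bump_mean n t)%:E) _ _ _ _ _ _ lt_green) => //.
  - by move=> k; exact: measurable_funS (measurable_bump_mean l k).
  - move=> t /=; rewrite in_itv/= andbT => t0; apply: cvg_EFin; first exact: nearW.
    by apply: cvgM; [exact: cvg_cst|exact: bump_mean_cvg].
have /andP[h2 h3] : potential l n 0 <= potential l n (mesh R n) + S (mesh R n) <= kappa l y + e / 2.
  by near: n.
by move: h1; rewrite -potential_laplace// -EFinD lte_fin; lra.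
Unshelve. all: by end_near. Qed.

End green_limit.

Section green_value.
Context (R : realType) (m : {measure set R -> \bar R}) (S : cumulative R R).
Context (P : R -> probability (path_space R) R) (p : R -> R -> R -> R).
Hypothesis hX : reflected_diffusion m S P.
Hypothesis hp : transition_density m P p.
Implicit Types (y z t l : R) (n : nat).
Local Notation leb := (@lebesgue_measure R).
Local Notation potential := (potential m P).
Local Notation kappa := (kappa S P).
Local Notation bump_mean := (bump_mean m P).

Let smm := diff_speed hX.

(* Off [`[a, b]] the weight is dominated by discounts at rates [a^-1] and [l / 2]
   with coefficients that make both contributions small. *)
Let expR_cut l a b t : 0 < l -> 0 < a -> 0 < t -> ~ (a <= t <= b) ->
  expR (- (l * t)) <= expR 1 * expR (- (a^-1 * t)) + expR (- (l / 2 * b)) * expR (- (l / 2 * t)).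
Proof.
move=> l0 a0 t0 /negP; rewrite negb_and -2!ltNge => /orP[ta|bt].
  rewrite -expRD; apply: (@le_trans _ _ 1).
    by rewrite -expR0 ler_expR oppr_le0 mulr_ge0// ltW.
  apply: (@le_trans _ _ (expR (1 - a^-1 * t))); last by rewrite lerDl mulr_ge0 ?expR_ge0.
  rewrite -[X in X <= _]expR0 ler_expR subr_ge0.
  by rewrite mulrC ler_pdivrMr// mul1r ltW.
rewrite -[X in _ + X]expRD; apply: (@le_trans _ _ (expR (- (l / 2 * b) - l / 2 * t))).
  rewrite ler_expR; have : l * b <= l * t by rewrite ler_wpM2l// ltW.
  lra.
by rewrite lerDr mulr_ge0 ?expR_ge0.
Qed.

Let integral_cut l a b (g : R -> R) : 0 < l -> 0 < a ->
  measurable_fun setT g -> (forall t, 0 <= g t) ->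
  forall F, F = (fun (l : R) (t : R) => (expR (- (l * t)) * g t)%:E) ->
  (\int[leb]_(t in `]0%R, +oo[) F l t <= \int[leb]_(t in `[a, b]) F l t +
    ((expR 1)%R%:E * \int[leb]_(t in `]0%R, +oo[) F (a^-1)%R t +
     (expR (- (l / 2 * b)))%R%:E * \int[leb]_(t in `]0%R, +oo[) F (l / 2)%R t))%E.
Proof.
move=> l0 a0 mg g0 F FE.
have mF (l' : R) (D : set R) : measurable D -> measurable_fun D (F l').
  move=> mD; rewrite FE; apply/measurable_EFinP; apply: (@measurable_funS _ _ _ _ setT) => //.
  apply: measurable_funM => //; apply: continuous_measurable_fun => t.
  apply: continuous_comp; last exact: continuous_expR.
  by apply: cvgN; apply: cvgM; [exact: cvg_cst|exact: cvg_id].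
have F0 l' t : (0 <= F l' t)%E by rewrite FE lee_fin mulr_ge0 ?expR_ge0.
have -> : `[a, b]%classic = `]0, +oo[%classic `&` `[a, b] :> set R.
  apply/seteqP; split=> t /=; rewrite !in_itv/= ?andbT; last by case.
  by move=> h; split=> //; case/andP: h => h _; exact: lt_le_trans h.
rewrite integral_mkcondr.
have mFc (l' c : R) : measurable_fun (`]0, +oo[%classic : set R) (fun t : R => (c%:E * F l' t)%E).
  by apply: measurable_funeM; exact: mF.
have Fc0 (l' c : R) t : 0 <= c -> (0 <= c%:E * F l' t)%E by move=> c0; rewrite mule_ge0.
have mFr : measurable_fun (`]0, +oo[%classic : set R) (F l \_ `[a, b]).
  by apply/measurable_restrict => //; apply: mF; exact: measurableI.
have Fr0 t : (0 <= (F l \_ `[a, b]) t)%E by rewrite patchE; case: ifP.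
have e1 : 0 <= expR 1 :> R := expR_ge0 _.
have e2 : 0 <= expR (- (l / 2 * b)) := expR_ge0 _.
rewrite -(@ge0_integralZl_EFin _ _ _ leb _ _ (F a^-1))//; last exact: mF.
rewrite -(@ge0_integralZl_EFin _ _ _ leb _ _ (F (l / 2)))//; last exact: mF.
rewrite -[X in (_ + X)%E]ge0_integralD//; try exact: mFc; try (by move=> t _; exact: Fc0).
rewrite -ge0_integralD//; try (by move=> t _; rewrite adde_ge0// Fc0);
  try exact: (emeasurable_funD (mFc _ _) (mFc _ _)).
apply: ge0_le_integral => //.
- exact: mF.
- by apply: emeasurable_funD => //; apply: (emeasurable_funD (mFc _ _) (mFc _ _)).
move=> t /=; rewrite in_itv/= andbT => t0; rewrite patchE.
case: ifPn => [_|].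
  by rewrite leeDl// adde_ge0// Fc0.
rewrite notin_setE/= in_itv/= add0e => h.
rewrite FE -!EFinM -EFinD lee_fin !mulrA -mulrDl ler_wpM2r//.
exact: expR_cut.
Qed.

Let integral_cut_fin l a b (g : R -> R) (u v w : R) : 0 < l -> 0 < a ->
  measurable_fun setT g -> (forall t, 0 <= g t) ->
  forall F, F = (fun (l : R) (t : R) => (expR (- (l * t)) * g t)%:E) ->
  u%:E = (\int[leb]_(t in `]0%R, +oo[) F l t)%E ->
  v%:E = (\int[leb]_(t in `]0%R, +oo[) F (a^-1)%R t)%E ->
  w%:E = (\int[leb]_(t in `]0%R, +oo[) F (l / 2)%R t)%E ->
  (u%:E <= \int[leb]_(t in `[a, b]) F l t +
    (expR 1 * v + expR (- (l / 2 * b)) * w)%:E)%E.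
Proof.
move=> l0 a0 mg g0 F FE -> hv hw.
by rewrite EFinD !EFinM hv hw; exact: integral_cut mg g0 _ FE.
Qed.

(** Uniform integrability in time: what lies outside [[a, b]] is bounded by potentials at the rates
    [a^-1] and [l / 2], which [potential_upper] controls through [kappa] for large [n]. *)
Lemma potential_cut l a b n : 0 < l -> 0 < a ->
  ((potential l n 0)%:E <=
    \int[leb]_(t in `[a, b]) (expR (- (l * t)) * bump_mean n t)%:E +
    (expR 1 * potential a^-1 n 0 + expR (- (l / 2 * b)) * potential (l / 2) n 0)%R%:E)%E.
Proof.
move=> l0 a0.
have l20 : 0 < l / 2 by rewrite divr_gt0.
have ai0 : 0 < a^-1 by rewrite invr_gt0.
have g0 t : 0 <= bump_mean n t by have /andP[] := bump_mean_bound hX n t.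
exact: (integral_cut_fin b l0 a0 (measurable_bump_mean0 hX n) g0 erefl
  (potential_laplace hX n l0) (potential_laplace hX n ai0) (potential_laplace hX n l20)).
Qed.

(** The density is bounded for times in [[a, b]], so dominated convergence applies; the limit is a
    part of the integral that defines [green]. *)
Lemma bump_mean_cut l a b (G e : R) : 0 < l -> 0 < a -> a <= b -> 0 < e ->
  green p l 0 0 = G%:E ->
  \forall n \near \oo, (\int[leb]_(t in `[a, b]) (expR (- (l * t)) * bump_mean n t)%:E
    <= (G + e)%:E)%E.
Proof.
move=> l0 a0 ab e0 GE; have [C hC] := density_bounded hp a0 ab.
have pC t : a <= t -> t <= b -> 0 <= p t 0 0 <= C.
  move=> ta tb; rewrite hC// andbT (density_ge0 smm hp)//; exact: lt_le_trans ta.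
have mF n : measurable_fun `[a, b] (fun t => (expR (- (l * t)) * bump_mean n t)%:E).
  exact: measurable_funS (measurable_bump_mean hX l n).
have C0 : 0 <= C by have /andP[h1 h2] := pC a (lexx a) ab; exact: le_trans h2.
have m1 n : mesh R n <= 1 by rewrite invf_le1 ?ler1n ?ltr0n.
have dom n t : t \in `[a, b] -> (0 <= (expR (- (l * t)) * bump_mean n t)%:E <= C%:E)%E.
  rewrite in_itv/= => /andP[ta tb]; have t0 : 0 < t by exact: lt_le_trans ta.
  have /andP[h1 h2] : 0 <= bump_mean n t <= C.
    apply: (bump_mean_density hX hp) => // z z0 zn.
    by rewrite (density_ge0 smm hp)//= hC// (le_trans zn).
  rewrite !lee_fin mulr_ge0 ?expR_ge0//= (le_trans _ h2)// ler_piMl//.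
  by rewrite -expR0 ler_expR oppr_le0 mulr_ge0// ltW.
have cv : (\int[leb]_(t in `[a, b]) (expR (- (l * t)) * bump_mean n t)%:E @[n --> \oo] -->
    \int[leb]_(t in `[a, b]) (expR (- (l * t)) * p t 0 0)%:E)%E.
  apply: (@ge0_dominated_cvg _ _ _ leb `[a, b]
    (fun n t => (expR (- (l * t)) * bump_mean n t)%:E)
    (fun t => (expR (- (l * t)) * p t 0 0)%:E) (cst C%:E)) => //.
  - move=> t /=; rewrite in_itv/= => /andP[ta _]; apply: cvg_EFin; first exact: nearW.
    apply: cvgM; first exact: cvg_cst.
    by apply: (bump_mean_cvg hX hp); exact: lt_le_trans ta.
  - rewrite integral_cst//= lebesgue_measure_itv/= lte_fin.
    by case: ifP => _; rewrite ?mule0 ?ltry// -EFinB -EFinM ltry.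
set I := (\int[leb]_(t in `[a, b]) (expR (- (l * t)) * p t 0 0)%:E)%E in cv *.
have mp : measurable_fun (`]0, +oo[%classic : set R) (fun t : R => (expR (- (l * t)) * p t 0 0)%:E).
  apply: (emeasurable_fun_cvg (fun n t => (expR (- (l * t)) * bump_mean n t)%:E)).
    by move=> n; exact: measurable_funS (measurable_bump_mean hX l n).
  move=> t /=; rewrite in_itv/= andbT => t0; apply: cvg_EFin; first exact: nearW.
  by apply: cvgM; [exact: cvg_cst|exact: (bump_mean_cvg hX hp)].
have IG : (I <= G%:E)%E.
  rewrite -GE; apply: ge0_subset_integral => //.
  - by move=> t /=; rewrite in_itv/= andbT => t0; rewrite lee_fin mulr_ge0 ?expR_ge0 ?(density_ge0 smm hp).
  - by move=> t /=; rewrite !in_itv/= andbT => /andP[ta _]; exact: lt_le_trans ta.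
have I0 : (0 <= I)%E.
  apply: integral_ge0 => t /=; rewrite in_itv/= => /andP[ta tb].
  by rewrite lee_fin mulr_ge0 ?expR_ge0//; have /andP[] := pC _ ta tb.
have Ifin : I = (fine I)%:E.
  by rewrite fineK// ge0_fin_numE// (le_lt_trans IG)// ltry.
rewrite Ifin in cv IG; rewrite lee_fin in IG.
have /fine_cvgP[fin /cvgr_lt lt] := cv.
have Ie : fine I < G + e by rewrite (le_lt_trans IG)// ltrDl.
have lt' := lt _ Ie.
near=> n.
have h1 : (\int[leb]_(t in `[a, b]) (expR (- (l * t)) * bump_mean n t)%:E)%E \is a fin_num.
  by near: n.
rewrite -(fineK h1) lee_fin; apply/ltW; near: n; apply: lt'.
Unshelve. all: by end_near. Qed.

Let green_lower_arith (A B C D G d e : R) : d = e / 8 -> 0 < d ->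
  D - d <= A -> A <= G + d + (B + C) -> B <= 2 * d -> C <= d -> D <= G + e.
Proof. by move=> ->; lra. Qed.

Lemma green_lower l y (G : R) : 0 < l -> 0 < y -> green p l 0 0 = G%:E ->
  kappa l y * (1 - l * (kappa l 1 + 1) * speed_mass m y) <= G.
Proof.
move=> l0 y0 GE; apply/ler_addgt0Pr => e e0.
(* Five of the eight parts are spent: one on the lower bound of the potential, one on the times in
   [[r^-1, b]], two on short times and one on late times. *)
pose d := e / 8.
have d0 : 0 < d by rewrite divr_gt0.
have c0 : 0 < expR 1 :> R := expR_gt0 _.
have dc0 : 0 < d / expR 1 by rewrite divr_gt0.
have l20 : 0 < l / 2 by rewrite divr_gt0.
(* Short times: a rate [r] at which the Laplace transform from [y'] is at most 1/2 gives
   [kappa r y' <= 2 * S y'], hence at most [d / expR 1]. The cut is placed at [r^-1], whose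
   associated rate is [r]; dividing by [expR 1] offsets the coefficient in [potential_cut]. *)
have [y' y'0 y'd] : exists2 y', 0 < y' & S y' <= d / expR 1 / 2.
  have dc20 : 0 < d / expR 1 / 2 by rewrite divr_gt0.
  have [n _ /(_ n (leqnn n)) hn] := (@cvgrPdist_le _ _ _ _ _ _ _).1 (@scale_mesh_cvg _ _ _ _ hX) _ dc20.
  exists (mesh R n); first exact: mesh_gt0.
  by move: hn; rewrite /= sub0r normrN; apply: le_trans; exact: ler_norm.
have [r r0 hr] := hit_laplace_large hX y'0.
have k1 : kappa r y' <= d / expR 1.
  have := hr _ (lexx r) => h.
  rewrite /kappa ler_pdivrMr; last by lra.
  apply: (le_trans y'd); rewrite ler_wpM2l ?(ltW dc0)//; lra.
have K0 : 0 <= kappa (l / 2) 1.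
  rewrite divr_ge0// ?subr_ge0; first by apply/ltW; exact: (scale_gt0 hX).
  by apply: ltW; exact: (hit_laplace_lt1 hX).
(* Late times: with K the second factor, [b] is taken with l b / 2 >= K / d, and e^z >= z
   concludes. *)
have [b rb hb] : exists2 b, r^-1 <= b & expR (- (l / 2 * b)) * (kappa (l / 2) 1 + d) <= d.
  set K := kappa (l / 2) 1 + d.
  have Kd : 0 < K by rewrite ltr_wpDl.
  exists (Num.max r^-1 ((l / 2)^-1 * (K / d))); first by rewrite le_max lexx.
  set b := Num.max _ _.
  have h : K / d <= l / 2 * b by rewrite -ler_pdivrMl// le_max lexx orbT.
  rewrite expRN ler_pdivrMl ?expR_gt0// mulrC -ler_pdivrMl// mulrC.
  by apply: (le_trans h); apply: le_trans (expR_ge1Dx _); rewrite lerDr.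
have ri0 : 0 < r^-1 by rewrite invr_gt0.
have n1 := potential_lower hX hp l0 y0 ltr01 d0.
have n2 := bump_mean_cut l0 ri0 rb d0 GE.
have n3 := potential_upper hX hp r0 y'0 dc0.
have n4 := potential_upper hX hp l20 ltr01 d0.
suff : \forall n \near \oo, kappa l y * (1 - l * (kappa l 1 + 1) * speed_mass m y) <= G + e.
  by move=> /filter_ex[].
near=> n.
have h1 : kappa l y * (1 - l * (kappa l 1 + 1) * speed_mass m y) - d <= potential l n 0 by near: n.
have h2 : (\int[leb]_(t in `[r^-1%R, b]) (expR (- (l * t)) * bump_mean n t)%:E
    <= (G + d)%:E)%E by near: n.
have /andP[u1 u2] : potential r n 0 <= potential r n (mesh R n) + S (mesh R n)
  <= kappa r y' + d / expR 1 by near: n.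
have /andP[v1 v2] : potential (l / 2) n 0 <= potential (l / 2) n (mesh R n) + S (mesh R n)
  <= kappa (l / 2) 1 + d by near: n.
have := potential_cut b n l0 ri0; rewrite invrK => h3.
have : ((potential l n 0)%:E <= (G + d)%:E +
  (expR 1 * potential r n 0 + expR (- (l / 2 * b)) * potential (l / 2) n 0)%R%:E)%E.
  by apply: (le_trans h3); rewrite leeD2r.
rewrite -EFinD lee_fin => h4.
have h5 : expR 1 * potential r n 0 <= 2 * d.
  rewrite -ler_pdivlMl// (le_trans (le_trans u1 u2))//.
  have -> : (expR 1)^-1 * (2 * d) = d / expR 1 + d / expR 1 by ring.
  by rewrite lerD2r.
have h6 : expR (- (l / 2 * b)) * potential (l / 2) n 0 <= d.
  by apply: le_trans hb; rewrite ler_wpM2l ?expR_ge0// (le_trans v1).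
exact: (green_lower_arith erefl d0 h1 h4 h5 h6).
Unshelve. all: by end_near. Qed.

End green_value.

Section laplace_limit.
Context (R : realType) (m : {measure set R -> \bar R}) (S : cumulative R R).
Context (P : R -> probability (path_space R) R) (p : R -> R -> R -> R).
Hypothesis hX : reflected_diffusion m S P.
Hypothesis hp : transition_density m P p.
Implicit Types (y z t l : R) (n : nat).

Lemma speed_mass_near0 (e : R) : 0 < e -> exists2 y, 0 < y & speed_mass m y <= e.
Proof.
move=> e0; pose F n : set R := `]0, mesh R n]%classic.
have FI : \bigcap_n F n = set0.
  apply/seteqP; split=> // z Fz.
  have z0 : 0 < z by have := Fz 0 I; rewrite /F/= in_itv/= => /andP[].
  have /cvgr_lt /(_ _ z0) [n _ /(_ n (leqnn n)) /= zn] := @mesh_cvg R.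
  have := Fz n I; rewrite /F/= in_itv/= => /andP[_ nz].
  by move: (lt_le_trans zn nz); rewrite ltxx.
have /= := @nonincreasing_cvg_mu _ _ _ m F; rewrite FI measure0.
have Ffin n : (m (F n) < +oo)%E by exact: (speed_mass_fin hX).
move=> /(_ (Ffin 0) (fun n => measurable_itv _) measurable0) cv.
have /cv : nonincreasing_seq F.
  apply/nonincreasing_seqP => n; rewrite subsetEset => z; rewrite /F/= !in_itv/= => /andP[-> /=].
  move=> h; apply: (le_trans h); rewrite lef_pV2 ?posrE ?ltr0n// ler_nat.
  exact: leqW.
rewrite -(_ : 0%:E = 0%E)// => /fine_cvgP[_ /cvgrPdist_le /(_ _ e0) [n _ /(_ n (leqnn n)) hn]].
exists (mesh R n); first exact: mesh_gt0.
by move: hn; rewrite /= sub0r normrN; apply: le_trans; exact: ler_norm.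
Qed.

(** Finiteness comes from [green_upper], positivity from [green_lower] at a [y] so small that the
    error factor is at least 1/2. *)
Lemma green_fin l : 0 < l -> exists2 G, 0 < G & green p l 0 0 = G%:E.
Proof.
move=> l0.
have green0 : (0 <= green p l 0 0)%E := green_ge0 hX hp l.
have GE : green p l 0 0 = (fine (green p l 0 0))%:E.
  by rewrite fineK// ge0_fin_numE// (le_lt_trans (green_upper hX hp l0 ltr01))// ltry.
exists (fine (green p l 0 0)) => //.
set C := l * (kappa S P l 1 + 1).
have kpos y : 0 < y -> 0 < kappa S P l y.
  move=> y0; rewrite divr_gt0 ?(scale_gt0 hX)// subr_gt0.
  exact: (hit_laplace_lt1 hX).
have C0 : 0 < C by rewrite mulr_gt0// addr_gt0// kpos.
have [y y0 ym] : exists2 y, 0 < y & speed_mass m y <= C^-1 / 2.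
  by apply: speed_mass_near0; rewrite divr_gt0// invr_gt0.
apply: lt_le_trans (green_lower hX hp l0 y0 GE).
rewrite mulr_gt0 ?kpos// -/C subr_gt0 -ltr_pdivlMl// mulr1 (le_lt_trans ym)//.
by rewrite ltr_pdivrMr// ltr_pMr ?invr_gt0// ltr1n.
Qed.

Lemma laplace_start_limit l G : 0 < l -> 0 < G -> green p l 0 0 = G%:E ->
  (1 - hit_laplace P l 0 y) / S y @[y --> 0^'+] --> G^-1.
Proof.
move=> l0 G0 GE; apply/cvgrPdist_le => e e0.
set C := l * (kappa S P l 1 + 1).
have kpos y : 0 < y -> 0 < kappa S P l y.
  move=> y0; rewrite divr_gt0 ?(scale_gt0 hX)// subr_gt0.
  exact: (hit_laplace_lt1 hX).
have C0 : 0 < C by rewrite mulr_gt0// addr_gt0// kpos.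
(* For [y <= y1] this gives 1 - G / kappa <= e G, and division by G leaves [e]. *)
have [y1 y10 ym] : exists2 y, 0 < y & speed_mass m y <= C^-1 * (e * G).
  by apply: speed_mass_near0; rewrite mulr_gt0 ?invr_gt0// mulr_gt0.
near=> y.
have y0 : 0 < y by near: y; exact: nbhs_right_gt.
have yy1 : y <= y1 by near: y; exact: nbhs_right_le.
have k0 := kpos _ y0.
have kE : (1 - hit_laplace P l 0 y) / S y = (kappa S P l y)^-1 by rewrite invf_div.
rewrite kE.
have u : G <= kappa S P l y by have := green_upper hX hp l0 y0; rewrite GE lee_fin.
have lo := green_lower hX hp l0 y0 GE; rewrite -/C in lo.
have ki : (kappa S P l y)^-1 <= G^-1 by rewrite lef_pV2.
rewrite ger0_norm ?subr_ge0//.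
have Cm : C * speed_mass m y <= e * G.
  by rewrite -ler_pdivlMl// (le_trans _ ym)// (speed_mass_le hX).
have q : 1 - C * speed_mass m y <= (kappa S P l y)^-1 * G by rewrite ler_pdivlMl.
have : G^-1 - (kappa S P l y)^-1 = (1 - (kappa S P l y)^-1 * G) / G.
  by rewrite mulrBl mul1r mulfK// gt_eqF.
move=> ->; rewrite ler_pdivrMr//.
by apply: (le_trans _ Cm); lra.
Unshelve. all: by end_near. Qed.

End laplace_limit.

(** * Tails of the Lévy measure *)

Section levy_exponent.
Context (R : realType) (m : {measure set R -> \bar R}) (S : cumulative R R).
Context (P : R -> probability (path_space R) R) (p : R -> R -> R -> R).
Context (L : R -> path_space R -> R) (nu : {measure set R -> \bar R}).
Hypothesis hX : reflected_diffusion m S P.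
Hypothesis hp : transition_density m P p.
Hypothesis hnu : levy_measure P p L nu.
Implicit Types (y z t l v : R) (n k : nat) (g h : R -> R).

(** Compares the two expressions for the Laplace transform of the inverse local time at level 1. An
    infinite exponent is impossible, since it would make a positive exponential vanish. *)
Lemma exponent_green l : 0 < l ->
  (\int[nu]_(v in `]0%R, +oo[) (1 - expR (- (l * v)))%:E = (fine (green p l 0 0))^-1%:E)%E.
Proof.
move=> l0; have := levy_exponent hnu ler01 l0.
rewrite (levy_green hnu ler01 l0) mul1r mul1e.
set J := (\int[nu]_(v in _) _)%E.
have J0 : (0 <= J)%E.
  apply: integral_ge0 => v /=; rewrite in_itv/= andbT => v0.
  by rewrite lee_fin subr_ge0 -expR0 ler_expR oppr_le0 mulr_ge0// ltW.
move: J0; case: J => [r||]//=; last by move=> _ [] /eqP; rewrite gt_eqF// expR_gt0.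
by move=> _ [] /expR_inj/oppr_inj ->.
Qed.

Definition start_mean g y : R := fine (\int[P y]_w (g (fine (hit 0 w)))%:E)%E.

(** Test functions for the convergence of the measures P_y(H_0 in dv) / S(y) to nu. Finiteness of
    the integral is included so that differences can be taken. *)
Definition levy_limit g := [/\ measurable_fun setT g, forall v, 0 <= v -> 0 <= g v <= 1 &
  exists2 q : R, (\int[nu]_(v in `]0%R, +oo[) (g v)%:E = q%:E)%E &
    start_mean g y / S y @[y --> 0^'+] --> q].

Lemma fine_hit_ge0 w : (0 <= fine (hit (0 : R) w))%R.
Proof. by apply: fine_ge0; exact: hit_ge0. Qed.

Lemma start_meanE g y : measurable_fun setT g -> (forall v, 0 <= v -> 0 <= g v <= 1) ->
  (\int[P y]_w (g (fine (hit 0 w)))%:E = (start_mean g y)%:E)%E /\ 0 <= start_mean g y <= 1.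
Proof.
move=> mg g01.
have mgh : measurable_fun setT (fun w : path_space R => g (fine (hit 0 w))).
  by apply: measurableT_comp => //; exact: measurable_fine_hit.
have gh w : 0 <= g (fine (hit (0 : R) w)) <= 1 by exact: (g01 _ (fine_hit_ge0 w)).
have E : (\int[P y]_w (g (fine (hit 0 w)))%:E = (start_mean g y)%:E)%E.
  by rewrite fineK//; exact: prob_integral_fin mgh gh.
by split=> //; rewrite -2!lee_fin -E; exact: prob_integral_bound mgh gh.
Qed.

Lemma levy_limit_expR l : 0 < l -> levy_limit (fun v => 1 - expR (- (l * v))).
Proof.
move=> l0; have [G G0 GE] := green_fin hX hp l0.
have mexp : measurable_fun setT (fun v : R => 1 - expR (- (l * v))).
  apply: continuous_measurable_fun => t; apply: cvgB; first exact: cvg_cst.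
  apply: (@continuous_comp _ _ _ (fun v : R => - (l * v)) expR); last exact: continuous_expR.
  by apply: cvgN; apply: cvgM; [exact: cvg_cst|exact: cvg_id].
split => //.
  move=> v v0; rewrite subr_ge0 gerBl expR_ge0 andbT -expR0 ler_expR oppr_le0 mulr_ge0//.
  exact: ltW.
exists G^-1; first by rewrite exponent_green// GE.
suff -> : (fun y => start_mean (fun v => 1 - expR (- (l * v))) y / S y) =
    (fun y => (1 - hit_laplace P l 0 y) / S y).
  exact: (laplace_start_limit hX hp l0 G0 GE).
apply/funext => y; congr (_ / _); rewrite /start_mean.
rewrite (prob_integral_complement (P y) (measurable_expR_hit l 0)
  (fun w => expR_hit_bound 0 w (ltW l0))).
by rewrite (hit_laplaceE P 0 y (ltW l0)).
Qed.

Lemma levy_limitB g h : levy_limit g -> levy_limit h ->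
  (forall v, 0 <= v -> h v <= g v) -> levy_limit (fun v => g v - h v).
Proof.
move=> [mg g01 [q gq gl]] [mh h01 [r hr hl]] hg.
have md : measurable_fun setT (fun v => g v - h v) by exact: measurable_funB.
have d01 v : 0 <= v -> 0 <= g v - h v <= 1.
  by move=> v0; have /andP[? ?] := g01 _ v0; have /andP[? ?] := h01 _ v0; have := hg _ v0; lra.
split=> //; exists (q - r).
  have : (q%:E = \int[nu]_(v in `]0%R, +oo[) (g v - h v)%:E + r%:E)%E.
    rewrite -gq -hr -ge0_integralD//.
    - by apply: eq_integral => v _; rewrite -EFinD subrK.
    - move=> v /=; rewrite in_itv/= andbT => v0; rewrite lee_fin.
      by have /andP[] := d01 _ (ltW v0).
    - by apply/measurable_EFinP; exact: measurable_funS md.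
    - move=> v /=; rewrite in_itv/= andbT => v0; rewrite lee_fin.
      by have /andP[] := h01 _ (ltW v0).
    - by apply/measurable_EFinP; exact: measurable_funS mh.
  case: (\int[nu]_(v in _) _)%E => [s||]//= [] ->.
  by rewrite addrK.
have -> : (fun y => start_mean (fun v => g v - h v) y / S y) =
    (fun y => start_mean g y / S y - start_mean h y / S y).
  apply/funext => y; rewrite -mulrBl; congr (_ / _).
  have [Eg _] := start_meanE y mg g01; have [Eh _] := start_meanE y mh h01.
  have [Ed _] := start_meanE y md d01.
  apply/eqP; rewrite eq_sym subr_eq eq_sym -(inj_eq (@EFin_inj R)) EFinD -Eg -Eh -Ed.
  rewrite -ge0_integralD//.
  - by apply/eqP; apply: eq_integral => w _; rewrite -EFinD subrK.
  - by move=> w _; rewrite lee_fin; have /andP[] := d01 _ (fine_hit_ge0 w).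
  - apply/measurable_EFinP; apply: (@measurableT_comp _ _ _ _ _ _ (fun v => g v - h v)) => //.
    exact: measurable_fine_hit.
  - by move=> w _; rewrite lee_fin; have /andP[] := h01 _ (fine_hit_ge0 w).
  - by apply/measurable_EFinP; apply: measurableT_comp => //; exact: measurable_fine_hit.
exact: cvgB.
Qed.

(** With w = 1 - e^(- a v), subtracting w^(k+1) e^(- (b + a) v) from w^(k+1) e^(- b v) gives w^(k+2)
    e^(- b v). The exponential factor is carried along so that the induction uses differences only,
    as nothing is known of products of test functions. *)
Lemma levy_limit_pow k (a b : R) : 0 < a -> 0 <= b ->
  levy_limit (fun v => (1 - expR (- (a * v))) ^+ k.+1 * expR (- (b * v))).
Proof.
move=> a0; elim: k b => [|k IH] b b0.
  have [->|bn0] := eqVneq b 0.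
    have := levy_limit_expR a0; congr levy_limit; apply/funext => v.
    by rewrite mul0r oppr0 expR0 mulr1 expr1.
  have bp : 0 < b by rewrite lt_neqAle eq_sym bn0.
  have ab0 : 0 < a + b by rewrite addr_gt0.
  have := levy_limitB (levy_limit_expR ab0) (levy_limit_expR bp).
  have -> : (fun v : R => 1 - expR (- ((a + b) * v)) - (1 - expR (- (b * v)))) =
     (fun v => (1 - expR (- (a * v))) ^+ 1 * expR (- (b * v))).
    by apply/funext => v; rewrite expr1 mulrBl mul1r -expRD -opprD -mulrDl; ring.
  apply=> v v0; rewrite lerB// ler_expR lerN2 ler_wpM2r// lerDr; exact: ltW.
have := levy_limitB (IH b b0) (IH (b + a) (addr_ge0 b0 (ltW a0))).
have -> : (fun v : R => (1 - expR (- (a * v))) ^+ k.+1 * expR (- (b * v)) -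
    (1 - expR (- (a * v))) ^+ k.+1 * expR (- ((b + a) * v))) =
   (fun v => (1 - expR (- (a * v))) ^+ k.+2 * expR (- (b * v))).
  by apply/funext => v; rewrite mulrDl opprD expRD [in RHS]exprS; ring.
apply=> v v0; rewrite ler_wpM2l ?ler_expR ?lerN2 ?ler_wpM2r// ?lerDl ?(ltW a0)//.
by rewrite exprn_ge0// subr_ge0 -expR0 ler_expR oppr_le0 mulr_ge0// ltW.
Qed.

End levy_exponent.

(** * Cut-off functions built from exponentials *)

Section cutoff.
Context (R : realType).
Implicit Types (a b c v x e : R) (n k : nat).

Lemma bernoulli_ge x k : 0 <= x -> x <= 1 -> 1 - k%:R * x <= (1 - x) ^+ k.
Proof.
move=> x0 x1; elim: k => [|k IH]; first by rewrite mul0r subr0 expr0.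
rewrite exprS; apply: (@le_trans _ _ ((1 - x) * (1 - k%:R * x))).
  rewrite -natr1; have : 0 <= k%:R * x * x by rewrite !mulr_ge0.
  by lra.
by rewrite ler_wpM2l// subr_ge0.
Qed.

Lemma bernoulli_le x k : 0 <= x -> x <= 1 -> (1 - x) ^+ k * (1 + k%:R * x) <= 1.
Proof.
move=> x0 x1; elim: k => [|k IH]; first by rewrite mul0r addr0 mulr1 expr0.
apply: le_trans IH; rewrite exprSr -mulrA ler_wpM2l ?exprn_ge0 ?subr_ge0//.
rewrite -natr1; have : 0 <= k%:R * x * x by rewrite !mulr_ge0.
have : 0 <= x * x by rewrite mulr_ge0.
by lra.
Qed.

Let expR_mul_small (d e : R) : 0 < d -> 0 < e ->
  exists n : nat, (0 < n)%N /\ n%:R * expR (- (d * n%:R)) <= e.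
Proof.
(* Since e^z >= (z / 2)^2, it is enough that d^2 e n / 4 >= 1. *)
move=> d0 e0; set c := 4 / (d ^+ 2 * e).
have c0 : 0 <= c by rewrite divr_ge0// mulr_ge0 ?ltW// exprn_gt0.
exists (Num.truncn c).+1; split=> //.
set n := (Num.truncn c).+1.
have cn : c < n%:R by exact: truncnS_gt.
have n0 : 0 < n%:R :> R by rewrite ltr0n.
rewrite expRN ler_pdivrMr ?expR_gt0//.
have h : (d * n%:R / 2) ^+ 2 <= expR (d * n%:R).
  have -> : expR (d * n%:R) = expR (d * n%:R / 2) ^+ 2 by rewrite expr2 -expRD -splitr.
  have z0 : 0 <= d * n%:R / 2 by rewrite divr_ge0// mulr_ge0// ltW.
  rewrite ler_pXn2r ?nnegrE ?expR_ge0//.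
  by rewrite (le_trans _ (expR_ge1Dx _))// lerDr.
apply: (@le_trans _ _ (e * (d * n%:R / 2) ^+ 2)); last by rewrite ler_pM2l.
have -> : e * (d * n%:R / 2) ^+ 2 = (d ^+ 2 * e * n%:R / 4) * n%:R by field.
rewrite ler_pMl// ler_pdivlMr// mul1r -ler_pdivrMl; last by rewrite mulr_gt0// exprn_gt0.
by rewrite mulrC ltW.
Qed.

(* With [u = expR (- n v)], the power [(1 - u) ^+ N] for [N ~ expR (n c)]
   switches from 0 to 1 around [v = c]. *)
Lemma expR_cutoff a b e : 0 <= a -> a < b -> 0 < e -> exists n k,
  [/\ (0 < n)%N, forall v, b <= v -> 1 - e <= (1 - expR (- (n%:R * v))) ^+ k.+1 &
    forall v, 0 <= v -> v <= a ->
      (1 - expR (- (n%:R * v))) ^+ k.+1 <= e * (1 - expR (- (1 * v)))].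
Proof.
move=> a0 ab e0; set c := (a + b) / 2.
have ac : 0 < c - a by rewrite /c; lra.
have bc : 0 < b - c by rewrite /c; lra.
have bca : b - c = c - a by rewrite /c; lra.
(* This [n] has n e^(- n (c - a)) <= e / 2. With M the integer part of e^(n c), the product (M + 1)
   u is at most 2 e^(- n (c - a)) at [b] and at least e^(n (c - a)) at [a]. *)
have [n [n0 hn]] := expR_mul_small ac (divr_gt0 e0 (ltr0n R 2)).
set M := Num.truncn (expR (n%:R * c)).
have n0' : 0 < n%:R :> R by rewrite ltr0n.
have n1 : 1 <= n%:R :> R by rewrite ler1n.
have c0 : 0 <= c by rewrite /c; lra.
have E1 : 1 <= expR (n%:R * c) by rewrite -expR0 ler_expR mulr_ge0// ltW.
have /andP[Mle Mgt] : M%:R <= expR (n%:R * c) < M.+1%:R.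
  by apply: truncn_itv; exact: expR_ge0.
have expE d : expR (n%:R * c) * expR (- (n%:R * d)) = expR (- ((d - c) * n%:R)).
  by rewrite -expRD; congr expR; ring.
have u01 v : 0 <= v -> 0 <= expR (- (n%:R * v)) <= 1.
  by move=> v0; rewrite expR_ge0/= -expR0 ler_expR oppr_le0 mulr_ge0.
exists n, M; split=> // v.
  move=> bv; have v0 : 0 <= v by rewrite (le_trans _ bv)// (le_trans a0)// ltW.
  have /andP[u0 u1] := u01 _ v0.
  apply: le_trans (bernoulli_ge _ u0 u1); rewrite lerB//.
  apply: (@le_trans _ _ (2 * expR (n%:R * c) * expR (- (n%:R * b)))).
    apply: ler_pM => //; first by rewrite -natr1; lra.
    by rewrite ler_expR lerN2 ler_pM2l.
  rewrite -mulrA expE bca -ler_pdivlMl// [2^-1 * _]mulrC; apply: le_trans hn.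
  by rewrite ler_peMl ?expR_ge0.
move=> v0 va; have /andP[u0 u1] := u01 _ v0.
(* One factor is set aside and bounded by Bernoulli's inequality. The error is then relative to 1 -
   e^(- v), which nu integrates even if its mass near 0 is infinite; the other [M] factors absorb
   [n]. *)
rewrite exprSr; have h1 : 1 - expR (- (n%:R * v)) <= n%:R * (1 - expR (- (1 * v))).
  have x1 : expR (- v) <= 1 by rewrite -expR0 ler_expR oppr_le0.
  have := @bernoulli_ge (1 - expR (- v)) n; rewrite subKr -expRM_natl mulrN mul1r.
  move=> /(_ _ _); rewrite subr_ge0 gerBl expR_ge0 => /(_ x1 isT).
  by lra.
have /andP[t0 t1] := u01 _ a0.
have h2 : (1 - expR (- (n%:R * v))) ^+ M <= (1 - expR (- (n%:R * a))) ^+ M.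
  rewrite lerXn2r ?nnegrE ?subr_ge0// lerB// ler_expR lerN2 ler_pM2l//.
have h3 : (1 - expR (- (n%:R * a))) ^+ M * n%:R <= e.
  have := bernoulli_le M t0 t1.
  set q := _ ^+ M; set t := expR (- (n%:R * a)) => h.
  have q0 : 0 <= q by rewrite exprn_ge0// subr_ge0.
  have q1 : q * (M.+1%:R * t) <= 1.
    by apply: le_trans h; rewrite ler_wpM2l// -natr1 mulrDl mul1r addrC lerD2r.
  have q2 : q * (expR (n%:R * c) * t) <= 1.
    by apply: le_trans q1; rewrite ler_wpM2l// ler_wpM2r// ltW.
  rewrite expE in q2.
  have -> : q * n%:R = (q * expR (- ((a - c) * n%:R))) * (n%:R * expR (- ((c - a) * n%:R))).
    rewrite mulrACA [expR _ * expR _](_ : _ = 1) ?mulr1//.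
    by rewrite -expRD -[RHS]expR0; congr expR; ring.
  apply: (@le_trans _ _ (1 * (e / 2))); last by lra.
  by apply: ler_pM => //; rewrite mulr_ge0 ?expR_ge0// ltW.
have w0 : 0 <= 1 - expR (- (1 * v)) by rewrite mul1r subr_ge0 -expR0 ler_expR oppr_le0.
apply: (@le_trans _ _ ((1 - expR (- (n%:R * a))) ^+ M * (n%:R * (1 - expR (- (1 * v)))))).
  by apply: ler_pM => //; rewrite ?exprn_ge0 ?subr_ge0.
by rewrite mulrA ler_wpM2r.
Qed.

End cutoff.

Lemma integral_le_comb d (T : measurableType d) (R : realType)
    (mu : {measure set T -> \bar R}) (D : set T) (f g h : T -> R) (a b : R) :
  measurable D -> measurable_fun D f -> measurable_fun D g -> measurable_fun D h ->
  0 <= a -> 0 <= b ->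
  (forall x, D x -> [/\ 0 <= f x, 0 <= g x, 0 <= h x & f x <= a * g x + b * h x]) ->
  (\int[mu]_(x in D) (f x)%:E <= a%:E * \int[mu]_(x in D) (g x)%:E +
    b%:E * \int[mu]_(x in D) (h x)%:E)%E.
Proof.
move=> mD mf mg mh a0 b0 H.
have mE (u : T -> R) : measurable_fun D u -> measurable_fun D (fun x => (u x)%:E).
  by move=> mu'; exact/measurable_EFinP.
have mg' := mE _ mg; have mh' := mE _ mh; have mf' := mE _ mf.
have g0 x : D x -> (0 <= (g x)%:E)%E by move=> /H[_ + _ _]; rewrite lee_fin.
have h0 x : D x -> (0 <= (h x)%:E)%E by move=> /H[_ _ + _]; rewrite lee_fin.
have mag : measurable_fun D (fun x => (a%:E * (g x)%:E)%E) by exact: measurable_funeM.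
have mbh : measurable_fun D (fun x => (b%:E * (h x)%:E)%E) by exact: measurable_funeM.
rewrite -ge0_integralZl_EFin// -ge0_integralZl_EFin// -ge0_integralD//; last 2 first.
- by move=> x Dx; rewrite mule_ge0// g0.
- by move=> x Dx; rewrite mule_ge0// h0.
apply: ge0_le_integral => //.
- by move=> x /H[+ _ _ _]; rewrite lee_fin.
- exact: emeasurable_funD.
- by move=> x /H[_ _ _ +]; rewrite -!EFinM -EFinD lee_fin.
Qed.

Section levy_tail.
Context (R : realType) (m : {measure set R -> \bar R}) (S : cumulative R R).
Context (P : R -> probability (path_space R) R) (p : R -> R -> R -> R).
Context (L : R -> path_space R -> R) (nu : {measure set R -> \bar R}).
Hypothesis hX : reflected_diffusion m S P.
Hypothesis hp : transition_density m P p.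
Hypothesis hnu : levy_measure P p L nu.
Implicit Types (y z t v a b e : R) (n k : nat).

(** Errors are measured against this function, a [levy_limit] and therefore integrable; the form
    [1 * v] matches [levy_limit_expR] at rate 1. *)
Let ramp (v : R) : R := 1 - expR (- (1 * v)).

Let cut n k (v : R) : R := (1 - expR (- (n%:R * v))) ^+ k.+1.

Let tail (t v : R) : R := \1_(`]t, +oo[%classic : set R) v.

Let tailE t v : tail t v = (t < v)%R%:R.
Proof. by rewrite /tail indicE mem_setE/= in_itv/= andbT. Qed.

Let mtail t : measurable_fun setT (tail t).
Proof. exact: measurable_indic. Qed.

Let tail01 t v : 0 <= v -> 0 <= tail t v <= 1.
Proof. by move=> _; rewrite tailE; case: (t < v)%R; rewrite ?lexx ?ler01. Qed.

Definition levy_tail t : R := fine (nu `]t, +oo[%classic).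

Let ramp_limit : levy_limit S P nu ramp.
Proof. exact: (levy_limit_expR hX hp hnu ltr01). Qed.

Let cut_limit n k : (0 < n)%N -> levy_limit S P nu (cut n k).
Proof.
move=> n0; have n0' : 0 < n%:R :> R by rewrite ltr0n.
have := levy_limit_pow hX hp hnu k n0' (lexx 0); congr levy_limit.
by apply/funext => v; rewrite mul0r oppr0 expR0 mulr1.
Qed.

Let start_mean_tail t y : 0 <= t -> 0 <= y -> start_mean P (tail t) y = hit_tail P t y.
Proof.
move=> t0 y0; rewrite /start_mean -[RHS]/(fine (hit_tail P t y)%:E) hit_tail_indic; congr fine.
have mfin : measurable [set w : path_space R | (hit 0 w < +oo)%E] by exact: measurable_hit_lt.
apply: (prob1_eq_integral mfin (diff_recurrent hX y0 (lexx 0))).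
- apply/measurable_EFinP; apply: measurableT_comp => //; exact: measurable_fine_hit.
- by apply/measurable_EFinP; apply: measurable_indic; exact: measurable_hit_gt.
- by move=> w; rewrite lee_fin; have /andP[] := tail01 t (fine_hit_ge0 w).
- by move=> w; rewrite lee_fin.
- move=> w /= wfin; rewrite tailE indicE.
  have E : hit (0 : R) w = (fine (hit (0 : R) w))%:E by rewrite fineK// ge0_fin_numE// hit_ge0.
  have [h|h] := ltP t (fine (hit 0 w)); first by rewrite mem_set//= E lte_fin.
  by rewrite memNset//= E lte_fin; apply/negP; rewrite -leNgt.
Qed.

Let nu_tail t : 0 <= t -> (\int[nu]_(v in `]0%R, +oo[) (tail t v)%:E = nu `]t, +oo[%classic)%E.
Proof.
move=> t0; rewrite integral_indic//; congr (nu _).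
apply/seteqP; split=> v /=; rewrite !in_itv/= !andbT; first by case.
by move=> tv; split=> //; exact: le_lt_trans tv.
Qed.

(** Markov's inequality: beyond [t] the integrable [ramp] is at least 1 - e^(- t). *)
Lemma levy_tailE t : 0 < t -> nu `]t, +oo[%classic = (levy_tail t)%:E.
Proof.
move=> t0; rewrite /levy_tail fineK// ge0_fin_numE//.
have [mr r01 [q rq _]] := ramp_limit.
have et : 0 < 1 - expR (- t) by rewrite subr_gt0 -expR0 ltr_expR oppr_lt0.
have := @integral_le_comb _ _ _ nu `]0%R, +oo[ (tail t) ramp ramp (1 - expR (- t))^-1 0.
rewrite (nu_tail (ltW t0)) rq mul0e adde0 => /(_ _ _ _ _ _ _ _)/le_lt_trans; apply => //.
- exact: measurable_funS (mtail t).
- exact: measurable_funS mr.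
- exact: measurable_funS mr.
- by rewrite invr_ge0 ltW.
- move=> v /=; rewrite in_itv/= andbT => v0.
  have /andP[r0 _] := r01 _ (ltW v0); split=> //.
  rewrite mul0r addr0 tailE; case: ltP => [tv|_]; last by rewrite mulr_ge0// invr_ge0 ltW.
  by rewrite ler_pdivlMl// mulr1 /ramp mul1r lerB// ler_expR lerN2 ltW.
- by rewrite -EFinM ltry.
Qed.

Let start_mean_comb (f g h : R -> R) a b y :
  measurable_fun setT f -> measurable_fun setT g -> measurable_fun setT h ->
  (forall v, 0 <= v -> 0 <= f v <= 1) -> (forall v, 0 <= v -> 0 <= g v <= 1) ->
  (forall v, 0 <= v -> 0 <= h v <= 1) -> 0 <= a -> 0 <= b ->
  (forall v, 0 <= v -> f v <= a * g v + b * h v) ->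
  start_mean P f y <= a * start_mean P g y + b * start_mean P h y.
Proof.
move=> mf mg mh f01 g01 h01 a0 b0 H.
have [Ef _] := start_meanE P y mf f01; have [Eg _] := start_meanE P y mg g01.
have [Eh _] := start_meanE P y mh h01.
rewrite -lee_fin EFinD 2!EFinM -Ef -Eg -Eh; apply: integral_le_comb => //;
  try by apply: measurableT_comp => //; exact: measurable_fine_hit.
move=> w _; have w0 := fine_hit_ge0 w.
have /andP[? _] := f01 _ w0; have /andP[? _] := g01 _ w0; have /andP[? _] := h01 _ w0.
by split=> //; exact: H.
Qed.

(** Holds at every [y] because the tail divided by [S] is at most its value at any [z < y]. As [z]
    tends to 0 the latter is compared with a cut-off that lies, up to errors, between the indicators
    of []b, +oo[] and []a, +oo[]. *)
Lemma hit_tail_le_levy_tail a b y : 0 < a -> a < b -> 0 < y ->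
  hit_tail P b y <= S y * levy_tail a.
Proof.
move=> a0 ab y0; have [mr r01 [q rq _]] := ramp_limit.
have Sy := scale_gt0 hX y0.
rewrite -ler_pdivrMl//; apply/ler_addgt0Pr => e0 e00.
have q0 : 0 <= q.
  rewrite -lee_fin -rq; apply: integral_ge0 => v /=; rewrite in_itv/= andbT => v0.
  by rewrite lee_fin; have /andP[] := r01 _ (ltW v0).
set A := (S y)^-1 * hit_tail P b y.
have A0 : 0 <= A by rewrite mulr_ge0 ?hit_tail_ge0// invr_ge0 ltW.
(* The denominator secures both [e < 1] and [e * (q + A) <= e0]: [q] weighs the error of the cut-off
   below [a], and [A] the loss from the factor [1 - e]. *)
pose e := e0 / (q + A + 2 + e0).
have qA : 0 < q + A + 2 + e0 by lra.
have e_0 : 0 < e by rewrite divr_gt0.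
have [n [k [n0 hb ha]]] := expR_cutoff (ltW a0) ab e_0.
have [mc c01 [r cr cl]] := cut_limit k n0.
have rle : r <= levy_tail a + e * q.
  rewrite -lee_fin EFinD EFinM -cr -rq -levy_tailE// -(nu_tail (ltW a0)) -[X in (X + _)%E]mul1e.
  apply: integral_le_comb => //.
  - exact: measurable_funS mc.
  - exact: measurable_funS (mtail a).
  - exact: measurable_funS mr.
  - exact: ltW.
  move=> v /=; rewrite in_itv/= andbT => /ltW v0.
  have /andP[? c1] := c01 _ v0; have /andP[? _] := tail01 a v0; have /andP[? _] := r01 _ v0.
  split=> //; rewrite mul1r tailE; case: ltP => [_|va]; last by rewrite add0r; exact: ha.
  by rewrite (le_trans c1)// lerDl mulr_ge0// ltW.
have Ale : A * (1 - e) <= r.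
  apply: (@cvgr_to_ge _ _ _ _ _ _ _ cl).
  near=> z.
  have z0 : 0 < z by near: z; exact: nbhs_right_gt.
  have zy : z < y by near: z; exact: nbhs_right_lt.
  have Sz := scale_gt0 hX z0.
  (* Beyond [b] the cut-off is at least [1 - e]; the defect is charged to the tail itself and moved
     to the left side later. *)
  have h1 : hit_tail P b z <= 1 * start_mean P (cut n k) z + e * hit_tail P b z.
    rewrite -(start_mean_tail (ltW (lt_trans a0 ab)) (ltW z0)).
    apply: (start_mean_comb z (mtail b) mc (mtail b) (tail01 b) c01 (tail01 b) ler01 (ltW e_0)).
    move=> v v0; rewrite mul1r tailE; case: ltP => [bv|_].
      by have : 1 - e <= cut n k v := hb _ (ltW bv); rewrite mulr1 lerBlDr.
    by rewrite mulr0 addr0; have /andP[] := c01 _ v0.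
  have h2 := hit_tail_scale hX b z0 zy.
  have h3 : A <= hit_tail P b z / S z.
    by rewrite ler_pdivlMr// /A mulrC mulrA.
  have e1 : e < 1.
    by rewrite /e ltr_pdivrMr// mul1r; lra.
  rewrite ler_pdivlMr//.
  apply: (@le_trans _ _ (hit_tail P b z * (1 - e))); last by lra.
  rewrite mulrAC ler_wpM2r ?subr_ge0 ?(ltW e1)//.
  by rewrite -ler_pdivlMr.
have eqA : e * (q + A) <= e0.
  by rewrite /e mulrAC ler_pdivrMr// ler_pM2l//; lra.
by lra.
Unshelve. all: by end_near. Qed.

(** The cut-off is at least [1 - e] times the indicator of []b, +oo[], used under nu, and at most
    the indicator of []a, +oo[] plus [e] times [ramp], used under the laws of H_0. Monotonicity in
    [y] goes the wrong way here, so the bound is claimed only near 0. *)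
Lemma levy_tail_le_hit_tail a b e0 : 0 < a -> a < b -> 0 < e0 ->
  \forall y \near 0^'+, levy_tail b - e0 <= hit_tail P a y / S y.
Proof.
move=> a0 ab e00; have [mr r01 [q rq rl]] := ramp_limit.
have b0 : 0 < b by exact: lt_trans ab.
have q0 : 0 <= q.
  rewrite -lee_fin -rq; apply: integral_ge0 => v /=; rewrite in_itv/= andbT => v0.
  by rewrite lee_fin; have /andP[] := r01 _ (ltW v0).
set A := levy_tail b.
have A0 : 0 <= A by exact: fine_ge0.
pose e := e0 / (q + A + 2 + e0).
have qA : 0 < q + A + 2 + e0 by lra.
have e_0 : 0 < e by rewrite divr_gt0.
have e1 : e < 1 by rewrite /e ltr_pdivrMr// mul1r; lra.
have [n [k [n0 hb ha]]] := expR_cutoff (ltW a0) ab e_0.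
have [mc c01 [r cr cl]] := cut_limit k n0.
have Ar : A <= r + e * A.
  rewrite -lee_fin EFinD EFinM -cr -(levy_tailE b0) -(nu_tail (ltW b0)) -[X in (X + _)%E]mul1e.
  apply: integral_le_comb => //.
  - exact: measurable_funS (mtail b).
  - exact: measurable_funS mc.
  - exact: measurable_funS (mtail b).
  - exact: ltW.
  move=> v /=; rewrite in_itv/= andbT => /ltW v0.
  have /andP[? _] := c01 _ v0; have /andP[? _] := tail01 b v0.
  split=> //; rewrite mul1r tailE; case: ltP => [bv|_]; last by rewrite mulr0 addr0.
  by have : 1 - e <= cut n k v := hb _ (ltW bv); rewrite mulr1 lerBlDr.
have lim : start_mean P (cut n k) y / S y - e * (start_mean P ramp y / S y)
    @[y --> 0^'+] --> r - e * q.
  by apply: cvgB => //; apply: cvgM => //; exact: cvg_cst.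
have rq_gt : A - e0 < r - e * q.
  have : e * (q + A + 2) < e0.
    rewrite /e mulrAC ltr_pdivrMr// ltr_pM2l//; lra.
  by lra.
have /cvgr_gt /(_ _ rq_gt) near_lim := lim.
near=> y.
have y0 : 0 < y by near: y; exact: nbhs_right_gt.
have Sy := scale_gt0 hX y0.
have h1 : start_mean P (cut n k) y <= 1 * hit_tail P a y + e * start_mean P ramp y.
  rewrite -(start_mean_tail (ltW a0) (ltW y0)).
  apply: (start_mean_comb y mc (mtail a) mr c01 (tail01 a) r01 ler01 (ltW e_0)).
  move=> v v0; have /andP[_ c1] := c01 _ v0; have /andP[r0 _] := r01 _ v0.
  rewrite mul1r tailE; case: ltP => [_|va]; last by rewrite add0r; exact: ha.
  by rewrite (le_trans c1)// lerDl mulr_ge0// ltW.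
have h2 : A - e0 < start_mean P (cut n k) y / S y - e * (start_mean P ramp y / S y) by near: y.
apply/ltW/(lt_le_trans h2).
by rewrite mulrA -mulrBl ler_wpM2r ?invr_ge0 ?(ltW Sy)// lerBlDr -[X in _ <= X + _]mul1r.
Unshelve. all: by end_near. Qed.

End levy_tail.

(** * Subexponential laws are long-tailed *)

Section long_tail.
Context (R : realType) (F : R -> R) (mu : probability R R).
Hypothesis FE : forall x, mu `]-oo, x]%classic = (F x)%:E.
Hypothesis F0 : forall x, x <= 0 -> F x = 0.
Implicit Types (x y s e : R).

Let F_ge0 x : 0 <= F x. Proof. by rewrite -lee_fin -FE. Qed.

Let F_le1 x : F x <= 1. Proof. by rewrite -lee_fin -FE; exact: probability_le1. Qed.

Let F_nd x y : x <= y -> F x <= F y.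
Proof.
move=> xy; rewrite -lee_fin -2!FE; apply: le_measure; rewrite ?inE//.
by apply: subset_itvl; rewrite bnd_simp.
Qed.

Let mF x : measurable_fun setT (fun y => F (x - y)).
Proof.
by apply: nonincreasing_measurable => // a b ab; rewrite F_nd// lerB.
Qed.

(* For [y] in [`]0, s]] use [F (x - y) <= F x], for [y] in [`]s, x]] use
   [F (x - y) <= F (x - s)]; beyond [x] the integrand vanishes. *)
Lemma convolution_le s x : 0 <= s -> s <= x ->
  \int[mu]_y F (x - y) <= F s * F x + (F x - F s) * F (x - s).
Proof.
move=> s0 sx; have x0 : 0 <= x by exact: le_trans sx.
have FN a b : a <= b -> mu `]a, b]%classic = (F b - F a)%:E.
  move=> ab; have h : ((F a)%:E + mu `]a, b]%classic = (F b)%:E)%E.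
    rewrite -(FE a) -(FE b) -measureU//.
      congr (mu _); apply/seteqP; split=> z /=; rewrite !in_itv/=.
        by case=> [za|/andP[]//]; exact: le_trans ab.
      by move=> zb; case: (leP z a) => za; [left|right; rewrite zb].
    apply/seteqP; split=> z //=; rewrite !in_itv/= => -[za /andP[az _]].
    by move: (lt_le_trans az za); rewrite ltxx.
  move: h; case: (mu `]a, b]%classic) => [r h||]//.
  have Fab : F a + r = F b by apply: EFin_inj; exact: h.
  by rewrite -Fab addrC addKr.
have I0 (A : set R) : measurable A -> measurable_fun setT (fun y : R => (\1_A y : R)%:E).
  by move=> mA; apply/measurable_EFinP; exact: measurable_indic.
rewrite /Rintegral.
have Fin : (\int[mu]_y (F (x - y))%:E <= (F s * F x + (F x - F s) * F (x - s))%:E)%E.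
  have -> : (F s * F x + (F x - F s) * F (x - s))%:E =
    (1%:E * \int[mu]_y (\1_(`]-oo, (0 : R)]%classic : set R) y)%:E +
    ((F x)%:E * \int[mu]_y (\1_(`]-oo, s]%classic : set R) y)%:E +
     (F (x - s))%:E * \int[mu]_y (\1_(`]s, x]%classic : set R) y)%:E))%E.
    have intE (A : set R) c : measurable A -> mu A = c%:E ->
      (\int[mu]_y (\1_A y)%:E = c%:E)%E by move=> mA; rewrite integral_indic// setIT.
    rewrite (intE _ _ (measurable_itv _) (FE 0)).
    rewrite (intE _ _ (measurable_itv _) (FE s)).
    rewrite (intE _ _ (measurable_itv _) (FN _ _ sx)).
    by rewrite (F0 (lexx 0)) mule0 add0e -!EFinM -EFinD; congr (_%:E); ring.
  rewrite -!ge0_integralZl_EFin//; try exact: I0.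
  have mc (c : R) (A : set R) : measurable A ->
      measurable_fun setT (fun y : R => (c%:E * (\1_A y)%:E)%E).
    by move=> mA; apply: measurable_funeM; exact: I0.
  rewrite -[X in (_ <= _ + X)%E]ge0_integralD//;
    try (by apply: mc); try (by move=> y _; rewrite mule_ge0// lee_fin).
  rewrite -ge0_integralD//;
    try (by apply: emeasurable_funD; apply: mc); try (by apply: mc);
    try (by move=> y _; rewrite ?adde_ge0// mule_ge0// lee_fin).
  apply: ge0_le_integral => //.
  - by move=> y _; rewrite lee_fin.
  - by apply/measurable_EFinP; exact: mF.
  - apply: emeasurable_funD; first by apply: measurable_funeM; exact: I0.
    by apply: emeasurable_funD; apply: measurable_funeM; exact: I0.
  move=> y _; rewrite -!EFinM -!EFinD lee_fin !indicE !mem_setE/= !in_itv/=.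
  have [y0|y0] := leP y 0.
    by rewrite mulr1 (le_trans (F_le1 _))// lerDl addr_ge0// mulr_ge0.
  rewrite mulr0 add0r; have [ys|sy] := leP y s.
    by rewrite mulr1/= mulr0 addr0 F_nd// gerBl ltW.
  rewrite mulr0 add0r; have [yx|xy] := leP y x.
    by rewrite mulr1 F_nd// lerB// ltW.
  by rewrite mulr0 F0// subr_le0 ltW.
rewrite -lee_fin fineK// ge0_fin_numE ?(le_lt_trans Fin) ?ltry//.
by apply: integral_ge0 => y _; rewrite lee_fin.
Qed.

(** Let u, v, g be the tails of F at x - s, x and s. By [convolution_le] the tail of the convolution
    at x is at least 2 v - g v + u (g - v). Subexponentiality makes it at most (2 + d) v, whence u
    (g - d) <= (g + d) v as soon as v <= d. *)
Lemma subexponential_long_tail s e : (forall x, 0 < x -> F x < 1) ->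
  F x @[x --> +oo] --> (1 : R) ->
  (1 - \int[mu]_y F (x - y)) / (1 - F x) @[x --> +oo] --> (2 : R) ->
  0 < s -> 0 < e ->
  \forall x \near +oo, 1 - F (x - s) <= (1 + e) * (1 - F x).
Proof.
move=> Flt1 Fcvg cv s0 e0; set g := 1 - F s.
have g0 : 0 < g by rewrite subr_gt0; exact: Flt1.
(* The solution of g + d = (1 + e) (g - d). *)
pose d := g * e / (2 + e).
have d0 : 0 < d by rewrite divr_gt0 ?mulr_gt0// addr_gt0.
have dE : d * (2 + e) = g * e by rewrite divfK// gt_eqF// addr_gt0.
have /cvgrPdist_le /(_ _ d0) n1 := Fcvg.
have /cvgrPdist_le /(_ _ d0) n2 := cv.
near=> x.
have sx : s <= x by near: x; apply: nbhs_pinfty_ge; rewrite num_real.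
have x0 : 0 < x by exact: lt_le_trans sx.
have := convolution_le (ltW s0) sx.
have : `|1 - F x| <= d by near: x.
have : `|2 - (1 - \int[mu]_y F (x - y)) / (1 - F x)| <= d by near: x.
have v0 : 0 < 1 - F x by rewrite subr_gt0; exact: Flt1.
have u0 : 0 <= 1 - F (x - s) by rewrite subr_ge0.
set J := \int[mu]_y _; rewrite !ler_norml => /andP[h1 _] /andP[_ h2] h3.
have {}h1 : 1 - J <= (2 + d) * (1 - F x) by rewrite -ler_pdivrMr//; lra.
have gd : 0 < g - d.
  suff : d < g by lra.
  by rewrite /d ltr_pdivrMr ?addr_gt0// ltr_pM2l//; lra.
have h4 : (1 - F (x - s)) * (g - d) <= (1 - F x) * (g + d).
  have h5 : (1 - F (x - s)) * (g - d) <= (1 - F (x - s)) * (F x - F s).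
    by rewrite ler_wpM2l// /g; lra.
  apply: (le_trans h5); rewrite /g; lra.
rewrite -(ler_pM2r gd) (le_trans h4)// mulrAC mulrC ler_pM2r//; lra.
Unshelve. all: by end_near. Qed.

End long_tail.

(** * Matching upper and lower bounds for large times *)

Section hitting_tail_asymptotics.
Context (R : realType) (m : {measure set R -> \bar R}) (S : cumulative R R).
Context (P : R -> probability (path_space R) R) (p : R -> R -> R -> R).
Context (L : R -> path_space R -> R) (nu : {measure set R -> \bar R}).
Hypothesis hX : reflected_diffusion m S P.
Hypothesis hp : transition_density m P p.
Hypothesis hnu : levy_measure P p L nu.
Hypothesis hA : subexponential (normalized_levy nu).
Implicit Types (x y s t e r : R).
Local Notation F := (normalized_levy nu).
Local Notation tail := (levy_tail nu).

(** If it were 0, the convention on division by 0 would make the normalized distribution function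
    vanish identically, against its limit 1. *)
Let tail1_gt0 : 0 < tail 1.
Proof.
have [mu [_ _ _ F1 _]] := hA.
rewrite lt_neqAle eq_sym fine_ge0// andbT; apply/negP => /eqP c0.
have /cvgr_gt /(_ _ ltr01) /filter_ex[x] := F1.
by rewrite /normalized_levy -/(levy_tail nu 1) c0 invr0 mulr0 ltxx.
Qed.

Let tail_normalized t : 1 <= t -> tail t = tail 1 * (1 - F t).
Proof.
move=> t1; have t0 : 0 < t by exact: lt_le_trans t1.
have h : ((fine (nu `]1, t]%classic))%:E + (tail t)%:E = (tail 1)%:E)%E.
  rewrite -(levy_tailE hX hp hnu t0) -(levy_tailE hX hp hnu ltr01) fineK; last first.
    rewrite ge0_fin_numE//; apply: (@le_lt_trans _ _ (nu `]1, +oo[%classic)).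
      by apply: le_measure; rewrite ?inE//; exact: subset_itvl.
    by rewrite (levy_tailE hX hp hnu ltr01) ltry.
  rewrite -measureU//.
    congr (nu _); apply/seteqP; split=> z /=; rewrite !in_itv/= ?andbT.
      by case=> [/andP[]//|tz]; exact: le_lt_trans tz.
    by move=> z1; case: (leP z t) => zt; [left; rewrite z1|right].
  apply/seteqP; split=> z //=; rewrite !in_itv/= andbT => -[/andP[_ zt] tz].
  by move: (lt_le_trans tz zt); rewrite ltxx.
have {}h : fine (nu `]1, t]%classic) = tail 1 - tail t.
  by apply/eqP; rewrite eq_sym subr_eq eq_sym; apply/eqP/EFin_inj.
rewrite /normalized_levy h -/(levy_tail nu 1) mulrBr mulr1 mulrCA divff ?gt_eqF//.
by rewrite mulr1 subKr.
Qed.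

Let tail_gt0 t : 0 < t -> 0 < tail t.
Proof.
have [mu [_ _ Flt1 _ _]] := hA.
have gt1 s : 1 <= s -> 0 < tail s.
  move=> s1; rewrite tail_normalized// mulr_gt0// subr_gt0 Flt1//.
  exact: lt_le_trans s1.
move=> t0; have := gt1 (Num.max 1 t); rewrite le_max lexx => /(_ isT) h.
apply: lt_le_trans h _; rewrite -lee_fin -!(levy_tailE hX hp hnu)//; last first.
  by rewrite lt_max t0 orbT.
apply: le_measure; rewrite ?inE//; apply: subset_itvr.
by rewrite bnd_simp le_max lexx orbT.
Qed.

Lemma levy_tail_long s e : 0 < s -> 0 < e ->
  \forall t \near +oo, tail (t - s) <= (1 + e) * tail t.
Proof.
move=> s0 e0; have [mu [FE [F0 _] Flt1 F1 F2]] := hA.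
near=> t.
have ts : 1 + s <= t by near: t; apply: nbhs_pinfty_ge; rewrite num_real.
have t1 : 1 <= t by lra.
have st1 : 1 <= t - s by lra.
rewrite (tail_normalized t1) (tail_normalized st1) mulrCA ler_pM2l//; near: t.
exact: (subexponential_long_tail FE F0).
Unshelve. all: by end_near. Qed.

(** The recursion from [y] is divided by [S y], and [y] tends to 0. The unit between [r + 2 + t] and
    [t + r + 3], and the passage from 1/2 to 1/4, are the gaps a < b that the two comparisons with
    nu require. *)
Let levy_tail_le_lower x t r : 0 < x -> 0 <= t -> 0 <= r ->
  tail (t + r + 3) <= hit_tail P t x / S x + tail (1 / 4) * hit_tail P r x * hit_tail P t x.
Proof.
move=> x0 t0 r0; apply/ler_addgt0Pr => e e0.
have a0 : 0 < r + 2 + t by lra.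
have ab : r + 2 + t < t + r + 3 by lra.
suff : \forall y \near (0 : R)^'+, tail (t + r + 3) <=
    hit_tail P t x / S x + tail (1 / 4) * hit_tail P r x * hit_tail P t x + e.
  by move=> /filter_ex[].
near=> y.
have y0 : 0 < y by near: y; exact: nbhs_right_gt.
have yx : y < x by near: y; exact: nbhs_right_lt.
have h1 : tail (t + r + 3) - e <= hit_tail P (r + 2 + t) y / S y.
  by near: y; exact: (levy_tail_le_hit_tail hX hp hnu).
have h2 := hit_tail_recursion hX y0 yx t0 r0.
have Sy := scale_gt0 hX y0.
have h3 : hit_tail P 2^-1 y <= S y * tail (1 / 4).
  by apply: (hit_tail_le_levy_tail hX hp hnu) => //; lra.
rewrite -lerBlDr (le_trans h1)// ler_pdivrMr// (le_trans h2)//.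
move: h3; move: (hit_tail P 2^-1 y) (hit_tail P t x) (hit_tail_ge0 P t x)
  (hit_tail P r x) (hit_tail_ge0 P r x) => h A A0 C C0 h3.
have -> : (A / S x + tail (1 / 4) * C * A) * S y =
    S y / S x * A + S y * tail (1 / 4) * C * A by ring.
by rewrite lerD2l !ler_wpM2r.
Unshelve. all: by end_near. Qed.

Lemma hit_tail_asymptotics x : 0 < x ->
  hit_tail P t x / (S x * tail t) @[t --> +oo] --> (1 : R).
Proof.
move=> x0; have Sx := scale_gt0 hX x0.
apply/cvgrPdist_le => e0 e00.
(* The bounds q <= 1 + e and 1 <= (1 + e)^2 q on the ratio q give |1 - q| <= e0 once 3 e is at most
   both 1 and e0. *)
pose e := Num.min 1 e0 / 3.
have e_0 : 0 < e by rewrite divr_gt0// lt_min ltr01.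
have ee : 3 * e <= e0 by rewrite mulrC divfK// ge_min lexx orbT.
have e1 : 3 * e <= 1 by rewrite mulrC divfK// ge_min lexx.
have c0 : 0 < S x * tail (1 / 4) by rewrite mulr_gt0// tail_gt0// divr_gt0.
(* This [r] depends on [x] and [e] but not on [t]: it makes the second term of [levy_tail_le_lower]
   at most [e] times the first, while the shift [r + 3] stays fixed as [t] grows. *)
have [r r0 hr] := hit_tail_eventually hX (ltW x0) (divr_gt0 e_0 c0).
have s0 : 0 < r + 3 by lra.
have [M [_ hM]] := levy_tail_long s0 e_0.
near=> t.
have t2 : 2 <= t by near: t; apply: nbhs_pinfty_ge; rewrite num_real.
have t0 : 0 < t by lra.
have T0 := tail_gt0 t0.
have u1 : hit_tail P t x <= S x * tail (t - 1).
  by apply: (hit_tail_le_levy_tail hX hp hnu); lra.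
have u2 : tail (t - 1) <= (1 + e) * tail t by near: t; exact: levy_tail_long.
(* Long-tailedness is applied at the later time [t + (r + 3)], so that the tail at [t] is bounded by
   the one that the lower estimate controls. *)
have l1 : tail (t + (r + 3) - (r + 3)) <= (1 + e) * tail (t + (r + 3)).
  apply: hM; have : M < t by near: t; apply: nbhs_pinfty_gt; rewrite num_real.
  by lra.
rewrite addrK in l1.
have l2 := levy_tail_le_lower x0 (ltW t0) r0.
set A := hit_tail P t x in u1 l2 *.
have l3 : tail (t + (r + 3)) <= A / S x * (1 + e).
  rewrite addrA; apply: (le_trans l2); rewrite mulrDr mulr1 lerD2l.
  have -> : A / S x * e = (e / S x) * A by ring.
  rewrite ler_wpM2r ?hit_tail_ge0// ler_pdivlMr//.
  by move: hr; rewrite ler_pdivlMr//; lra.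
set q := A / (S x * tail t).
have qE : A / S x = q * tail t by rewrite /q invfM mulrA divfK// gt_eqF.
have q0 : 0 <= q by rewrite divr_ge0 ?hit_tail_ge0// mulr_ge0 ?ltW.
have q_up : q <= 1 + e.
  rewrite ler_pdivrMr ?mulr_gt0// (le_trans u1)// mulrCA ler_pM2l//.
have q_lo : 1 <= (1 + e) * (1 + e) * q.
  have E : (1 + e) * (1 + e) * q * tail t = (1 + e) * (q * tail t * (1 + e)) by ring.
  by rewrite -(ler_pM2r T0) mul1r E (le_trans l1)// -qE ler_pM2l//; lra.
rewrite ler_norml; apply/andP; split; first by lra.
nra.
Unshelve. all: by end_near. Qed.

End hitting_tail_asymptotics.

Theorem proposition4p2 (R : realType)
  (m : {measure set R -> \bar R}) (S : cumulative R R)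
  (P : R -> probability (path_space R) R)
  (p : R -> R -> R -> R)
  (L : R -> path_space R -> R)
  (nu : {measure set R -> \bar R})
  (hX : reflected_diffusion m S P)
  (hp : transition_density m P p)
  (hL : local_time m P L)
  (hnu : levy_measure P p L nu)
  (hA : subexponential (normalized_levy nu))
  (x : R) (hx : 0 < x) :
  fine (P x [set w | (t%:E < hit 0 w)%E]) / (S x * fine (nu `]t, +oo[%classic))
    @[t --> +oo] --> (1 : R).
Proof. exact: (hit_tail_asymptotics hX hp hnu hA hx). Qed.
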